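(* Let $\mathbb{A}_n$ be the linearly oriented quiver $n\to n-1\to\cdots\to1$, $\widehat{\mathbb{A}}_n$ its biframed quiver, $\mathcal{A}_{\widehat{\mathbb{A}}_n}$ the associated cluster algebra with coefficients, and $\mathcal{C}_{\mathbb{A}_n}$ the cluster category. (a) Any seed of $\mathcal{A}_{\widehat{\mathbb{A}}_n}$ is uniquely determined by its quiver: if $(Q,u)$ and $(Q',u')$ are seeds obtained from the initial seed by finite sequences of mutations and $\varphi:Q\to Q'$ is an isomorphism of ice quivers fixing every frozen vertex, then $u'_{\varphi(v)}=u_v$ for every vertex $v$. (b) Cluster tilting objects correspond to clusters: the assignment $T=T_1\oplus\cdots\oplus T_n\mapsto\{X_{T_1},\dots,X_{T_n}\}\cup\{y_1,\dots,y_n,z_1,\dots,z_n\}$ is a bijection between the isomorphism classes of cluster tilting objects of $\mathcal{C}_{\mathbb{A}_n}$ and the clusters of $\mathcal{A}_{\widehat{\mathbb{A}}_n}$.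
   Context: Let $k$ be an algebraically closed field. **Ice quivers, seeds, clusters.** A cluster quiver is a finite quiver without loops and 2-cycles. An ice quiver of type $(n,m)$ is a cluster quiver with vertex set $\{1,\dots,m\}$ whose vertices $n+1,\dots,m$ are frozen. Mutation $\mu_r$ at a non-frozen vertex $r$: (i) for each path $i\to r\to j$ add an arrow $i\to j$; (ii) reverse all arrows with source or target $r$; (iii) delete the 2-cycles created. Arrows between two frozen vertices are disregarded. A seed is a pair $(Q,u)$ with $Q$ an ice quiver of type $(n,m)$ and $u=\{u_1,\dots,u_m\}$ algebraically independent over $\mathbb{Q}$, $u_v$ attached to vertex $v$; its mutation at $r$ is $(\mu_r(Q),u\setminus\{u_r\}\cup\{u_r'\})$ with $u_ru_r'=\prod_{v\to r}u_v+\prod_{r\to v}u_v$. A cluster is any set $u'$ appearing in a seed $(Q',u')$ obtained from the initial seed by a finite sequence of mutations. **Biframed quiver.** $\widehat{\mathbb{A}}_n$ is the ice quiver of type $(n,3n)$ whose arrows are those of $\mathbb{A}_n$ together with $2n+i\to i$ and $i\to n+i$ for $i=1,\dots,n$. The initial seed of $\mathcal{A}_{\widehat{\mathbb{A}}_n}$ is $\widehat{\mathbb{A}}_n$ with $x_i$ at vertex $i$, $y_i$ at vertex $n+i$, $z_i$ at vertex $2n+i$. **Cluster category and cluster character.** $\mathcal{C}_Q$ is the orbit category of $\mathcal{D}^b(\mathrm{mod}\,kQ)$ by $\tau^{-1}[1]$; $P_i$ is the indecomposable projective module at vertex $i$. A cluster tilting object is $T=T_1\oplus\cdots\oplus T_n$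 with pairwise nonisomorphic indecomposable $T_r$ and $\mathrm{Ext}^1_{\mathcal{C}_Q}(T,T)=0$. $X_?:\mathrm{obj}\,\mathcal{C}_Q\to\mathbb{Q}(x_1,\dots,x_n,y_1,\dots,y_n,z_1,\dots,z_n)$ is the map with $X_{M\oplus N}=X_MX_N$, $X_{P_i[1]}=x_i$, and, for an indecomposable $kQ$-module $V$ with dimension vector $d$, $$X_V=\sum_{0\le e\le d}\chi(\mathrm{Gr}_e(V))\prod_{r=1}^n x_r^{-\langle e,\alpha_r\rangle-\langle\alpha_r,d-e\rangle}\,y_r^{e_r}z_r^{d_r-e_r},$$ where $\mathrm{Gr}_e(V)$ is the Grassmannian of submodules of dimension vector $e$, $\chi$ the Euler characteristic, $\alpha_r$ the dimension vector of the simple $S_r$, and $\langle\ ,\ \rangle$ the Euler form. *)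

(* Defs.v *)
From HB Require Import structures.
From mathcomp Require Import all_boot all_order all_algebra.
From mathcomp Require Import perm finmap mpoly.

Set Implicit Arguments.
Unset Strict Implicit.
Unset Printing Implicit Defensive.

Import GRing.Theory.
Local Open Scope ring_scope.

(* Vertices 1, ..., n of A_n are represented by the elements 0, ..., n - 1 of
   'I_n, and the vertices 1, ..., m of an ice quiver by those of 'I_m. *)

(* A quiver without loops and 2-cycles is given by its numbers of arrows:
   [Q i j] is the number of arrows i -> j.  The vertices v with n <= v are the
   frozen ones. *)
Definition quiver (m : nat) := 'I_m -> 'I_m -> nat.

Definition frozen (n m : nat) (v : 'I_m) : bool := (n <= v)%N.

(* Deleting the 2-cycles between i and j is the truncated subtraction;
   arrows between frozen vertices are dropped. *)
Definition quiver_mut (n m : nat) (r : 'I_m) (Q : quiver m) : quiver m :=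
  fun i j =>
    if (i == r) || (j == r) then Q j i
    else if frozen n i && frozen n j then 0%N
    else ((Q i j + Q i r * Q r j) - (Q j i + Q j r * Q r i))%N.

Definition ice_quiver_iso (n m : nat) (Q Q' : quiver m) (phi : {perm 'I_m}) :=
  (forall v, frozen n v -> phi v = v) /\
  (forall i j, ~~ (frozen n i && frozen n j) -> Q' (phi i) (phi j) = Q i j).

Record seed (m : nat) (K : fieldType) :=
  Seed { sq : quiver m; su : 'I_m -> K }.

Definition seed_mut (n m : nat) (K : fieldType) (r : 'I_m) (S : seed m K) :=
  Seed (quiver_mut n r (sq S))
       (fun v => if v == r
                 then (\prod_w su S w ^+ sq S w r + \prod_w su S w ^+ sq S r w)
                      / su S r
                 else su S v).

Inductive mutation_equivalent (n m : nat) (K : fieldType) (S0 : seed m K) :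
    seed m K -> Prop :=
| mut_refl : mutation_equivalent n S0 S0
| mut_step S r : mutation_equivalent n S0 S -> ~~ frozen n r ->
    mutation_equivalent n S0 (seed_mut n r S).

Definition cluster_of (m : nat) (K : fieldType) (S : seed m K) : {fset K} :=
  [fset su S v | v : 'I_m]%fset.

Definition is_cluster (n m : nat) (K : fieldType) (S0 : seed m K)
    (c : {fset K}) : Prop :=
  exists2 S, mutation_equivalent n S0 S & c = cluster_of S.

Definition arrowA (n : nat) (i j : 'I_n) : bool := i == j.+1 :> nat.

Definition ratfun (n : nat) : fieldType := {fraction {mpoly rat[n + n + n]}}.

Definition xvertex (n : nat) (i : 'I_n) : 'I_(n + n + n) :=
  lshift n (lshift n i).
Definition yvertex (n : nat) (i : 'I_n) : 'I_(n + n + n) :=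
  lshift n (rshift n i).
Definition zvertex (n : nat) (i : 'I_n) : 'I_(n + n + n) := rshift (n + n) i.

Definition indet (n : nat) (v : 'I_(n + n + n)) : ratfun n :=
  FracField.tofrac ('X_v : {mpoly rat[n + n + n]}).

Definition xvar (n : nat) (i : 'I_n) : ratfun n := indet (xvertex i).
Definition yvar (n : nat) (i : 'I_n) : ratfun n := indet (yvertex i).
Definition zvar (n : nat) (i : 'I_n) : ratfun n := indet (zvertex i).

Definition biframedA (n : nat) : quiver (n + n + n) := fun v w =>
  [|| [exists i, exists j, [&& v == xvertex i, w == xvertex j & arrowA i j]],
      [exists i, (v == zvertex i) && (w == xvertex i)] |
      [exists i, (v == xvertex i) && (w == yvertex i)]] : nat.

Definition initial_seed (n : nat) : seed (n + n + n) (ratfun n) :=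
  Seed (@biframedA n) (@indet n).

Section Representations.
Variables (k : fieldType) (n : nat).

(* The space at vertex v is the space of row vectors 'rV_(rdim v); linear maps
   act by multiplication on the right. *)
Record rep := Rep {
  rdim : 'I_n -> nat;
  ract : forall i j : 'I_n, arrowA i j -> 'M[k]_(rdim i, rdim j) }.

Record rhom (V W : rep) := RHom {
  rmap :> forall v, 'M[k]_(rdim V v, rdim W v);
  rmapP : forall i j (a : arrowA i j),
    ract V a *m rmap j = rmap i *m ract W a }.

Program Definition rid V : rhom V V := RHom (rmap := fun v => 1%:M) _.
Next Obligation. by rewrite mulmx1 mul1mx. Qed.

Program Definition rcomp U V W (g : rhom V W) (f : rhom U V) : rhom U W :=
  RHom (rmap := fun v => f v *m g v) _.
Next Obligation. by rewrite mulmxA rmapP -!mulmxA rmapP. Qed.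

Program Definition rzero V W : rhom V W := RHom (rmap := fun v => 0) _.
Next Obligation. by rewrite mulmx0 mul0mx. Qed.

Program Definition radd V W (f g : rhom V W) : rhom V W :=
  RHom (rmap := fun v => f v + g v) _.
Next Obligation. by rewrite mulmxDr mulmxDl !rmapP. Qed.

Program Definition rscale V W (c : k) (f : rhom V W) : rhom V W :=
  RHom (rmap := fun v => c *: f v) _.
Next Obligation. by rewrite -scalemxAr -scalemxAl rmapP. Qed.

Definition rep0 : rep := @Rep (fun=> 0%N) (fun _ _ _ => 0).

Definition rsum (V W : rep) : rep :=
  @Rep (fun v => rdim V v + rdim W v)%N
       (fun i j a => block_mx (ract V a) 0 0 (ract W a)).

Program Definition rhom_sum V V' W W' (f : rhom V V') (g : rhom W W') :
    rhom (rsum V W) (rsum V' W') :=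
  RHom (rmap := fun v => block_mx (f v) 0 0 (g v)) _.
Next Obligation.
by rewrite !mulmx_block !mulmx0 !mul0mx !addr0 !add0r !rmapP.
Qed.

Definition rep_iso V W : Prop := exists (f : rhom V W) (g : rhom W V),
  (forall v, f v *m g v = 1%:M) /\ (forall v, g v *m f v = 1%:M).

Definition rep_is0 V : Prop := forall v, rdim V v = 0%N.

Definition rep_indecomposable V : Prop := ~ rep_is0 V /\
  forall A B, rep_iso V (rsum A B) -> rep_is0 A \/ rep_is0 B.

(* The indecomposable projective P_i = (kQ) e_i has, at vertex v, the basis of
   all paths from i to v: there is one if v <= i, and none otherwise. *)
Definition proj (i : 'I_n) : rep :=
  @Rep (fun v => (v <= i)%N : nat) (fun _ _ _ => const_mx 1).

Record cplx := Cplx {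
  cx :> int -> rep;
  cd : forall p, rhom (cx p) (cx (p + 1));
  cdd : forall p v, cd p v *m cd (p + 1) v = 0;
  cbounded : exists N : nat, forall p, (N < `|p|)%N -> rep_is0 (cx p) }.

Record chain (X Y : cplx) := Chain {
  cmap :> forall p, rhom (X p) (Y p);
  cmapP : forall p v, cd X p v *m cmap (p + 1) v = cmap p v *m cd Y p v }.

Program Definition chid X : chain X X := Chain (cmap := fun p => rid (X p)) _.
Next Obligation. by rewrite mulmx1 mul1mx. Qed.

Program Definition chcomp X Y Z (g : chain Y Z) (f : chain X Y) : chain X Z :=
  Chain (cmap := fun p => rcomp (g p) (f p)) _.
Next Obligation. by rewrite mulmxA cmapP -!mulmxA cmapP. Qed.

Program Definition chzero X Y : chain X Y :=
  Chain (cmap := fun p => rzero (X p) (Y p)) _.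
Next Obligation. by rewrite mulmx0 mul0mx. Qed.

Program Definition chadd X Y (f g : chain X Y) : chain X Y :=
  Chain (cmap := fun p => radd (f p) (g p)) _.
Next Obligation. by rewrite mulmxDr mulmxDl !cmapP. Qed.

Program Definition chscale X Y (c : k) (f : chain X Y) : chain X Y :=
  Chain (cmap := fun p => rscale c (f p)) _.
Next Obligation. by rewrite -scalemxAr -scalemxAl cmapP. Qed.

Program Definition cplx0 : cplx :=
  @Cplx (fun=> rep0) (fun=> rzero rep0 rep0) _ _.
Next Obligation. by rewrite mulmx0. Qed.
Next Obligation. by exists 0%N. Qed.

Program Definition csum (X Y : cplx) : cplx :=
  @Cplx (fun p => rsum (X p) (Y p)) (fun p => rhom_sum (cd X p) (cd Y p)) _ _.
Next Obligation.
by rewrite mulmx_block !mulmx0 !mul0mx !addr0 !add0r !cdd block_mx0.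
Qed.
Next Obligation.
have [[N1 h1] [N2 h2]] := (cbounded X, cbounded Y).
exists (maxn N1 N2) => p; rewrite gtn_max => /andP[l1 l2] v /=.
by rewrite h1 // h2.
Qed.

Program Definition cshift (X : cplx) : cplx :=
  @Cplx (fun p => X (p + 1)) (fun p => rscale (-1) (cd X (p + 1))) _ _.
Next Obligation. by rewrite -scalemxAl -scalemxAr cdd !scaler0. Qed.
Next Obligation.
have [N h] := cbounded X; exists N.+1 => p lp; apply: h.
case: p lp => [m|[|m]] //= lm.
  by rewrite addn1; do 2!apply: ltnW.
by rewrite subn1.
Qed.

Program Definition chshift X Y (f : chain X Y) : chain (cshift X) (cshift Y) :=
  Chain (cmap := fun p => f (p + 1)) _.
Next Obligation. by rewrite -scalemxAl -scalemxAr cmapP. Qed.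

Definition stalk_ob (V : rep) (p : int) : rep :=
  if p is Posz 0 then V else rep0.

Program Definition stalk (V : rep) : cplx :=
  @Cplx (stalk_ob V) (fun p => rzero (stalk_ob V p) (stalk_ob V (p + 1))) _ _.
Next Obligation. by rewrite mulmx0. Qed.
Next Obligation. by exists 0%N => -[[|m]|m]. Qed.

(* f induces isomorphisms on cohomology; the degree is written p + 1, which
   ranges over all integers. *)
Definition qis X Y (f : chain X Y) : Prop := forall p v,
  (forall x : 'rV_(rdim (X (p + 1)) v), x *m cd X (p + 1) v = 0 ->
     (exists y, x *m f (p + 1) v = y *m cd Y p v) ->
     exists z, x = z *m cd X p v) /\
  (forall y : 'rV_(rdim (Y (p + 1)) v), y *m cd Y (p + 1) v = 0 ->
     exists2 x, x *m cd X (p + 1) v = 0 &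
       exists z, y = x *m f (p + 1) v + z *m cd Y p v).

Lemma qis_shift X Y (f : chain X Y) : qis f -> qis (chshift f).
Proof.
move=> qf p v; have [inj surj] := qf (p + 1) v; split=> /=.
  move=> x; rewrite -scalemxAr scaleN1r => /eqP; rewrite oppr_eq0 => /eqP xd.
  case=> y xf; have [|z ->] := inj x xd.
    by exists (- y); rewrite xf -scalemxAr scaleN1r mulNmx.
  by exists (- z); rewrite -scalemxAr scaleN1r mulNmx opprK.
move=> y; rewrite -scalemxAr scaleN1r => /eqP; rewrite oppr_eq0 => /eqP yd.
have [x xd [z ->]] := surj y yd; exists x.
  by rewrite -scalemxAr xd scaler0.
by exists (- z); rewrite -scalemxAr scaleN1r mulNmx opprK.
Qed.

(* D^b(mod kA_n) is the localization of the category of bounded complexes at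
   the quasi-isomorphisms: its morphisms are the expressions generated by chain
   maps and formal inverses of quasi-isomorphisms, up to the congruence [deq].
   Formal sums of parallel expressions are included; as the quasi-isomorphisms
   are closed under direct sums, the localization is additive and these sums
   create no new morphism. *)
Inductive dmor : cplx -> cplx -> Type :=
| dmap X Y : chain X Y -> dmor X Y
| dinv X Y (s : chain X Y) : qis s -> dmor Y X
| dcomp X Y Z : dmor Y Z -> dmor X Y -> dmor X Z
| dadd X Y : dmor X Y -> dmor X Y -> dmor X Y.

Definition did X : dmor X X := dmap (chid X).
Definition dzero X Y : dmor X Y := dmap (chzero X Y).
Definition dscale X Y (c : k) (f : dmor X Y) : dmor X Y :=
  dcomp (dmap (chscale c (chid Y))) f.

Inductive deq : forall X Y, dmor X Y -> dmor X Y -> Prop :=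
| deq_refl X Y (f : dmor X Y) : deq f f
| deq_sym X Y (f g : dmor X Y) : deq f g -> deq g f
| deq_trans X Y (f g h : dmor X Y) : deq f g -> deq g h -> deq f h
| deq_comp X Y Z (g g' : dmor Y Z) (f f' : dmor X Y) :
    deq g g' -> deq f f' -> deq (dcomp g f) (dcomp g' f')
| deq_add X Y (f f' g g' : dmor X Y) :
    deq f f' -> deq g g' -> deq (dadd f g) (dadd f' g')
| deq_compA X Y Z T (h : dmor Z T) (g : dmor Y Z) (f : dmor X Y) :
    deq (dcomp h (dcomp g f)) (dcomp (dcomp h g) f)
| deq_comp1 X Y (f : dmor X Y) : deq (dcomp f (did X)) f
| deq_1comp X Y (f : dmor X Y) : deq (dcomp (did Y) f) f
| deq_addA X Y (f g h : dmor X Y) :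
    deq (dadd f (dadd g h)) (dadd (dadd f g) h)
| deq_addC X Y (f g : dmor X Y) : deq (dadd f g) (dadd g f)
| deq_add0 X Y (f : dmor X Y) : deq (dadd f (dzero X Y)) f
| deq_compDl X Y Z (g g' : dmor Y Z) (f : dmor X Y) :
    deq (dcomp (dadd g g') f) (dadd (dcomp g f) (dcomp g' f))
| deq_compDr X Y Z (g : dmor Y Z) (f f' : dmor X Y) :
    deq (dcomp g (dadd f f')) (dadd (dcomp g f) (dcomp g f'))
| deq_map X Y (f g : chain X Y) :
    (forall p v, f p v = g p v) -> deq (dmap f) (dmap g)
| deq_map_comp X Y Z (g : chain Y Z) (f : chain X Y) :
    deq (dmap (chcomp g f)) (dcomp (dmap g) (dmap f))
| deq_map_add X Y (f g : chain X Y) :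
    deq (dmap (chadd f g)) (dadd (dmap f) (dmap g))
| deq_invK X Y (s : chain X Y) (hs : qis s) :
    deq (dcomp (dinv hs) (dmap s)) (did X)
| deq_Kinv X Y (s : chain X Y) (hs : qis s) :
    deq (dcomp (dmap s) (dinv hs)) (did Y).

Record dfunctor := DFunctor {
  dfob :> cplx -> cplx;
  dfmor : forall X Y, dmor X Y -> dmor (dfob X) (dfob Y);
  dfmor_eq : forall X Y (f g : dmor X Y), deq f g -> deq (dfmor f) (dfmor g);
  dfmor_id : forall X, deq (dfmor (did X)) (did (dfob X));
  dfmor_comp : forall X Y Z (g : dmor Y Z) (f : dmor X Y),
    deq (dfmor (dcomp g f)) (dcomp (dfmor g) (dfmor f));
  dfmor_add : forall X Y (f g : dmor X Y),
    deq (dfmor (dadd f g)) (dadd (dfmor f) (dfmor g)) }.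

Program Definition dfcomp (G F : dfunctor) : dfunctor :=
  @DFunctor (fun X => G (F X)) (fun X Y f => dfmor G (dfmor F f)) _ _ _ _.
Next Obligation. by do 2!apply: dfmor_eq. Qed.
Next Obligation.
by apply: deq_trans (dfmor_id _ _); apply/dfmor_eq/dfmor_id.
Qed.
Next Obligation.
by apply: deq_trans (dfmor_comp _ _ _); apply/dfmor_eq/dfmor_comp.
Qed.
Next Obligation.
by apply: deq_trans (dfmor_add _ _ _); apply/dfmor_eq/dfmor_add.
Qed.

Fixpoint dshift_mor X Y (f : dmor X Y) : dmor (cshift X) (cshift Y) :=
  match f with
  | dmap _ _ f => dmap (chshift f)
  | dinv _ _ _ hs => dinv (qis_shift hs)
  | dcomp _ _ _ g f => dcomp (dshift_mor g) (dshift_mor f)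
  | dadd _ _ f g => dadd (dshift_mor f) (dshift_mor g)
  end.

Lemma dshift_mor_id X : deq (dshift_mor (did X)) (did (cshift X)).
Proof. exact: deq_map. Qed.

Lemma dshift_mor_eq X Y (f g : dmor X Y) :
  deq f g -> deq (dshift_mor f) (dshift_mor g).
Proof.
have z A B : deq (dshift_mor (dzero A B)) (dzero (cshift A) (cshift B)).
  exact: deq_map.
elim=> {X Y f g} /=.
- by move=> *; apply: deq_refl.
- by move=> *; apply: deq_sym.
- by move=> X Y f g h _ fg _ gh; exact: deq_trans gh.
- by move=> *; apply: deq_comp.
- by move=> *; apply: deq_add.
- by move=> *; apply: deq_compA.
- by move=> X Y f; refine (deq_trans (deq_comp _ _) (deq_comp1 _));
    [apply: deq_refl | apply: dshift_mor_id].
- by move=> X Y f; refine (deq_trans (deq_comp _ _) (deq_1comp _));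
    [apply: dshift_mor_id | apply: deq_refl].
- by move=> *; apply: deq_addA.
- by move=> *; apply: deq_addC.
- by move=> X Y f; refine (deq_trans (deq_add _ _) (deq_add0 _));
    [apply: deq_refl | apply: z].
- by move=> *; apply: deq_compDl.
- by move=> *; apply: deq_compDr.
- by move=> X Y f g fg; apply: deq_map => p v; apply: fg.
- by move=> X Y Z g f; refine (deq_trans _ (deq_map_comp _ _)); apply: deq_map.
- by move=> X Y f g; refine (deq_trans _ (deq_map_add _ _)); apply: deq_map.
- by move=> X Y s hs; refine (deq_trans (deq_invK _) _);
    apply/deq_sym/dshift_mor_id.
- by move=> X Y s hs; refine (deq_trans (deq_Kinv _) _);
    apply/deq_sym/dshift_mor_id.
Qed.

Definition dshift : dfunctor :=
  @DFunctor cshift dshift_mor dshift_mor_eq dshift_mor_id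
    (fun _ _ _ _ _ => deq_refl _) (fun _ _ _ _ => deq_refl _).

(* The Auslander-Reiten translation of D^b(mod kA_n) is the autoequivalence tau,
   unique up to natural isomorphism, for which Serre duality
     Hom(X, Y[1]) = D Hom(Y, tau X)
   holds.  Its inverse T is determined in the same way by
     Hom(T Y, X) = D Hom(X, Y[1]),
   which is expressed here as a natural perfect pairing between the two
   (finite-dimensional) spaces of morphisms. *)
Definition is_AR_inverse (T : dfunctor) : Prop :=
  exists pair : forall X Y, dmor (T Y) X -> dmor X (dshift Y) -> k,
    [/\ (forall X Y (f f' : dmor (T Y) X) (g g' : dmor X (dshift Y)),
           deq f f' -> deq g g' -> pair X Y f g = pair X Y f' g'),
        (forall X Y c (f f' : dmor (T Y) X) (g g' : dmor X (dshift Y)),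
           pair X Y (dadd (dscale c f) f') g = c * pair X Y f g + pair X Y f' g
           /\
           pair X Y f (dadd (dscale c g) g') = c * pair X Y f g + pair X Y f g'),
        (forall X X' Y (f : dmor (T Y) X) (h : dmor X X')
                (g : dmor X' (dshift Y)),
           pair X' Y (dcomp h f) g = pair X Y f (dcomp g h)),
        (forall X Y Y' (f : dmor (T Y') X) (u : dmor Y Y')
                (g : dmor X (dshift Y)),
           pair X Y (dcomp f (dfmor T u)) g =
           pair X Y' f (dcomp (dfmor dshift u) g)) &
        (forall X Y (f : dmor (T Y) X),
           (forall g, pair X Y f g = 0) -> deq f (dzero _ _)) /\
        (forall X Y (g : dmor X (dshift Y)),
           (forall f, pair X Y f g = 0) -> deq g (dzero _ _))].

Section Orbit.
Variable F : dfunctor.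

(* The orbit category D^b/F has the objects of D^b, and morphisms
     Hom(X, Y) = \bigoplus_(i in Z) Hom_(D^b)(X, F^i Y).
   To avoid choosing a quasi-inverse of F, an element of the i-th summand is
   represented by a morphism F^a X -> F^b Y of D^b with b - a = i, where
   f : F^a X -> F^b Y is identified with F f : F^(a+1) X -> F^(b+1) Y. *)
Record hterm (X Y : cplx) := HTerm {
  hsrc : nat; htgt : nat;
  hmor : dmor (iter hsrc F X) (iter htgt F Y) }.

Definition hraise X Y (t : hterm X Y) : hterm X Y :=
  @HTerm X Y (hsrc t).+1 (htgt t).+1 (dfmor F (hmor t)).

Lemma hsrc_raise X Y m (t : hterm X Y) :
  hsrc (iter m (@hraise X Y) t) = (m + hsrc t)%N.
Proof. by elim: m => //= m ->. Qed.

Lemma htgt_raise X Y m (t : hterm X Y) :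
  htgt (iter m (@hraise X Y) t) = (m + htgt t)%N.
Proof. by elim: m => //= m ->. Qed.

Lemma hcomp_subproof X Y Z (s : hterm Y Z) (t : hterm X Y) :
  htgt (iter (hsrc s) (@hraise X Y) t) = hsrc (iter (htgt t) (@hraise Y Z) s).
Proof. by rewrite htgt_raise hsrc_raise addnC. Qed.

(* For t : F^a X -> F^b Y and s : F^c Y -> F^d Z, the composite is
   F^b s \o F^c t : F^(c+a) X -> F^(b+d) Z. *)
Definition hcomp X Y Z (s : hterm Y Z) (t : hterm X Y) : hterm X Z :=
  let t' := iter (hsrc s) (@hraise X Y) t in
  let s' := iter (htgt t) (@hraise Y Z) s in
  @HTerm X Z (hsrc t') (htgt s')
    (dcomp (hmor s')
       (ecast b (dmor (iter (hsrc t') F X) (iter b F Y))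
              (hcomp_subproof s t) (hmor t'))).

(* Elements of the direct sum: finite sums of homogeneous elements. *)
Definition omor (X Y : cplx) := seq (hterm X Y).

Definition oid X : omor X X := [:: @HTerm X X 0 0 (did X)].

Definition ocomp X Y Z (g : omor Y Z) (f : omor X Y) : omor X Z :=
  [seq hcomp s t | s <- g, t <- f].

Inductive oeq (X Y : cplx) : omor X Y -> omor X Y -> Prop :=
| oeq_refl f : oeq f f
| oeq_sym f g : oeq f g -> oeq g f
| oeq_trans f g h : oeq f g -> oeq g h -> oeq f h
| oeq_cat f f' g g' : oeq f f' -> oeq g g' -> oeq (f ++ g) (f' ++ g')
| oeq_catC f g : oeq (f ++ g) (g ++ f)
| oeq_mor a b (f g : dmor (iter a F X) (iter b F Y)) :
    deq f g -> oeq [:: HTerm f] [:: HTerm g]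
| oeq_add a b (f g : dmor (iter a F X) (iter b F Y)) :
    oeq [:: HTerm (dadd f g)] [:: HTerm f; HTerm g]
| oeq_zero a b : oeq [:: @HTerm X Y a b (dzero _ _)] [::]
| oeq_raise t : oeq [:: hraise t] [:: t].

Definition ozero X Y : omor X Y := [::].

Definition orbit_iso X Y : Prop := exists (f : omor X Y) (g : omor Y X),
  oeq (ocomp g f) (oid X) /\ oeq (ocomp f g) (oid Y).

Definition orbit_indecomposable X : Prop := ~ orbit_iso X cplx0 /\
  forall A B, orbit_iso X (csum A B) ->
    orbit_iso A cplx0 \/ orbit_iso B cplx0.

Definition orbit_Ext1_eq0 X Y : Prop :=
  forall f : omor X (cshift Y), oeq f (ozero X (cshift Y)).

Definition osum (T : 'I_n -> cplx) : cplx :=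
  \big[csum/cplx0]_(i < n) T i.

Definition cluster_tilting (T : 'I_n -> cplx) : Prop :=
  [/\ forall i, orbit_indecomposable (T i),
      forall i j, i != j -> ~ orbit_iso (T i) (T j) &
      orbit_Ext1_eq0 (osum T) (osum T)].

End Orbit.

(* The cluster category is the orbit category of tau^-1[1]. *)
Definition tau_inv_shift (T : dfunctor) : dfunctor := dfcomp dshift T.

Definition is_rref (e d : nat) (A : 'M[k]_(e, d)) : Prop :=
  exists c : 'I_e -> 'I_d,
    [/\ forall i i' : 'I_e, (i < i')%N -> (c i < c i')%N,
        forall (i : 'I_e) (j : 'I_d), (j < c i)%N -> A i j = 0 &
        forall i i', A i (c i') = (i == i')%:R].

(* Each e-dimensional subspace of k^d is the row space of a unique e x d matrix
   in reduced row echelon form, so that Gr_e(V) is identified with a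
   constructible subset of an affine space, the decomposition of Grassmannians
   into Schubert cells being the decomposition according to the pivots. *)
Definition quiver_Gr (V : rep) (e : 'I_n -> nat) (s : seq k) : Prop :=
  exists U : forall v, 'M[k]_(e v, rdim V v),
    [/\ forall v, is_rref (U v),
        forall i j (a : arrowA i j), (U i *m ract V a <= U j)%MS &
        s = flatten [seq [seq U v i j | i <- enum 'I_(e v),
                                         j <- enum 'I_(rdim V v)]
                    | v <- enum 'I_n]].

Definition quiver_Gr_dim (V : rep) (e : 'I_n -> nat) : nat :=
  (\sum_v e v * rdim V v)%N.

End Representations.

(* Over an algebraically closed field, the constructible subsets of k^N are the
   subsets defined by first-order formulae. *)
Definition constructible (k : closedFieldType) (N : nat) (S : seq k -> Prop) :=
  exists f : GRing.formula k,
    forall s, S s <-> size s = N /\ GRing.holds s f.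

(* [chi N S] is the Euler characteristic of the constructible subset S of k^N.
   The theory used to define it (singular or l-adic cohomology with compact
   support) is replaced by its formal properties: additivity, multiplicativity,
   invariance under constructible bijections, and the value 1 on the affine
   line.  They determine chi on each set decomposed into affine spaces, in
   particular on the Grassmannians of indecomposable representations of A_n. *)
Record is_euler_characteristic (k : closedFieldType)
    (chi : nat -> (seq k -> Prop) -> int) : Prop := {
  chi_ext : forall N S S', (forall s, S s <-> S' s) -> chi N S = chi N S';
  chi_add : forall N S S', constructible N S -> constructible N S' ->
    (forall s, ~ (S s /\ S' s)) ->
    chi N (fun s => S s \/ S' s) = chi N S + chi N S';
  chi_mul : forall N N' S S', constructible N S -> constructible N' S' ->
    chi (N + N')%N (fun s => exists t t', [/\ S t, S' t' & s = t ++ t'])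
    = chi N S * chi N' S';
  chi_bij : forall N N' S S' (G : seq k -> seq k -> Prop),
    constructible N S -> constructible N' S' ->
    constructible (N + N')%N
      (fun s => exists t t', [/\ S t, S' t', G t t' & s = t ++ t']) ->
    (forall t, S t -> exists! t', S' t' /\ G t t') ->
    (forall t', S' t' -> exists! t, S t /\ G t t') ->
    chi N S = chi N' S';
  chi_line : chi 1%N (fun s => size s = 1%N) = 1 }.

Definition euler_form (n : nat) (d e : 'I_n -> int) : int :=
  \sum_i d i * e i - \sum_i \sum_(j | arrowA i j) d i * e j.

Definition dim_simple (n : nat) (r : 'I_n) : 'I_n -> int :=
  fun v => (v == r)%:R.

Section ClusterCharacter.
Variables (k : closedFieldType) (n : nat).
Variable chi : nat -> (seq k -> Prop) -> int.

Definition CC_formula (V : rep k n) : ratfun n :=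
  \sum_(e : {dffun forall v : 'I_n, 'I_(rdim V v).+1})
    (chi (quiver_Gr_dim V (fun v => e v)) (quiver_Gr V (fun v => e v)))%:~R *
    \prod_(r < n)
      (xvar r ^ (- euler_form (fun v => (e v)%:Z) (dim_simple r)
                 - euler_form (dim_simple r)
                     (fun v => (rdim V v)%:Z - (e v)%:Z))
       * yvar r ^+ e r * zvar r ^+ (rdim V r - e r)).

Definition is_cluster_character (F : dfunctor k n) (X : cplx k n -> ratfun n) :=
  [/\ forall M N, orbit_iso F M N -> X M = X N,
      forall M N, X (csum M N) = X M * X N,
      forall i, X (cshift (stalk (proj k i))) = xvar i &
      forall V, rep_indecomposable V -> X (stalk V) = CC_formula V].

Definition tilting_cluster (X : cplx k n -> ratfun n) (T : 'I_n -> cplx k n) :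
    {fset (ratfun n)} :=
  ([fset X (T i) | i : 'I_n] `|`
   ([fset yvar i | i : 'I_n] `|` [fset zvar i | i : 'I_n]))%fset.

End ClusterCharacter.

(* Main.v *)
Require Import Defs.
From HB Require Import structures.
From mathcomp Require Import all_boot all_order all_algebra.
From mathcomp Require Import perm finmap mpoly.
From Stdlib Require Import Setoid Morphisms Classical ClassicalEpsilon.
From Stdlib Require Import FunctionalExtensionality.
From mathcomp Require Import zify ring lra.

(** Why the theorem holds.  Number the vertices of an (n+3)-gon by 0, ..., n+2.
    A diagonal (i,j) with j <= n+1 stands for the interval module M(i,j) with
    support i+1, ..., j-1, and a diagonal (b,n+2) for P_b[1].  Everything is
    translated into diagonals and their crossings.

    Cluster side.  Put x_0 = x_(n+1) = 1, Y_c = y_1 ... y_c, Z_c = z_1 ... z_c,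
    w_c = Y_c / (Z_c x_c x_(c+1)) and S_j = w_0 + ... + w_(j-1).  The lambda length
    of (i,j) is x_i x_j (S_j - S_i) Z_(j-1) / Y_i, and that of (b,n+2) is x_b
    ([gX], [Xd]).  Up to monomials these are 2x2 minors, so they satisfy Ptolemy
    relations ([gX_exchange]).  The initial seed is the fan of all diagonals at
    n+2; the exchange relations are those of flips, provided that the arrows
    between mutable and frozen vertices are the shear coordinates of 2n arcs
    ([shear]).  That a flip changes these arrows by quiver mutation is a case
    check on the quadrilateral of the flipped diagonal and one more triangle
    ([sees_flip_mutable], [sees_flip_frozen], [realize_mut]).  Hence every seed
    comes from a triangulation ([mutation_realize]), and every triangulation
    occurs, as it can be flipped to the fan ([realize_reach]).

    Part (a).  The arrows to the frozen vertices reveal the two middle vertices of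
    the quadrilateral of a diagonal and on which side of it the diagonal lies
    ([shear_data]).  The missing vertex is found in the triangle behind the
    diagonal, whose long side is a longer diagonal, so that a triangulation is
    determined by its quiver by induction on the lengths ([sees_inj]).

    Category side.  Maps out of a two-term complex of projectives are computed by
    letting morphisms of the localization act on cocycles ([act_deq], [mk_full]).
    Since modules over A_n have projective dimension one, this gives the morphisms
    between shifted intervals ([hom_ind0], [hom_ind1]), and every complex is a sum
    of shifted intervals ([decompose]).  Serre duality then forces the translate
    of an interval ([tau_ind]).  As F = tau^-1[1] is faithful, a component of a
    morphism of the orbit category is zero only if it is zero in the derived
    category ([ext1_eq0]); so extensions vanish exactly when diagonals do not
    cross ([compat_fund], [osum_rigid]).

    Comparison.  Submodules of an interval module are its lower parts, and each
    Grassmannian is empty or a point, so that the cluster character of M(i,j) is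
    the lambda length of (i,j) ([CC_intv]).  Orbit isomorphism classes are told
    apart by their characters, through specializations: one at which all
    lambda lengths lie in [6/5,4/3), where no product of two can lie
    ([narrow_values]); and, for each (i,j) with j <= n+1, one at which only its
    lambda length vanishes ([kill_diag]).  The first makes indecomposability in the
    orbit category a statement about characters, and the second leads to the fact
    that the product over a cluster determines the cluster ([prod_Xd_inj]).  Thus
    cluster tilting objects, triangulations and clusters correspond to each other. *)

Set Implicit Arguments.
Unset Strict Implicit.
Unset Printing Implicit Defensive.

Import GRing.Theory.
Local Open Scope ring_scope.

(** * The derived category as an additive category *)

#[global] Hint Resolve deq_refl : core.

Section Additive.
Variables (k : fieldType) (n : nat).
Implicit Types X Y Z W : cplx k n.

#[global] Instance deq_equivalence X Y : Equivalence (@deq k n X Y).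
Proof.
split; [exact: deq_refl | exact: deq_sym | exact: deq_trans].
Qed.

#[global] Instance dcomp_proper X Y Z :
  Proper (@deq k n Y Z ==> @deq k n X Y ==> @deq k n X Z) (@dcomp k n X Y Z).
Proof. by move=> g g' gg f f' ff; apply: deq_comp. Qed.

#[global] Instance dadd_proper X Y :
  Proper (@deq k n X Y ==> @deq k n X Y ==> @deq k n X Y) (@dadd k n X Y).
Proof. by move=> g g' gg f f' ff; apply: deq_add. Qed.

#[global] Instance dscale_proper X Y c :
  Proper (@deq k n X Y ==> @deq k n X Y) (@dscale k n X Y c).
Proof. by move=> f f' ff; exact: deq_comp (deq_refl _) ff. Qed.

Lemma deq0D X Y (f : dmor X Y) : deq (dadd (dzero X Y) f) f.
Proof. by rewrite deq_addC deq_add0. Qed.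

(** Absorption of zero is not among the relations; it follows by induction on the
    expression, where a formal inverse is cancelled against its map. *)
Lemma comp0d X Y Z (f : dmor X Y) : deq (dcomp (dzero Y Z) f) (dzero X Z).
Proof.
elim: f Z => {X Y} [X Y f|X Y s hs|X Y W g IHg f IHf|X Y f IHf g IHg] Z.
- by rewrite -deq_map_comp; apply: deq_map => p v; rewrite /= mulmx0.
- have -> : deq (dzero X Z) (dcomp (dzero Y Z) (dmap s)).
    by rewrite -deq_map_comp; apply: deq_map => p v; rewrite /= mulmx0.
  by rewrite -deq_compA deq_Kinv deq_comp1.
- by rewrite deq_compA IHg IHf.
- by rewrite deq_compDr IHf IHg deq_add0.
Qed.

Lemma compd0 X Y Z (f : dmor Y Z) : deq (dcomp f (dzero X Y)) (dzero X Z).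
Proof.
elim: f X => {Y Z} [Y Z f|Y Z s hs|Y Z W g IHg f IHf|Y Z f IHf g IHg] X.
- by rewrite -deq_map_comp; apply: deq_map => p v; rewrite /= mul0mx.
- have -> : deq (dzero X Z) (dcomp (dmap s) (dzero X Y)).
    by rewrite -deq_map_comp; apply: deq_map => p v; rewrite /= mul0mx.
  by rewrite deq_compA deq_invK deq_1comp.
- by rewrite -deq_compA IHf IHg.
- by rewrite deq_compDl IHf IHg deq_add0.
Qed.

(** Scalars are central: this is what makes morphism spaces vector spaces. *)
Lemma dscale_central X Y c (f : dmor X Y) :
  deq (dcomp f (dmap (chscale c (chid X)))) (dscale c f).
Proof.
rewrite /dscale.
elim: f => {X Y} [X Y f|X Y s hs|X Y W g IHg f IHf|X Y f IHf g IHg].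
- rewrite -!deq_map_comp; apply: deq_map => p v /=.
  by rewrite -scalemxAl mul1mx -scalemxAr mulmx1.
- have e : deq (dcomp (dmap s) (dmap (chscale c (chid X))))
               (dcomp (dmap (chscale c (chid Y))) (dmap s)).
    rewrite -!deq_map_comp; apply: deq_map => p v /=.
    by rewrite -scalemxAl mul1mx -scalemxAr mulmx1.
  rewrite -[X in deq X _]deq_comp1 -(deq_Kinv hs) -deq_compA.
  rewrite (deq_compA (dmap (chscale c (chid Y)))) -e.
  by rewrite 2!deq_compA deq_invK deq_1comp.
- by rewrite -deq_compA IHf deq_compA IHg !deq_compA.
- by rewrite deq_compDl IHf IHg deq_compDr.
Qed.

Lemma dscale_compl X Y Z c (g : dmor Y Z) (f : dmor X Y) :
  deq (dcomp (dscale c g) f) (dscale c (dcomp g f)).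
Proof. by rewrite /dscale deq_compA. Qed.

Lemma dscale_compr X Y Z c (g : dmor Y Z) (f : dmor X Y) :
  deq (dcomp g (dscale c f)) (dscale c (dcomp g f)).
Proof. by rewrite {1}/dscale deq_compA dscale_central dscale_compl. Qed.

Lemma dscale1 X Y (f : dmor X Y) : deq (dscale 1 f) f.
Proof.
rewrite /dscale -[X in deq _ X]deq_1comp; apply: deq_comp; last by [].
by apply: deq_map => p v; rewrite /= scale1r.
Qed.

Lemma dscale0 X Y (f : dmor X Y) : deq (dscale 0 f) (dzero X Y).
Proof.
rewrite /dscale -[X in deq _ X](@comp0d X Y Y f); apply: deq_comp; last by [].
by apply: deq_map => p v; rewrite /= scale0r.
Qed.

Lemma dscaler0 X Y c : deq (dscale c (dzero X Y)) (dzero X Y).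
Proof. by rewrite /dscale compd0. Qed.

Lemma dscaleA X Y a b (f : dmor X Y) :
  deq (dscale a (dscale b f)) (dscale (a * b) f).
Proof.
rewrite /dscale deq_compA -deq_map_comp; apply: deq_comp; last by [].
by apply: deq_map => p v; rewrite /= -scalemxAr mulmx1 scalerA.
Qed.

Lemma dscaleDl X Y a b (f : dmor X Y) :
  deq (dscale (a + b) f) (dadd (dscale a f) (dscale b f)).
Proof.
rewrite /dscale -deq_compDl -deq_map_add; apply: deq_comp; last by [].
by apply: deq_map => p v; rewrite /= scalerDl.
Qed.

Lemma daddN X Y (f : dmor X Y) : deq (dadd f (dscale (-1) f)) (dzero X Y).
Proof. by rewrite -{1}[f]dscale1 -dscaleDl subrr dscale0. Qed.

Lemma dadd_eq0 X Y (f g : dmor X Y) :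
  deq (dadd f (dscale (-1) g)) (dzero X Y) -> deq f g.
Proof.
move=> h; rewrite -[f]deq_add0 -(daddN g) [dadd g _]deq_addC deq_addA h.
by rewrite deq0D.
Qed.

Lemma dscale_eq0 X Y c (f : dmor X Y) : c != 0 ->
  deq (dscale c f) (dzero X Y) -> deq f (dzero X Y).
Proof.
by move=> c0 h; rewrite -[f]dscale1 -(mulVf c0) -dscaleA h dscaler0.
Qed.

Definition diso X Y := exists (f : dmor X Y) (g : dmor Y X),
  deq (dcomp g f) (did X) /\ deq (dcomp f g) (did Y).

Lemma diso_refl X : diso X X.
Proof. by exists (did X), (did X); rewrite deq_comp1. Qed.

Lemma diso_sym X Y : diso X Y -> diso Y X.
Proof. by case=> f [g [h1 h2]]; exists g, f. Qed.

Lemma diso_trans Y X Z : diso X Y -> diso Y Z -> diso X Z.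
Proof.
case=> f [g [h1 h2]] [f' [g' [h1' h2']]].
exists (dcomp f' f), (dcomp g g'); split.
  by rewrite -deq_compA (deq_compA g' f' f) h1' deq_1comp.
by rewrite -deq_compA (deq_compA f g g') h2 deq_1comp.
Qed.

Lemma qis_diso X Y (s : chain X Y) : qis s -> diso X Y.
Proof.
by move=> hs; exists (dmap s), (dinv hs); rewrite deq_invK deq_Kinv.
Qed.

Lemma chain_diso X Y (f : chain X Y) (g : chain Y X) :
  (forall p v, f p v *m g p v = 1%:M) -> (forall p v, g p v *m f p v = 1%:M) ->
  diso X Y.
Proof.
move=> fg gf; exists (dmap f), (dmap g); rewrite -!deq_map_comp.
by split; apply: deq_map => p v /=.
Qed.

Lemma dfmor_diso (F : dfunctor k n) X Y : diso X Y -> diso (F X) (F Y).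
Proof.
case=> f [g [h1 h2]]; exists (dfmor F f), (dfmor F g).
by rewrite -!dfmor_comp -!dfmor_id; split; apply: dfmor_eq.
Qed.

#[global] Instance dfmor_proper (F : dfunctor k n) X Y :
  Proper (@deq k n X Y ==> @deq k n (F X) (F Y)) (@dfmor k n F X Y).
Proof. by move=> f g; apply: dfmor_eq. Qed.

Lemma dfmor0 (F : dfunctor k n) X Y : deq (dfmor F (dzero X Y)) (dzero _ _).
Proof.
have h : deq (dadd (dfmor F (dzero X Y)) (dfmor F (dzero X Y)))
             (dfmor F (dzero X Y)).
  by rewrite -dfmor_add deq_add0.
rewrite -[dfmor _ _ in X in deq X _]deq_add0.
by rewrite -(daddN (dfmor F (dzero X Y))) deq_addA h.
Qed.

Definition dhom0 X Y := forall f : dmor X Y, deq f (dzero X Y).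

Lemma dhom0_iso X Y X' Y' : diso X X' -> diso Y Y' -> dhom0 X Y -> dhom0 X' Y'.
Proof.
move=> [f [g [h1 h2]]] [f' [g' [h1' h2']]] h0 u.
rewrite -[u]deq_1comp -[u]deq_comp1 -h2 -h2'.
rewrite -!deq_compA (deq_compA u f g) (deq_compA g' (dcomp u f) g).
by rewrite (h0 (dcomp g' (dcomp u f))) comp0d compd0.
Qed.

End Additive.

(** * Finite direct sums *)

Section Biproducts.
Variables (k : fieldType) (n : nat).
Implicit Types X Y Z W : cplx k n.

Program Definition chain_inl X Y : chain X (csum X Y) :=
  Chain (cmap := fun p => RHom (rmap := fun v => row_mx 1%:M 0) _) _.
Next Obligation. by rewrite mul_mx_row mul_row_block !mulmx0 !mul0mx !addr0 mulmx1 mul1mx. Qed.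
Next Obligation. by rewrite mul_mx_row mul_row_block !mulmx0 !mul0mx !addr0 mulmx1 mul1mx. Qed.

Program Definition chain_inr X Y : chain Y (csum X Y) :=
  Chain (cmap := fun p => RHom (rmap := fun v => row_mx 0 1%:M) _) _.
Next Obligation. by rewrite mul_mx_row mul_row_block !mulmx0 !mul0mx !add0r mulmx1 mul1mx. Qed.
Next Obligation. by rewrite mul_mx_row mul_row_block !mulmx0 !mul0mx !add0r mulmx1 mul1mx. Qed.

Program Definition chain_prl X Y : chain (csum X Y) X :=
  Chain (cmap := fun p => RHom (rmap := fun v => col_mx 1%:M 0) _) _.
Next Obligation. by rewrite mul_block_col mul_col_mx !mulmx0 !mul0mx !addr0 mulmx1 mul1mx. Qed.
Next Obligation. by rewrite mul_block_col mul_col_mx !mulmx0 !mul0mx !addr0 mulmx1 mul1mx. Qed.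

Program Definition chain_prr X Y : chain (csum X Y) Y :=
  Chain (cmap := fun p => RHom (rmap := fun v => col_mx 0 1%:M) _) _.
Next Obligation. by rewrite mul_block_col mul_col_mx !mulmx0 !mul0mx !add0r mulmx1 mul1mx. Qed.
Next Obligation. by rewrite mul_block_col mul_col_mx !mulmx0 !mul0mx !add0r mulmx1 mul1mx. Qed.

Lemma inlK X Y : deq (dcomp (dmap (chain_prl X Y)) (dmap (chain_inl X Y))) (did X).
Proof.
rewrite -deq_map_comp; apply: deq_map => p v /=.
by rewrite mul_row_col mulmx1 mul0mx addr0.
Qed.

Lemma inrK X Y : deq (dcomp (dmap (chain_prr X Y)) (dmap (chain_inr X Y))) (did Y).
Proof.
rewrite -deq_map_comp; apply: deq_map => p v /=.
by rewrite mul_row_col mulmx1 mul0mx add0r.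
Qed.

Lemma inl_prr X Y : deq (dcomp (dmap (chain_prr X Y)) (dmap (chain_inl X Y))) (dzero _ _).
Proof.
rewrite -deq_map_comp; apply: deq_map => p v /=.
by rewrite mul_row_col mulmx0 mul0mx addr0.
Qed.

Lemma inr_prl X Y : deq (dcomp (dmap (chain_prl X Y)) (dmap (chain_inr X Y))) (dzero _ _).
Proof.
rewrite -deq_map_comp; apply: deq_map => p v /=.
by rewrite mul_row_col mulmx0 mul0mx addr0.
Qed.

Lemma csum_id X Y : deq (dadd (dcomp (dmap (chain_inl X Y)) (dmap (chain_prl X Y)))
   (dcomp (dmap (chain_inr X Y)) (dmap (chain_prr X Y)))) (did _).
Proof.
rewrite -!deq_map_comp -deq_map_add; apply: deq_map => p v /=.
rewrite !mul_col_row add_block_mx !mulmx0 !mul0mx !mulmx1 !addr0 !add0r.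
by rewrite -scalar_mx_block.
Qed.

Definition dsumm (I : Type) (s : seq I) X Y (F : I -> dmor X Y) : dmor X Y :=
  foldr (fun i f => dadd (F i) f) (dzero X Y) s.

Lemma dsumm_compr (I : Type) (s : seq I) X Y Z (F : I -> dmor X Y) (g : dmor Y Z) :
  deq (dcomp g (dsumm s F)) (dsumm s (fun i => dcomp g (F i))).
Proof. by elim: s => [|i s IHs] /=; rewrite ?compd0 // deq_compDr IHs. Qed.

Lemma dsumm_compl (I : Type) (s : seq I) X Y Z (F : I -> dmor Y Z) (g : dmor X Y) :
  deq (dcomp (dsumm s F) g) (dsumm s (fun i => dcomp (F i) g)).
Proof. by elim: s => [|i s IHs] /=; rewrite ?comp0d // deq_compDl IHs. Qed.

Lemma dsumm_eq (I : eqType) (s : seq I) X Y (F G : I -> dmor X Y) :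
  {in s, forall i, deq (F i) (G i)} -> deq (dsumm s F) (dsumm s G).
Proof.
elim: s => [|i s IHs] FG //=; rewrite (FG i) ?mem_head //.
by rewrite IHs // => j js; apply: FG; rewrite in_cons js orbT.
Qed.

Lemma dsumm0 (I : eqType) (s : seq I) X Y (F : I -> dmor X Y) :
  {in s, forall i, deq (F i) (dzero X Y)} -> deq (dsumm s F) (dzero X Y).
Proof.
elim: s => [|i s IHs] F0 //=; rewrite (F0 i) ?mem_head // deq0D.
by apply: IHs => j js; apply: F0; rewrite in_cons js orbT.
Qed.

Lemma dsumm1 (I : eqType) (s : seq I) X Y (F : I -> dmor X Y) i :
  uniq s -> i \in s -> {in s, forall j, j != i -> deq (F j) (dzero X Y)} ->
  deq (dsumm s F) (F i).
Proof.
elim: s => [|j s IHs] //= /andP[js us]; rewrite in_cons.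
have [-> _ F0|ij /= si F0] := eqVneq i j.
  rewrite dsumm0 ?deq_add0 // => l ls; apply: F0; first by rewrite in_cons ls orbT.
  by apply: contraNneq js => <-.
rewrite (F0 j) ?mem_head 1?eq_sym // deq0D; apply: IHs => // l ls.
by apply: F0; rewrite in_cons ls orbT.
Qed.

Lemma dfmor_dsumm (G : dfunctor k n) (I : Type) (s : seq I) X Y (F : I -> dmor X Y) :
  deq (dfmor G (dsumm s F)) (dsumm s (fun i => dfmor G (F i))).
Proof. by elim: s => [|i s IHs] /=; rewrite ?dfmor0 // dfmor_add IHs. Qed.

(** Direct sums are described by inclusions and projections, a form which every
    additive functor preserves. *)
Definition bip (I : eqType) (s : seq I) (T : I -> cplx k n) (O : cplx k n)
    (io : forall i, dmor (T i) O) (pi : forall i, dmor O (T i)) : Prop :=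
  [/\ {in s, forall i, deq (dcomp (pi i) (io i)) (did (T i))},
      {in s &, forall i j, i != j -> deq (dcomp (pi j) (io i)) (dzero _ _)} &
      deq (dsumm s (fun i => dcomp (io i) (pi i))) (did O)].

Definition has_bip (I : eqType) (s : seq I) (T : I -> cplx k n) (O : cplx k n) :=
  exists io pi, @bip I s T O io pi.

Lemma bip_eq0l (I : eqType) (s : seq I) T O io pi (Y : cplx k n) (f : dmor O Y) :
  @bip I s T O io pi -> {in s, forall i, deq (dcomp f (io i)) (dzero _ _)} ->
  deq f (dzero O Y).
Proof.
move=> [_ _ h] f0; rewrite -[f]deq_comp1 -h dsumm_compr dsumm0 // => i si.
by rewrite deq_compA f0 // comp0d.
Qed.

Lemma bip_eq0r (I : eqType) (s : seq I) T O io pi (Y : cplx k n) (f : dmor Y O) :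
  @bip I s T O io pi -> {in s, forall i, deq (dcomp (pi i) f) (dzero _ _)} ->
  deq f (dzero Y O).
Proof.
move=> [_ _ h] f0; rewrite -[f]deq_1comp -h dsumm_compl dsumm0 // => i si.
by rewrite -deq_compA f0 // compd0.
Qed.

Lemma has_bip_nil (I : eqType) T : @has_bip I [::] T (cplx0 k n).
Proof.
exists (fun i => dzero _ _), (fun i => dzero _ _); split=> //=.
by apply: deq_map => p v; apply/matrixP => -[].
Qed.

Lemma has_bip_cons (I : eqType) (s : seq I) T O i :
  i \notin s -> has_bip s T O -> has_bip (i :: s) T (csum (T i) O).
Proof.
move=> si [io [pi [h1 h2 h3]]].
pose io' j : dmor (T j) (csum (T i) O) :=
  match eqVneq j i with
  | EqNotNeq e => ecast x (dmor (T x) _) (esym e) (dmap (chain_inl (T i) O))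
  | NeqNotEq _ => dcomp (dmap (chain_inr (T i) O)) (io j) end.
pose pi' j : dmor (csum (T i) O) (T j) :=
  match eqVneq j i with
  | EqNotNeq e => ecast x (dmor _ (T x)) (esym e) (dmap (chain_prl (T i) O))
  | NeqNotEq _ => dcomp (pi j) (dmap (chain_prr (T i) O)) end.
have iE : io' i = dmap (chain_inl (T i) O).
  by rewrite /io'; case: eqVneq => [e|/eqP//]; rewrite eq_axiomK.
have pE : pi' i = dmap (chain_prl (T i) O).
  by rewrite /pi'; case: eqVneq => [e|/eqP//]; rewrite eq_axiomK.
have ni j : j \in s -> j != i by move=> js; apply: contraNneq si => <-.
have iE' j : j \in s -> io' j = dcomp (dmap (chain_inr (T i) O)) (io j).
  by rewrite /io'; case: eqVneq => [e /ni/eqP//|//].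
have pE' j : j \in s -> pi' j = dcomp (pi j) (dmap (chain_prr (T i) O)).
  by rewrite /pi'; case: eqVneq => [e /ni/eqP//|//].
exists io', pi'; split=> [j|j l|/=].
- rewrite in_cons; have [-> _|_ /= js] := eqVneq j i; first by rewrite iE pE inlK.
  rewrite iE' // pE' // -deq_compA (deq_compA (dmap (chain_prr _ _))) inrK.
  by rewrite deq_1comp h1.
- rewrite !in_cons; have [-> _|_ /= js] := eqVneq j i.
    have [//|_ /= ls _] := eqVneq l i.
    by rewrite iE pE' // -deq_compA inl_prr compd0.
  have [-> _ _|_ /= ls jl] := eqVneq l i.
    by rewrite iE' // pE deq_compA inr_prl comp0d.
  rewrite iE' // pE' // -deq_compA (deq_compA (dmap (chain_prr _ _))) inrK.
  by rewrite deq_1comp h2.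
- rewrite iE pE -csum_id; apply: deq_add; first by [].
  transitivity (dcomp (dcomp (dmap (chain_inr (T i) O)) (dsumm s (fun j => dcomp (io j) (pi j))))
    (dmap (chain_prr (T i) O))); last by rewrite h3 deq_comp1.
  rewrite dsumm_compr dsumm_compl; apply: dsumm_eq => j js.
  by rewrite iE' // pE' // !deq_compA.
Qed.

Definition csums (I : Type) (s : seq I) (T : I -> cplx k n) : cplx k n :=
  foldr (fun i O => csum (T i) O) (cplx0 k n) s.

Lemma has_bip_csums (I : eqType) (s : seq I) T : uniq s -> has_bip s T (csums s T).
Proof.
elim: s => [|i s IHs] /=; first by move=> _; apply: has_bip_nil.
by move=> /andP[si us]; apply: has_bip_cons => //; apply: IHs.
Qed.

Lemma osumE (T : 'I_n -> cplx k n) : osum T = csums (index_enum 'I_n) T.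
Proof. by rewrite /osum unlock. Qed.

Lemma bip_diso (I : eqType) (s : seq I) T T' O O' : uniq s ->
  {in s, forall i, diso (T i) (T' i)} ->
  @has_bip I s T O -> @has_bip I s T' O' -> diso O O'.
Proof.
move=> us iso [io [pi [h1 h2 h3]]] [io' [pi' [h1' h2' h3']]].
have [t [e e1 e2]] : exists (t : forall i, dmor (T i) (T' i)),
    exists2 e : (forall i, dmor (T' i) (T i)),
     {in s, forall i, deq (dcomp (e i) (t i)) (did _)} &
     {in s, forall i, deq (dcomp (t i) (e i)) (did _)}.
  elim: s us iso {h1 h2 h3 h1' h2' h3'} => [|i s IHs] /= us iso.
    by exists (fun i => dzero _ _), (fun i => dzero _ _).
  have /andP[si {}us] := us.
  have [||t [e e1 e2]] := IHs => [//|j js|]; first by apply: iso; rewrite in_cons js orbT.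
  have [f [g [fg gf]]] := iso i (mem_head _ _).
  exists (fun j => match eqVneq j i with
    | EqNotNeq e => ecast x (dmor (T x) (T' x)) (esym e) f | _ => t j end).
  exists (fun j => match eqVneq j i with
    | EqNotNeq e => ecast x (dmor (T' x) (T x)) (esym e) g | _ => e j end).
    move=> j; rewrite in_cons; case: eqVneq => [e' _|_ /=]; last exact: e1.
    by subst j.
  move=> j; rewrite in_cons; case: eqVneq => [e' _|_ /=]; last exact: e2.
  by subst j.
exists (dsumm s (fun i => dcomp (io' i) (dcomp (t i) (pi i)))).
exists (dsumm s (fun i => dcomp (io i) (dcomp (e i) (pi' i)))).
split; [rewrite -h3 | rewrite -h3'].
  rewrite dsumm_compl; apply: dsumm_eq => i si.
  rewrite dsumm_compr (dsumm1 us si) => [|j js ji].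
    rewrite -!deq_compA (deq_compA (pi' i)) h1' // deq_1comp.
    by rewrite (deq_compA (e i)) e1 // deq_1comp.
  by rewrite -!deq_compA (deq_compA (pi' i)) h2' // comp0d !compd0.
rewrite dsumm_compl; apply: dsumm_eq => i si.
rewrite dsumm_compr (dsumm1 us si) => [|j js ji].
  rewrite -!deq_compA (deq_compA (pi i)) h1 // deq_1comp.
  by rewrite (deq_compA (t i)) e2 // deq_1comp.
by rewrite -!deq_compA (deq_compA (pi i)) h2 // comp0d !compd0.
Qed.

Lemma csum_diso X X' Y Y' : diso X X' -> diso Y Y' -> diso (csum X Y) (csum X' Y').
Proof.
move=> hX hY.
have b (A B : cplx k n) : has_bip [:: true; false] (fun b => if b then A else B) (csum A B).
  exists (fun b => match b return dmor (if b then A else B) (csum A B) with true => dmap (chain_inl A B) | false => dmap (chain_inr A B) end).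
  exists (fun b => match b return dmor (csum A B) (if b then A else B) with true => dmap (chain_prl A B) | false => dmap (chain_prr A B) end).
  split=> [[] _|[] [] _ _ //|]; rewrite ?inlK ?inrK ?inl_prr ?inr_prl //.
  by rewrite /= deq_add0 csum_id.
by apply: bip_diso (b X Y) (b X' Y') => // -[].
Qed.

End Biproducts.

(** * Mapping cones and homotopies *)

Section Cones.
Variables (k : fieldType) (n : nat).
Implicit Types X Y Z W : cplx k n.

Program Definition cone X Y (f : chain X Y) : cplx k n :=
  @Cplx k n (fun t => rsum (X (t + 1)) (Y t))
    (fun t => RHom (rmap := fun v => block_mx (- cd X (t + 1) v) (f (t + 1) v) 0 (cd Y t v)) _) _ _.
Next Obligation.
rewrite !mulmx_block !mulmx0 !mul0mx !addr0 !add0r mulmxN mulNmx !rmapP.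
by [].
Qed.
Next Obligation.
rewrite mulmx_block !mulmx0 !mul0mx !addr0 !add0r mulmxN mulNmx opprK !cdd.
by rewrite mulNmx cmapP addNr block_mx0.
Qed.
Next Obligation.
have [[N1 h1] [N2 h2]] := (cbounded X, cbounded Y).
exists (maxn N1 N2).+1 => p lp v /=.
rewrite h2 ?h1 //; lia.
Qed.

Program Definition cone_in X Y (f : chain X Y) : chain Y (cone f) :=
  Chain (cmap := fun p => RHom (rmap := fun v => row_mx 0 1%:M) _) _.
Next Obligation. by rewrite mul_mx_row mul_row_block !mulmx0 !mul0mx !add0r mulmx1 mul1mx. Qed.
Next Obligation. by rewrite mul_mx_row mul_row_block !mulmx0 !mul0mx !add0r mulmx1 mul1mx. Qed.

(** Zero cohomology, elementwise *)
Definition acyclic X := forall p v (x : 'rV_(rdim (X (p + 1)) v)),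
  x *m cd X (p + 1) v = 0 -> exists y, x = y *m cd X p v.

Lemma acyclic_diso0 X : acyclic X -> diso X (cplx0 k n).
Proof.
move=> aX; apply: (@qis_diso _ _ _ _ (chzero X (cplx0 k n))) => p v; split.
  by move=> x xd _; apply: aX.
by move=> y _; exists 0; [rewrite mul0mx | exists 0; apply/matrixP => ? [[]]].
Qed.

Lemma cplx0_id : deq (did (cplx0 k n)) (dzero _ _).
Proof. by apply: deq_map => p v; apply/matrixP => [[]]. Qed.

Lemma diso0_id X : diso X (cplx0 k n) -> deq (did X) (dzero X X).
Proof.
move=> [f [g [<- _]]]; rewrite -[g]deq_comp1 cplx0_id compd0 comp0d.
by [].
Qed.

Lemma cone_id_acyclic X : acyclic (cone (chid X)).
Proof.
move=> p v x; rewrite -[x]hsubmxK; set a := lsubmx x; set b := rsubmx x.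
rewrite /= mul_row_block mulmx1 mulmx0 addr0 => /eqP; rewrite row_mx_eq0.
case/andP=> _; rewrite addr_eq0 => /eqP ab.
exists (row_mx b 0); rewrite mul_row_block !mul0mx !addr0 mulmx1 mulmxN ab.
by [].
Qed.

(** A null-homotopic map factors through the contractible cone of an identity. *)
Lemma homotopic_deq0 X Y (u : chain X Y) (h : forall t, rhom (X (t + 1)) (Y t)) :
  (forall t v, u (t + 1) v = cd X (t + 1) v *m h (t + 1) v + h t v *m cd Y t v) ->
  deq (dmap u) (dzero X Y).
Proof.
move=> hu; unshelve epose (b := @Chain k n (cone (chid X)) Y
  (fun t => @RHom k n (cone (chid X) t) (Y t) (fun v => col_mx (h t v) (u t v)) _) _).
- move=> i j a /=; rewrite mul_block_col mul_col_mx !mul0mx add0r addr0 !rmapP.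
  by [].
- move=> p v /=; rewrite mul_block_col mul_col_mx mul0mx add0r cmapP mul1mx.
  by rewrite hu mulNmx addKr.
have -> : deq (dmap u) (dcomp (dmap b) (dmap (cone_in (chid X)))).
  rewrite -deq_map_comp; apply: deq_map => p v /=.
  by rewrite mul_row_col mul0mx mul1mx add0r.
rewrite -[dmap b]deq_comp1 (diso0_id (acyclic_diso0 (@cone_id_acyclic X))).
by rewrite compd0 comp0d.
Qed.

End Cones.

(** * Paths and projective representations *)

Section Paths.
Variables (k : fieldType) (n : nat).
Implicit Types V W : rep k n.

Definition ract0 V (v u : 'I_n) : 'M[k]_(rdim V v, rdim V u) :=
  if arrowA v u =P true is ReflectT e then ract V e else 0.

Lemma ract0E V v u (a : arrowA v u) : ract0 V v u = ract V a.
Proof. by rewrite /ract0; case: eqP => // e; rewrite (bool_irrelevance e a). Qed.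

Lemma ract0_0 V v u : ~~ arrowA v u -> ract0 V v u = 0.
Proof. by move=> a; rewrite /ract0; case: eqP => // e; rewrite e in a. Qed.

Lemma ract0_rmap V W (f : rhom V W) v u : ract0 V v u *m f u = f v *m ract0 W v u.
Proof.
case: (boolP (arrowA v u)) => a; first by rewrite !(ract0E _ a) rmapP.
by rewrite !ract0_0 // mulmx0 mul0mx.
Qed.

(** The identity when v = u; written entrywise to avoid a cast *)
Definition idc V (v u : 'I_n) : 'M[k]_(rdim V v, rdim V u) :=
  \matrix_(a, b) ((v == u) && (a == b :> nat))%:R.

Lemma idc1 V v : idc V v v = 1%:M.
Proof. by apply/matrixP => a b; rewrite !mxE eqxx. Qed.

Lemma idc0 V v u : v != u -> idc V v u = 0.
Proof. by move=> /negbTE e; apply/matrixP => a b; rewrite !mxE e. Qed.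

Fixpoint pathm V (m : nat) (v u : 'I_n) : 'M[k]_(rdim V v, rdim V u) :=
  if m is m'.+1 then \sum_w ract0 V v w *m pathm V m' w u else idc V v u.

Lemma pathmSr V m v u : pathm V m.+1 v u = \sum_w pathm V m v w *m ract0 V w u.
Proof.
elim: m v u => [|m IHm] v u.
  rewrite /= (bigD1 u) //= idc1 mulmx1 big1 => [|w wu]; last first.
    by rewrite idc0 // mulmx0.
  rewrite addr0 (bigD1 v) //= idc1 mul1mx big1 => [|w wv]; last first.
    by rewrite idc0 1?eq_sym // mul0mx.
  by rewrite addr0.
rewrite /= -/(pathm V m.+1 _ _).
under eq_bigr => w _ do rewrite -/(pathm V m.+1 w u) IHm mulmx_sumr.
rewrite exchange_big /=; apply: eq_bigr => w _.
by rewrite mulmx_suml; apply: eq_bigr => w' _; rewrite mulmxA.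
Qed.

Lemma pathm_rmap V W (f : rhom V W) m v u :
  pathm V m v u *m f u = f v *m pathm W m v u.
Proof.
elim: m v u => [|m IHm] v u /=.
  have [->|vu] := eqVneq v u; first by rewrite !idc1 mulmx1 mul1mx.
  by rewrite !idc0 // mulmx0 mul0mx.
rewrite mulmx_suml mulmx_sumr; apply: eq_bigr => w _.
by rewrite -mulmxA IHm !mulmxA ract0_rmap.
Qed.

Definition path V (v u : 'I_n) := pathm V (v - u) v u.

Lemma path_id V v : path V v v = 1%:M.
Proof. by rewrite /path subnn /= idc1. Qed.

Lemma path_rmap V W (f : rhom V W) v u : path V v u *m f u = f v *m path W v u.
Proof. exact: pathm_rmap. Qed.

Lemma path_stepl V (v w u : 'I_n) (a : arrowA v w) : (u <= w)%N ->
  path V v u = ract V a *m path V w u.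
Proof.
move=> uw; have vw : v = w.+1 :> nat by apply/eqP.
rewrite /path vw subSn //= (bigD1 w) //= (ract0E _ a) big1 ?addr0 // => x xw.
rewrite ract0_0 ?mul0mx // /arrowA vw eqSS; apply: contra xw => /eqP e.
by apply/eqP/val_inj.
Qed.

Lemma path_stepr V (v w u : 'I_n) (a : arrowA w u) : (w <= v)%N ->
  path V v u = path V v w *m ract V a.
Proof.
move=> wv; have wu : w = u.+1 :> nat by apply/eqP.
have e : (v - u = (v - w).+1)%N by lia.
rewrite /path e pathmSr (bigD1 w) //= (ract0E _ a) big1 ?addr0 // => x xw.
rewrite ract0_0 ?mulmx0 // /arrowA -wu; apply: contra xw => /eqP e'.
by apply/eqP/val_inj.
Qed.

Lemma path_trans V (v w u : 'I_n) : (u <= w)%N -> (w <= v)%N ->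
  path V v w *m path V w u = path V v u.
Proof.
move=> uw; have [m] := ubnP (v - w)%N; elim: m v => // m IHm v vm wv.
have [e|vw] := eqVneq v w; first by rewrite e path_id mul1mx.
have vv : (v.-1 < n)%N by have := ltn_ord v; lia.
have nvw : v <> w :> nat by move=> e; case/eqP: vw; apply: val_inj.
have a : arrowA v (Ordinal vv) by rewrite /arrowA /=; lia.
rewrite (path_stepl V a) /=; last by lia.
rewrite (path_stepl V a) /=; last by lia.
by rewrite -mulmxA IHm //=; lia.
Qed.

(** [prj m] is the projective at the m-th vertex when the vertices are counted
    from 1, and 0 when m = 0; morphisms from it are elements of the
    representation at that vertex. *)
Definition prj (m : nat) : rep k n :=
  @Rep k n (fun v => (v < m)%N : nat) (fun _ _ _ => const_mx 1).

Lemma mx_norow (b : bool) p (A B : 'M[k]_(b : nat, p)) : ~~ b -> A = B.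
Proof. by case: b A B => // A B _; apply/matrixP => [[]]. Qed.

Lemma cm1 (b : bool) : (1%:M : 'M[k]_(b : nat)) = const_mx 1.
Proof. by case: b; apply/matrixP => [] [[|?] ?] [[|?] ?] //; rewrite !mxE. Qed.

Lemma cmM (a b c : bool) : b ->
  (const_mx 1 : 'M[k]_(a : nat, b : nat)) *m (const_mx 1 : 'M[k]_(b : nat, c : nat)) = const_mx 1.
Proof. by case: b => // _; apply/matrixP => i j; rewrite !mxE big_ord1 !mxE mulr1. Qed.

Lemma const_mx_mul1 (b c : bool) p (A : 'M[k]_(1, p)) : b -> b = c ->
  (const_mx 1 : 'M[k]_(b : nat, c : nat)) *m ((const_mx 1 : 'cV[k]_(c : nat)) *m A) = (const_mx 1 : 'cV[k]_(b : nat)) *m A.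
Proof.
move=> hb hc; rewrite -hc {c hc}; case: b hb => // _; rewrite mulmxA; congr (_ *m _).
by apply/matrixP => i j; rewrite !mxE big_ord1 !mxE mulr1.
Qed.

Lemma const_mx_11 (b : bool) : b -> (const_mx 1 : 'rV[k]_(b : nat)) *m (const_mx 1 : 'cV[k]_(b : nat)) = 1%:M.
Proof.
by case: b => // _; apply/matrixP => i j; rewrite !mxE big_ord1 !mxE mulr1 !ord1.
Qed.

Definition top V (v : 'I_n) (a : rhom (prj v.+1) V) : 'rV[k]_(rdim V v) :=
  (const_mx 1 : 'rV[k]_((v < v.+1)%N : nat)) *m a v.

Program Definition elt V (v : 'I_n) (x : 'rV[k]_(rdim V v)) : rhom (prj v.+1) V :=
  RHom (rmap := fun u => (const_mx 1 : 'cV[k]_((u < v.+1)%N : nat)) *m (x *m path V v u)) _.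
Next Obligation.
have ij : i = j.+1 :> nat by apply/eqP.
case: (boolP (i < v.+1)%N) => iv; last exact: mx_norow.
rewrite const_mx_mul1 //; last by lia.
by rewrite (path_stepr V a) // !mulmxA.
Qed.

Lemma top_elt V v x : top (@elt V v x) = x.
Proof. by rewrite /top /= mulmxA const_mx_11 // path_id mulmx1 mul1mx. Qed.

Lemma path_prj m (v u : 'I_n) : (v < m)%N -> (u <= v)%N ->
  path (prj m) v u = const_mx 1.
Proof.
move=> vm; have [d] := ubnP (v - u)%N; elim: d u => // d IHd u ud uv.
have [e|nvu] := eqVneq u v.
  by rewrite e path_id cm1.
have nuv : u <> v :> nat by move=> e; case/eqP: nvu; apply: val_inj.
have uu : (u.+1 < n)%N by have := ltn_ord v; lia.
have a' : arrowA (Ordinal uu) u by rewrite /arrowA.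
rewrite (path_stepr _ a') /=; last by lia.
rewrite IHd /=; [|lia..].
by rewrite (@cmM (v < m)%N (u.+1 < m)%N (u < m)%N) //; lia.
Qed.

(** A morphism from a projective is given by the image of its generator. *)
Lemma topP V (v : 'I_n) (a : rhom (prj v.+1) V) u :
  a u = (const_mx 1 : 'cV[k]_((u < v.+1)%N : nat)) *m (top a *m path V v u).
Proof.
case/orP: (orbN (u < v.+1)%N) => uv; last exact: mx_norow.
rewrite /top -mulmxA -(path_rmap a) mulmxA mulmxA path_prj //.
transitivity ((1%:M : 'M_((u < v.+1)%N : nat)) *m a u); first by rewrite mul1mx.
rewrite cm1; congr (_ *m _).
have e1 := @cmM true (v < v.+1)%N (u < v.+1)%N (ltnSn v).
have e2 := @cmM (u < v.+1)%N true (u < v.+1)%N isT.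
by apply: esym; rewrite -mulmxA; rewrite e1 e2.
Qed.

Lemma top_eq V (v : 'I_n) (a b : rhom (prj v.+1) V) : top a = top b -> forall u, a u = b u.
Proof. by move=> e u; rewrite !topP e. Qed.

Lemma top_comp V W (v : 'I_n) (a : rhom (prj v.+1) V) (f : rhom V W) :
  top (rcomp f a) = top a *m f v.
Proof. by rewrite /top /= mulmxA. Qed.

(** Composition with this map restricts an element along a path *)
Program Definition prj_incl m m' : (m <= m')%N -> rhom (prj m) (prj m') := fun h =>
  RHom (rmap := fun u => const_mx 1) _.
Next Obligation.
case/orP: (orbN (i < m)%N) => im; last exact: mx_norow.
have ij : i = j.+1 :> nat by apply/eqP.
have [h1 h2] : (j < m)%N /\ (i < m')%N by lia.
by transitivity (const_mx 1 : 'M[k]_((i < m)%N : nat, (j < m')%N : nat));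
  [exact: (@cmM (i < m)%N (j < m)%N (j < m')%N) | apply/esym; exact: (@cmM (i < m)%N (i < m')%N (j < m')%N)].
Qed.

End Paths.

Lemma mxDE (R : nzRingType) m p (A B : 'M[R]_(m, p)) i j :
  (A + B) i j = A i j + B i j.
Proof. by rewrite mxE. Qed.

Lemma mxNE (R : nzRingType) m p (A : 'M[R]_(m, p)) i j : (- A) i j = - A i j.
Proof. by rewrite mxE. Qed.

Lemma mx0E (R : nzRingType) m p i j : (0 : 'M[R]_(m, p)) i j = 0.
Proof. by rewrite mxE. Qed.

(** Identities in the additive group of matrices, checked entrywise *)
Ltac mx_zmod := apply/matrixP => ? ?; rewrite ?(mxDE, mxNE, mx0E); ring.

(** * Two-term resolutions represent cohomological functors *)

Section Elements.
Variables (k : fieldType) (n : nat).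
Implicit Types (X Y : cplx k n) (V W : rep k n).

(** The conditions in the definition of a quasi-isomorphism, with morphisms from A
    in the place of vectors; they hold for projectives. *)
Definition lifts (A : rep k n) := forall X Y (s : chain X Y), qis s -> forall p,
  (forall a : rhom A (X (p + 1)), (forall v, a v *m cd X (p + 1) v = 0) ->
    (exists b : rhom A (Y p), forall v, a v *m s (p + 1) v = b v *m cd Y p v) ->
    exists c : rhom A (X p), forall v, a v = c v *m cd X p v) /\
  (forall a : rhom A (Y (p + 1)), (forall v, a v *m cd Y (p + 1) v = 0) ->
    exists2 b : rhom A (X (p + 1)), (forall v, b v *m cd X (p + 1) v = 0) &
    exists c : rhom A (Y p), forall v, a v = b v *m s (p + 1) v + c v *m cd Y p v).

Lemma lifts_prj m : (m <= n)%N -> lifts (prj k n m).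
Proof.
move=> mn X Y s hs p; case: m mn => [|m] mn.
  have z (p' : nat) (M N : 'M[k]_(0%N, p')) : M = N by apply/matrixP => [[]].
  split=> a _; first by move=> _; exists (rzero _ _) => v; apply: z.
  by exists (rzero _ _) => [v|]; [apply: z | exists (rzero _ _) => v; apply: z].
pose v := Ordinal mn; have [inj surj] := hs p v; split=> a ad.
  case=> b ab; have [||c e] := inj (top (a : rhom (prj k n v.+1) _)).
  - by rewrite /top -mulmxA ad mulmx0.
  - by exists (top (b : rhom (prj k n v.+1) _)); rewrite /top -!mulmxA ab.
  exists (elt c) => u; apply: (@top_eq _ _ _ v a (rcomp (cd X p) (elt c))).
  by rewrite top_comp top_elt.
have [|x xd [z e]] := surj (top (a : rhom (prj k n v.+1) _)).
  by rewrite /top -!mulmxA ad mulmx0.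
exists (elt x) => [u|].
  by rewrite /= -!mulmxA path_rmap (mulmxA x) xd mul0mx mulmx0.
exists (elt z) => u.
apply: (@top_eq _ _ _ v a (radd (rcomp (s (p + 1)) (elt x)) (rcomp (cd Y p) (elt z)))).
rewrite /top /= mulmxDr -/(top _).
have -> : const_mx 1 *m (elt x v *m s (p + 1) v) = top (elt x) *m s (p + 1) v by rewrite /top mulmxA.
have -> : const_mx 1 *m (elt z v *m cd Y p v) = top (elt z) *m cd Y p v by rewrite /top mulmxA.
by rewrite !top_elt.
Qed.

(** For b of the form [t == p], the degree t of the complex with V in degree p:
    a test instead of an equation keeps degrees free of transports. *)
Definition dlt (b : bool) V : rep k n := if b then V else rep0 k n.

Definition dmm (b c : bool) V W (f : rhom V W) : rhom (dlt b V) (dlt c W) :=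
  match b, c return rhom (dlt b V) (dlt c W) with
  | true, true => f | _, _ => rzero _ _ end.

(** Maps into degree t of X from a representation placed in degree p *)
Definition ins V X (p : int) (a : rhom V (X p)) (t : int) : rhom (dlt (t == p) V) (X t) :=
  match t =P p in reflect _ b return rhom (dlt b V) (X t) with
  | ReflectT e => ecast z (rhom V (X z)) (esym e) a
  | ReflectF _ => rzero _ _ end.

Definition ins1 V X (p : int) (a : rhom V (X p)) (t : int) : rhom (dlt (t + 1 == p + 1) V) (X t) :=
  match t + 1 =P p + 1 in reflect _ b return rhom (dlt b V) (X t) with
  | ReflectT e => ecast z (rhom V (X z)) (esym (@addIr int 1 t p e)) a
  | ReflectF _ => rzero _ _ end.

Program Definition rcol V V' W (f : rhom V W) (g : rhom V' W) : rhom (rsum V V') W :=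
  RHom (rmap := fun v => col_mx (f v) (g v)) _.
Next Obligation. by rewrite mul_block_col mul_col_mx !mul0mx !rmapP addr0 add0r. Qed.

Program Definition rblock V V' W W' (f : rhom V W) (f' : rhom V W') (g : rhom V' W)
    (g' : rhom V' W') : rhom (rsum V V') (rsum W W') :=
  RHom (rmap := fun v => block_mx (f v) (f' v) (g v) (g' v)) _.
Next Obligation. by rewrite !mulmx_block !mul0mx !mulmx0 !rmapP !addr0 !add0r. Qed.

Section Resolution.
Variables (q : int) (A B : rep k n) (f : rhom A B).
Hypotheses (pA : lifts A) (pB : lifts B).

(** The complex A -> B, placed in the degrees q+1 and q+2 *)
Program Definition two_term : cplx k n :=
  @Cplx k n (fun t => rsum (dlt (t == q + 1) A) (dlt (t == q + 1 + 1) B))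
   (fun t => rblock (rzero _ _) (dmm _ _ f) (rzero _ _) (rzero _ _)) _ _.
Next Obligation. by rewrite mulmx_block !mulmx0 !mul0mx !addr0 block_mx0. Qed.
Next Obligation.
exists (`|q| + 2)%N => p hp v /=.
have -> : p == q + 1 = false by apply/eqP; lia.
have -> : p == q + 1 + 1 = false by apply/eqP; lia.
by [].
Qed.

(** A pair of components is a candidate for a chain map from A -> B to X; the
    cocycles are the chain maps, and cohomologous ones are homotopic. *)
Definition pair X := (rhom B (X (q + 1 + 1)%R) * rhom A (X (q + 1)%R))%type.

Definition cocycle X (e : pair X) := forall v,
  e.1 v *m cd X (q + 1 + 1) v = 0 /\ f v *m e.1 v = e.2 v *m cd X (q + 1) v.

Definition cohomologous X (e e' : pair X) :=
  exists (g : rhom B (X (q + 1))) (h : rhom A (X q)), forall v,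
   e.1 v = e'.1 v + g v *m cd X (q + 1) v /\
   e.2 v = e'.2 v + f v *m g v + h v *m cd X q v.

Definition push X Y (u : chain X Y) (e : pair X) : pair Y :=
  (rcomp (u _) e.1, rcomp (u _) e.2).
Definition padd X (e e' : pair X) : pair X := (radd e.1 e'.1, radd e.2 e'.2).
Definition pscale X c (e : pair X) : pair X := (rscale c e.1, rscale c e.2).
Definition pzero X : pair X := (rzero _ _, rzero _ _).

Lemma cohom_ext X (e e' : pair X) : (forall v, e.1 v = e'.1 v /\ e.2 v = e'.2 v) ->
  cohomologous e e'.
Proof.
move=> h; exists (rzero _ _), (rzero _ _) => v; have [-> ->] := h v.
by rewrite /= !mul0mx mulmx0 !addr0.
Qed.

Lemma cohom_refl X (e : pair X) : cohomologous e e.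
Proof. exact: cohom_ext. Qed.

Lemma cohom_sym X (e e' : pair X) : cohomologous e e' -> cohomologous e' e.
Proof.
move=> [g [h H]]; exists (rscale (-1) g), (rscale (-1) h) => v /=; have [-> ->] := H v.
rewrite -?scalemxAl -?scalemxAr !scaleN1r; split; mx_zmod.
Qed.

Lemma cohom_trans X (e e' e'' : pair X) :
  cohomologous e e' -> cohomologous e' e'' -> cohomologous e e''.
Proof.
move=> [g [h H]] [g' [h' H']]; exists (radd g g'), (radd h h') => v /=.
have [-> ->] := H v; have [-> ->] := H' v; rewrite !mulmxDl mulmxDr.
split; mx_zmod.
Qed.

Lemma cohom_add X (e1 e2 e1' e2' : pair X) : cohomologous e1 e1' ->
  cohomologous e2 e2' -> cohomologous (padd e1 e2) (padd e1' e2').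
Proof.
move=> [g [h H]] [g' [h' H']]; exists (radd g g'), (radd h h') => v /=.
have [-> ->] := H v; have [-> ->] := H' v; rewrite !mulmxDl mulmxDr.
split; mx_zmod.
Qed.

Lemma cohom_push X Y (u : chain X Y) e e' : @cohomologous X e e' ->
  cohomologous (push u e) (push u e').
Proof.
move=> [g [h H]]; exists (rcomp (u _) g), (rcomp (u _) h) => v /=.
have [-> ->] := H v; rewrite !mulmxDl -!mulmxA !cmapP.
by [].
Qed.

Lemma cocycle_push X Y (u : chain X Y) e : @cocycle X e -> cocycle (push u e).
Proof.
move=> H v /=; have [h1 h2] := H v.
by rewrite -!mulmxA -!cmapP !mulmxA h1 mul0mx -h2.
Qed.

Lemma cocycle_add X (e e' : pair X) : cocycle e -> cocycle e' -> cocycle (padd e e').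
Proof.
move=> H H' v /=; have [h1 h2] := H v; have [h1' h2'] := H' v.
by rewrite !mulmxDl mulmxDr h1 h1' h2 h2' addr0.
Qed.

Lemma cocycle_scale X c (e : pair X) : cocycle e -> cocycle (pscale c e).
Proof.
move=> H v /=; have [h1 h2] := H v.
by rewrite -!scalemxAl -scalemxAr h1 h2 scaler0.
Qed.

Lemma qis_lift X Y (s : chain X Y) : qis s -> forall e, @cocycle Y e ->
  exists2 e', @cocycle X e' & cohomologous (push s e') e.
Proof.
move=> hs [a b] ce; have [_ l2] := pB hs (q + 1); have [l3 l4] := pA hs (q + 1).
have [_ l5] := pA hs q.
have [|a' a'd [g ag]] := l2 a; first by move=> v; have [] := ce v.
have [||d fd] := l3 (rcomp a' f).
- by move=> v /=; rewrite -mulmxA a'd mulmx0.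
- exists (radd b (rscale (-1) (rcomp g f))) => v /=; have [_ /= h] := ce v.
  by rewrite mulmxDl -h ag mulmxDr scaleN1r mulNmx -!mulmxA addrK.
have [|ee eed [h bh]] := l5 (radd (radd b (rscale (-1) (rcomp g f))) (rscale (-1) (rcomp (s _) d))).
  move=> v /=; have [_ /= h] := ce v.
  rewrite !mulmxDl -h ag mulmxDr !scaleN1r !mulNmx -!mulmxA -cmapP (mulmxA (d v)) -fd /=.
  by rewrite !mulmxA addrK subrr.
exists (a', radd d ee).
  by move=> v /=; rewrite a'd mulmxDl eed addr0 -fd.
apply: cohom_sym; exists g, h => v /=; rewrite ag; split=> //.
have := bh v; rewrite /= !scaleN1r mulmxDl => /eqP.
rewrite !subr_eq => /eqP ->; mx_zmod.
Qed.

Lemma qis_bnd X Y (s : chain X Y) : qis s -> forall e, @cocycle X e ->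
  cohomologous (push s e) (pzero Y) -> cohomologous e (pzero X).
Proof.
move=> hs [a b] ce [g [h H]].
have [l1 _] := pB hs (q + 1); have [_ l2] := pB hs q; have [l5 _] := pA hs q.
have [||g' ag'] := l1 a; first by move=> v; have [] := ce v.
  by exists g => v; have [/= -> _] := H v; rewrite add0r.
have [|x xd [t gt]] := l2 (radd (rcomp (s _) g') (rscale (-1) g)).
  move=> v /=; have [/= + _] := H v; rewrite add0r scaleN1r mulmxDl mulNmx.
  by move=> <-; rewrite -mulmxA -cmapP mulmxA -ag' subrr.
have [||h' bh'] := l5 (radd b (rscale (-1) (rcomp (radd g' (rscale (-1) x)) f))).
- move=> v /=; have [_ /= e] := ce v.
  by rewrite !scaleN1r mulmxDl mulNmx -mulmxA mulmxDl mulNmx xd subr0 -ag' e subrr.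
- exists (radd h (rscale (-1) (rcomp t f))) => v /=; have [_ /= e] := H v.
  have /= := gt v; rewrite !scaleN1r => e'.
  rewrite !mulmxDl e mulNmx -mulmxA !mulmxDl !mulNmx -mulmxA.
  have -> : g' v *m s (q + 1) v = x v *m s (q + 1) v + t v *m cd Y q v + g v.
    by rewrite -e'; mx_zmod.
  rewrite !mulmxDr !mulmxN; mx_zmod.
exists (radd g' (rscale (-1) x)), h' => v /=.
rewrite !scaleN1r !add0r mulmxDl mulNmx xd subr0; split; first exact: ag'.
by have := bh' v; rewrite /= !scaleN1r => <-; mx_zmod.
Qed.

Lemma qis_inj X Y (s : chain X Y) : qis s -> forall e e', @cocycle X e -> cocycle e' ->
  cohomologous (push s e) (push s e') -> cohomologous e e'.
Proof.
move=> hs e e' ce ce' h.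
have {}h : cohomologous (push s (padd e (pscale (-1) e'))) (pzero Y).
  have h' := cohom_add h (cohom_refl (pscale (-1) (push s e'))).
  apply: cohom_trans (cohom_trans _ h') _; apply: cohom_ext => v /=.
    by rewrite !mulmxDl -!scalemxAl.
  by rewrite !scaleN1r !subrr.
have {}h := qis_bnd hs (cocycle_add ce (cocycle_scale (-1) ce')) h.
have h' := cohom_add h (cohom_refl e').
apply: cohom_trans (cohom_trans _ h') _; apply: cohom_ext => v /=.
  by rewrite !scaleN1r; split; mx_zmod.
by rewrite !add0r.
Qed.

(** The action of a morphism of the derived category on classes, as a relation;
    a formal inverse acts by the inverse relation. *)
Fixpoint act X Y (u : dmor X Y) : pair X -> pair Y -> Prop :=
  match u with
  | dmap _ _ u => fun e e' => cohomologous (push u e) e'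
  | dinv _ _ s _ => fun e e' => cocycle e' /\ cohomologous (push s e') e
  | dcomp _ _ _ g u => fun e e' => exists2 e1, cocycle e1 & act u e e1 /\ act g e1 e'
  | dadd _ _ u u' => fun e e' => exists e1 e2,
     [/\ act u e e1, act u' e e2, cocycle e1, cocycle e2 & cohomologous (padd e1 e2) e']
  end.

Lemma act_total X Y (u : dmor X Y) e : cocycle e -> exists2 e', cocycle e' & act u e e'.
Proof.
elim: u e => {X Y} [X Y u|X Y s hs|X Y W g IHg u IHu|X Y u IHu g IHg] e ce /=.
- by exists (push u e); [exact: cocycle_push|exact: cohom_refl].
- by have [e' ce' h] := qis_lift hs ce; exists e'.
- have [e1 ce1 h1] := IHu _ ce; have [e2 ce2 h2] := IHg _ ce1.
  by exists e2 => //; exists e1.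
- have [e1 ce1 h1] := IHu _ ce; have [e2 ce2 h2] := IHg _ ce.
  exists (padd e1 e2); first exact: cocycle_add.
  by exists e1, e2; split=> //; apply: cohom_refl.
Qed.

Lemma act_fun X Y (u : dmor X Y) e1 e2 e1' e2' : cocycle e1 -> cocycle e2 ->
  cocycle e1' -> cocycle e2' -> cohomologous e1 e2 ->
  act u e1 e1' -> act u e2 e2' -> cohomologous e1' e2'.
Proof.
elim: u e1 e2 e1' e2' => {X Y} [X Y u|X Y s hs|X Y W g IHg u IHu|X Y u IHu g IHg] e1 e2 e1' e2' c1 c2 c1' c2' h /=.
- move=> h1 h2; apply: cohom_trans (cohom_sym h1) (cohom_trans _ h2).
  exact: cohom_push.
- move=> [_ h1] [_ h2]; apply: (qis_inj hs) => //.
  exact: cohom_trans h1 (cohom_trans h (cohom_sym h2)).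
- move=> [x1 cx1 [a1 b1]] [x2 cx2 [a2 b2]].
  exact: (IHg x1 x2) (IHu e1 e2 x1 x2 c1 c2 cx1 cx2 h a1 a2) b1 b2.
- move=> [x1 [y1 [a1 b1 cx1 cy1 h1]]] [x2 [y2 [a2 b2 cx2 cy2 h2]]].
  apply: cohom_trans (cohom_sym h1) (cohom_trans _ h2); apply: cohom_add.
    exact: (IHu e1 e2).
  exact: (IHg e1 e2).
Qed.

Lemma act_cohom X Y (u : dmor X Y) e e1 e2 : cocycle e2 -> cohomologous e1 e2 ->
  act u e e1 -> act u e e2.
Proof.
elim: u e e1 e2 => {X Y} [X Y u|X Y s hs|X Y W g IHg u IHu|X Y u IHu g IHg] e e1 e2 c2 h /=.
- by move=> h1; apply: cohom_trans h1 h.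
- by move=> [c1 h1]; split=> //; apply: cohom_trans h1; apply/cohom_push/cohom_sym.
- by move=> [x cx [a b]]; exists x => //; split=> //; apply: IHg b.
- by move=> [x [y [a b cx cy h']]]; exists x, y; split=> //; apply: cohom_trans h' h.
Qed.

Lemma act_add X Y (u : dmor X Y) e1 e2 e1' e2' : 
  cocycle e1' -> cocycle e2' -> act u e1 e1' -> act u e2 e2' ->
  act u (padd e1 e2) (padd e1' e2').
Proof.
elim: u e1 e2 e1' e2' => {X Y} [X Y u|X Y s hs|X Y W g IHg u IHu|X Y u IHu g IHg] e1 e2 e1' e2' c1 c2 /=.
- move=> h1 h2; apply: cohom_trans (cohom_add h1 h2).
  by apply: cohom_ext => v /=; rewrite !mulmxDl.
- move=> [_ h1] [_ h2]; split; first exact: cocycle_add.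
  apply: cohom_trans (cohom_add h1 h2).
  by apply: cohom_ext => v /=; rewrite !mulmxDl.
- move=> [x1 cx1 [a1 b1]] [x2 cx2 [a2 b2]]; exists (padd x1 x2); first exact: cocycle_add.
  by split; [exact: IHu|exact: IHg].
- move=> [x1 [y1 [a1 b1 cx1 cy1 h1]]] [x2 [y2 [a2 b2 cx2 cy2 h2]]].
  exists (padd x1 x2), (padd y1 y2); split; [exact: IHu | exact: IHg | exact: cocycle_add.. |].
  apply: cohom_trans (cohom_add h1 h2); apply: cohom_ext => v /=; split; mx_zmod.
Qed.

(** The relations of the localization hold for the action on classes, because
    quasi-isomorphisms act bijectively. *)
Lemma act_deq X Y (u u' : dmor X Y) : deq u u' ->
  forall e, cocycle e -> exists2 e', cocycle e' & act u e e' /\ act u' e e'.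
Proof.
elim=> {X Y u u'} /=.
- by move=> X Y u e /(act_total u)[e' c a]; exists e'.
- by move=> X Y u u' _ IH e /IH[e' c [a b]]; exists e'.
- move=> X Y u u' u'' _ IH _ IH' e ce; have [e' c [a b]] := IH e ce.
  have [e'' c' [a' b']] := IH' e ce; exists e'' => //; split=> //.
  by apply: act_cohom a => //; apply: act_fun b a' => //; apply: cohom_refl.
- move=> X Y Z g g' u u' _ IHg _ IHu e /IHu[e' c [a b]].
  have [e'' c' [a' b']] := IHg _ c; exists e'' => //.
  by split; exists e'.
- move=> X Y u u' g g' _ IHu _ IHg e ce; have [e' c [a b]] := IHu _ ce.
  have [e'' c' [a' b']] := IHg _ ce; exists (padd e' e''); first exact: cocycle_add.
  by split; exists e', e''; split=> //; apply: cohom_refl.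
- move=> X Y Z T h g u e /(act_total u)[e1 c1 a1]; have [e2 c2 a2] := act_total g c1.
  have [e3 c3 a3] := act_total h c2; exists e3 => //; split.
    by exists e2 => //; split=> //; exists e1.
  by exists e1 => //; split=> //; exists e2.
- move=> X Y u e ce; have [e' c a] := act_total u ce; exists e' => //.
  split=> //; exists e => //; split=> //; apply: cohom_ext => v /=; by rewrite !mulmx1.
- move=> X Y u e ce; have [e' c a] := act_total u ce; exists e' => //.
  split=> //; exists e' => //; split=> //; apply: cohom_ext => v /=; by rewrite !mulmx1.
- move=> X Y u g h e ce; have [e1 c1 a1] := act_total u ce.
  have [e2 c2 a2] := act_total g ce; have [e3 c3 a3] := act_total h ce.
  have c12 := cocycle_add c1 c2; have c23 := cocycle_add c2 c3.
  exists (padd (padd e1 e2) e3); first exact: cocycle_add.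
  split; [exists e1, (padd e2 e3)|exists (padd e1 e2), e3]; split=> //.
  + by exists e2, e3; split=> //; apply: cohom_refl.
  + by apply: cohom_ext => v /=; rewrite !addrA.
  + by exists e1, e2; split=> //; apply: cohom_refl.
  + exact: cohom_refl.
- move=> X Y u g e ce; have [e1 c1 a1] := act_total u ce.
  have [e2 c2 a2] := act_total g ce; exists (padd e1 e2); first exact: cocycle_add.
  split; [exists e1, e2|exists e2, e1]; split=> //; first exact: cohom_refl.
  by apply: cohom_ext => v /=; split; mx_zmod.
- move=> X Y u e ce; have [e1 c1 a1] := act_total u ce; exists e1 => //; split=> //.
  exists e1, (pzero Y); split=> //; try by apply: cohom_ext => v /=; rewrite !mulmx0.
    by move=> v /=; rewrite mulmx0 !mul0mx.
  by apply: cohom_ext => v /=; rewrite !addr0.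
- move=> X Y Z g g' u e ce; have [e1 c1 a1] := act_total u ce.
  have [e2 c2 a2] := act_total g c1; have [e3 c3 a3] := act_total g' c1.
  exists (padd e2 e3); first exact: cocycle_add.
  split; first by exists e1 => //; split=> //; exists e2, e3; split=> //; apply: cohom_refl.
  by exists e2, e3; split; [exists e1|exists e1|..] => //; apply: cohom_refl.
- move=> X Y Z g u u' e ce; have [e1 c1 a1] := act_total u ce.
  have [e1' c1' a1'] := act_total u' ce.
  have [e2 c2 a2] := act_total g c1; have [e3 c3 a3] := act_total g c1'.
  exists (padd e2 e3); first exact: cocycle_add.
  split.
    exists (padd e1 e1'); first exact: cocycle_add.
    split; first by exists e1, e1'; split=> //; apply: cohom_refl.
    exact: act_add.
  by exists e2, e3; split; [exists e1|exists e1'|..] => //; apply: cohom_refl.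
- move=> X Y u g ug e ce; exists (push u e); first exact: cocycle_push.
  by split; [exact: cohom_refl | apply: cohom_ext => v /=; rewrite !ug].
- move=> X Y Z g u e ce; exists (push g (push u e)); first by do 2!apply: cocycle_push.
  split; first by apply: cohom_ext => v /=; rewrite !mulmxA.
  by exists (push u e); [exact: cocycle_push | split; exact: cohom_refl].
- move=> X Y u g e ce; have cu := cocycle_push u ce; have cg := cocycle_push g ce.
  exists (padd (push u e) (push g e)); first exact: cocycle_add.
  split; first by apply: cohom_ext => v /=; rewrite !mulmxDr.
  by exists (push u e), (push g e); split=> //; apply: cohom_refl.
- move=> X Y s hs e ce; exists e => //; split.
    by exists (push s e); [exact: cocycle_push | split; [|split=> //]; apply: cohom_refl].
  by apply: cohom_ext => v /=; rewrite !mulmx1.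
- move=> X Y s hs e ce; have [e1 c1 h1] := qis_lift hs ce; exists e => //; split.
    by exists e1 => //; split.
  by apply: cohom_ext => v /=; rewrite !mulmx1.
Qed.

End Resolution.
End Elements.

Section Delta.
Variables (k : fieldType) (n : nat).
Implicit Types (X Y : cplx k n) (V W : rep k n).

Lemma dlt_norow b V v p (M N : 'M[k]_(rdim (dlt b V) v, p)) : ~~ b -> M = N.
Proof. by case: b M N => // M N _; apply/matrixP => [[]]. Qed.

Lemma dlt_lcancel b V v p (M N : 'M[k]_(rdim (dlt b V) v, p)) :
  dmm true b (rid V) v *m M = dmm true b (rid V) v *m N -> M = N.
Proof.
case: b M N => [|M N _]; last exact: dlt_norow.
by move=> M N /=; rewrite !mul1mx.
Qed.

Lemma ins_id V X p (a : rhom V (X p)) v : dmm true (p == p) (rid V) v *m ins a p v = a v.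
Proof. by rewrite /ins; case: eqP => // e; rewrite eq_axiomK /= mul1mx. Qed.

End Delta.

Section Representable.
Variables (k : fieldType) (n : nat).
Implicit Types (X Y : cplx k n) (V W : rep k n).
Variables (q : int) (A B : rep k n) (f : rhom A B).
Hypotheses (pA : lifts A) (pB : lifts B).
Notation R := (two_term q f).
Notation pair := (pair q A B).
Notation cocycle := (@cocycle k n q A B f _).
Notation cohomologous := (@cohomologous k n q A B f _).

Program Definition mk X (e : pair X) (ce : cocycle e) : chain R X :=
  Chain (cmap := fun t => rcol (ins e.2 t) (ins e.1 t)) _.
Next Obligation.
rewrite mul_block_col mul_col_mx !mul0mx !add0r; congr col_mx.
  rewrite /ins; case: (p + 1 =P q + 1 + 1) => e2; case: (p =P q + 1) => e1;
    try (exfalso; lia); last by rewrite /= !mul0mx.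
  by subst p; rewrite (eq_axiomK e2) /=; have [_ ->] := ce v.
rewrite /ins; case: (p =P q + 1 + 1) => e1; last by rewrite mul0mx.
by subst p; have [-> _] := ce v.
Qed.

(** The universal class, corresponding to the identity of A -> B *)
Program Definition upair : pair R :=
  (RHom (rmap := fun v => row_mx 0 (dmm true (q + 1 + 1 == q + 1 + 1) (rid B) v)) _,
   RHom (rmap := fun v => row_mx (dmm true (q + 1 == q + 1) (rid A) v) 0) _).
Next Obligation. by rewrite mul_mx_row mul_row_block !mul0mx !mulmx0 !add0r (rmapP (dmm true _ (rid B)) a). Qed.
Next Obligation. by rewrite mul_mx_row mul_row_block !mul0mx !mulmx0 !addr0 (rmapP (dmm true _ (rid A)) a). Qed.

Lemma upair_cocycle : cocycle upair.
Proof.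
move=> v /=; rewrite mul_row_block !mul0mx !mulmx0 !addr0 row_mx0; split=> //.
rewrite mul_row_block !mul_mx_row !mul0mx !mulmx0 !addr0; congr row_mx.
by rewrite eqxx /= eqxx mulmx1 mul1mx.
Qed.

Lemma mk_upair t v : mk upair_cocycle t v = 1%:M.
Proof.
rewrite [RHS]scalar_mx_block /=; congr col_mx.
  case/orP: (orbN (t == q + 1)) => [/eqP e|ne]; last exact: dlt_norow.
  subst t; apply: dlt_lcancel; rewrite (ins_id (X := R) (p := q + 1)) /= mul_mx_row mulmx0 mulmx1.
  by [].
case/orP: (orbN (t == q + 1 + 1)) => [/eqP e|ne]; last exact: dlt_norow.
subst t; apply: dlt_lcancel; rewrite (ins_id (X := R) (p := q + 1 + 1)) /= mul_mx_row mulmx0 mulmx1.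
by [].
Qed.

Lemma push_mk X (e : pair X) (ce : cocycle e) : cohomologous (push (mk ce) upair) e.
Proof.
apply: cohom_ext => v /=.
by split; rewrite mul_row_col mul0mx ?add0r ?addr0 -?[RHS]ins_id.
Qed.

Lemma mk_cohom X (e e' : pair X) (ce : cocycle e) (ce' : cocycle e') :
  cohomologous e e' -> deq (dmap (mk ce)) (dmap (mk ce')).
Proof.
move=> [g [h H]]; apply: dadd_eq0.
rewrite /dscale -deq_map_comp -deq_map_add.
apply: (@homotopic_deq0 k n R X _ (fun t => rcol (ins1 h t) (ins1 g t))) => t v /=.
rewrite -scalemxAr mulmx1 scaleN1r.
rewrite mul_block_col mul_col_mx !mul0mx !add0r opp_col_mx !add_col_mx; congr col_mx.
  rewrite /ins /ins1; case: (t + 1 =P q + 1) => e1; case: (t + 1 + 1 =P q + 1 + 1) => e2;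
    try (exfalso; lia); last by rewrite /= !mul0mx subr0 addr0.
  have e3 : t = q by lia.
  subst t; move: (esym (@addIr int 1 _ _ e1)) (esym (@addIr int 1 _ _ e2)) => d1 d2.
  rewrite (eq_axiomK d1) (eq_axiomK d2) (eq_axiomK e1) /=.
  by have [_ ->] := H v; mx_zmod.
rewrite /ins /ins1; case: (t + 1 =P q + 1 + 1) => e1; last by rewrite /= !mul0mx subr0 addr0.
have e3 : t = q + 1 by lia.
subst t; move: (esym (@addIr int 1 _ _ e1)) => d1.
rewrite (eq_axiomK d1) (eq_axiomK e1) /=.
have [-> _] := H v; mx_zmod.
Qed.

(** The naturality of [mk] with respect to all morphisms of the derived category
    is what makes the lifting property pass to formal inverses. *)
Lemma mk_act X Y (u : dmor X Y) (e : pair X) (e' : pair Y) (ce : cocycle e)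
  (ce' : cocycle e') : act f u e e' -> deq (dcomp u (dmap (mk ce))) (dmap (mk ce')).
Proof.
have mk_push (Z W : cplx k n) (g : chain Z W) (x : pair Z) (cx : cocycle x) (cx' : cocycle (push g x)) :
    deq (dcomp (dmap g) (dmap (mk cx))) (dmap (mk cx')).
  rewrite -deq_map_comp; apply: deq_map => t v /=.
  rewrite mul_col_mx; congr col_mx; rewrite /ins; case: eqP => e1; rewrite ?mul0mx //; by subst t.
elim: u e e' ce ce' => {X Y} [X Y u|X Y s hs|X Y W g IHg u IHu|X Y u IHu g IHg] e e' ce ce' /=.
- move=> h; rewrite (mk_push _ _ _ _ _ (cocycle_push u ce)); exact: mk_cohom.
- move=> [_ h]; rewrite -(mk_cohom (cocycle_push s ce') _ h) -(mk_push _ _ _ _ ce').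
  by rewrite deq_compA deq_invK deq_1comp.
- by move=> [e1 ce1 [a b]]; rewrite -deq_compA (IHu _ _ _ ce1 a) (IHg _ _ _ ce' b).
- move=> [e1 [e2 [a b c1 c2 h]]].
  rewrite deq_compDl (IHu _ _ _ c1 a) (IHg _ _ _ c2 b) -deq_map_add.
  rewrite -(mk_cohom (cocycle_add c1 c2) _ h); apply: deq_map => t v /=.
  rewrite add_col_mx; congr col_mx; rewrite /ins; case: eqP => e3; rewrite ?addr0 //; by subst t.
Qed.

(** A Yoneda argument: a morphism is the image of the universal class. *)
Lemma mk_full X (u : dmor R X) : exists e (ce : cocycle e), deq u (dmap (mk ce)).
Proof.
have [e ce a] := act_total pA pB u upair_cocycle; exists e, ce.
rewrite -(mk_act upair_cocycle ce a) -{1}[u]deq_comp1; apply: deq_comp => //.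
by apply: deq_map => t v; rewrite mk_upair.
Qed.

Lemma mk_eq0 X (e : pair X) (ce : cocycle e) :
  deq (dmap (mk ce)) (dzero R X) -> cohomologous e (pzero q A B X).
Proof.
move=> /(act_deq pA pB)/(_ _ upair_cocycle) [e' ce' /= [h1 h2]].
apply: cohom_trans (cohom_trans (cohom_sym (push_mk ce)) h1) (cohom_trans (cohom_sym h2) _).
by apply: cohom_ext => v /=; rewrite !mulmx0.
Qed.

Lemma mk_cohom0 X (e : pair X) (ce : cocycle e) :
  cohomologous e (pzero q A B X) -> deq (dmap (mk ce)) (dzero R X).
Proof.
move=> h; have c0 : cocycle (pzero q A B X) by move=> v /=; rewrite mulmx0 !mul0mx.
rewrite (mk_cohom ce c0 h); apply: deq_map => t v /=.
rewrite -col_mx0; congr col_mx; rewrite /ins; case: eqP => e1 //; by subst t.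
Qed.

End Representable.

(** * Intervals and their morphisms *)

Section Intervals.
Variables (k : fieldType) (n : nat).
Implicit Types (X Y : cplx k n) (V W : rep k n).

Definition brep (s : nat -> bool) : rep k n :=
  @Rep k n (fun v => s v : nat) (fun _ _ _ => const_mx 1).

(** The interval module attached to the diagonal (i,j): its support consists of
    the vertices i+1, ..., j-1 when vertices are counted from 1. *)
Definition insupp (i j v : nat) := (i <= v)%N && (v.+1 < j)%N.
Definition intv (i j : nat) : rep k n := brep (insupp i j).

Lemma cm0 (a b c : bool) : ~~ b ->
  (const_mx 1 : 'M[k]_(a : nat, b : nat)) *m (const_mx 1 : 'M[k]_(b : nat, c : nat)) = 0.
Proof. by case: b => // _; apply/matrixP => i j; rewrite !mxE big_ord0. Qed.

Lemma cm_bound (a c : bool) (M N : 'M[k]_(a : nat, c : nat)) : ~~ (a && c) -> M = N.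
Proof.
case: a M N => M N /=; last by move=> _; apply/matrixP => [[]].
by case: c M N => // M N _; apply/matrixP => ? [[]].
Qed.

Program Definition bhom (s s' : nat -> bool)
    (h : forall u : nat, (u.+1 < n)%N -> s u.+1 -> s' u -> s u = s' u.+1) : rhom (brep s) (brep s') :=
  RHom (rmap := fun v => const_mx 1) _.
Next Obligation.
have ij : i = j.+1 :> nat by apply/eqP.
have [/andP[si sj]|nij] := boolP (s i && s' j); last exact: cm_bound.
have e : s j = s' i by rewrite ij; apply: h; rewrite -?ij.
have [sj'|nsj] := boolP (s j).
  by transitivity (const_mx 1 : 'M[k]_(s i : nat, s' j : nat)); [exact: cmM|apply/esym; apply: cmM; rewrite -e].
by transitivity (0 : 'M[k]_(s i : nat, s' j : nat)); [exact: cm0|apply/esym; apply: cm0; rewrite -e].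
Qed.

Lemma path_brep (s : nat -> bool) (v u : 'I_n) : (u <= v)%N -> (forall t, (u <= t <= v)%N -> s t) ->
  path (brep s) v u = const_mx 1.
Proof.
have [d] := ubnP (v - u)%N; elim: d u => // d IHd u ud uv hs.
have [e|nvu] := eqVneq u v.
  by rewrite e path_id cm1.
have nuv : u <> v :> nat by move=> e; case/eqP: nvu; apply: val_inj.
have uu : (u.+1 < n)%N by have := ltn_ord v; lia.
have a' : arrowA (Ordinal uu) u by rewrite /arrowA.
rewrite (path_stepr _ a') /=; last by lia.
rewrite IHd /=; [|lia|lia|by move=> t ht; apply: hs; lia].
by apply: (@cmM k (s v) (s u.+1) (s u)); apply: hs; lia.
Qed.

Lemma prj_eq0 m V (a : rhom (prj k n m) V) : (m <= n)%N ->
  (forall w : 'I_n, m = w.+1 -> a w = 0) -> forall v, a v = 0.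
Proof.
case: m a => [|m] a mn h v; first exact: (@mx_norow _ false).
pose w := Ordinal mn; have := h w erefl => e.
have -> : 0 = rzero (prj k n w.+1) V v by [].
by apply: (@top_eq k n V w a (rzero _ _)); rewrite /top /= (e) !mulmx0.
Qed.

Lemma rV_bool (b : bool) (x : 'rV[k]_(b : nat)) : exists c, x = c *: const_mx 1.
Proof.
case: b x => x; last by exists 0; apply/matrixP => ? [[]].
by exists (x 0 0); apply/matrixP => i j; rewrite !mxE mulr1 !ord1.
Qed.

Lemma hom_prj_intv0 m i' j' b (a : rhom (prj k n m) (dlt b (intv i' j'))) : (m <= n)%N ->
  ~~ [&& b, (i' < m)%N & (m < j')%N] -> forall v, a v = 0.
Proof.
case: b a => a mn h; last by move=> v; apply/matrixP => ? [[]].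
apply: prj_eq0 => // w e; apply: cm_bound; apply: contra h => /andP[_].
by rewrite /insupp e.
Qed.

Lemma hom_prj_intv1 m i' j' b : (m <= n)%N -> [&& b, (i' < m)%N & (m < j')%N] ->
  exists a : rhom (prj k n m) (dlt b (intv i' j')), (~ forall v, a v = 0) /\
    forall a' : rhom (prj k n m) (dlt b (intv i' j')), exists c, forall v, a' v = c *: a v.
Proof.
case: b => //; case: m => // m mn /= h; pose w := Ordinal mn.
have hw : insupp i' j' w by rewrite /insupp /=; lia.
exists (@elt k n (intv i' j') w (const_mx 1)); split=> [h0|a'].
  have := top_elt (const_mx 1 : 'rV[k]_(rdim (intv i' j') w)).
  rewrite /top h0 mulmx0 => /matrixP/(_ 0).
  rewrite /= hw => /(_ 0); rewrite !mxE => /eqP.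
  by rewrite eq_sym oner_eq0.
have [c e] := rV_bool (top (a' : rhom (prj k n w.+1) (intv i' j'))).
exists c => v.
have -> : c *: elt (const_mx 1 : 'rV[k]_(rdim (intv i' j') w)) v = rscale c (elt (const_mx 1 : 'rV[k]_(rdim (intv i' j') w))) v by [].
apply: (@top_eq k n _ w a' (rscale c (elt _))); rewrite e /top /= -scalemxAr; congr (_ *: _).
exact: (esym (top_elt (const_mx 1 : 'rV[k]_(rdim (intv i' j') w)))).
Qed.

Lemma prj_incl_path m m' (h : (m <= m')%N) V (a : rhom (prj k n m') V) (w u : 'I_n) :
  m' = w.+1 -> m = u.+1 -> (const_mx 1 : 'rV[k]_((u < m)%N : nat)) *m (prj_incl k n h u *m a u) =
    (const_mx 1 : 'rV[k]_((w < m')%N : nat)) *m a w *m path V w u.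
Proof.
move=> ew eu; subst m m'.
rewrite -mulmxA -(path_rmap a) path_prj ?mulmxA; [|lia..].
congr (_ *m _); transitivity (const_mx 1 : 'rV[k]_((u < w.+1)%N : nat)).
  by apply: (@cmM k true (u < u.+1)%N (u < w.+1)%N).
by apply/esym; apply: (@cmM k true (w < w.+1)%N (u < w.+1)%N).
Qed.

Lemma intv_restr i m i' j' b (h : (i <= m)%N) : (m <= n)%N -> (i' < i)%N -> (m < j')%N ->
  (forall a : rhom (prj k n m) (dlt b (intv i' j')),
     (forall v, prj_incl k n h v *m a v = 0) -> forall v, a v = 0) /\
  (forall a : rhom (prj k n i) (dlt b (intv i' j')), exists c : rhom (prj k n m) (dlt b (intv i' j')),
     forall v, a v = prj_incl k n h v *m c v).
Proof.
case: b; last first.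
  by move=> *; split=> a; [move=> _ v | exists (rzero _ _) => v]; apply/matrixP => ? [[]].
case: i h => // i h; case: m h => // m h mn ii' mj'.
have iN : (i < n)%N by lia.
pose u := Ordinal iN; pose w := Ordinal mn.
have pE : path (intv i' j') w u = const_mx 1.
  by apply: path_brep => //= t; rewrite /insupp; lia.
have hw : insupp i' j' w by rewrite /insupp /=; lia.
have hu : insupp i' j' u by rewrite /insupp /=; lia.
split=> a.
  move=> a0; have e := @prj_incl_path _ _ h _ (a : rhom _ (intv i' j')) w u erefl erefl.
  move: e; rewrite a0 mulmx0 pE => e.
  have {}e : top (a : rhom (prj k n w.+1) (intv i' j')) = 0.
    rewrite /top -[LHS]mulmx1 (cm1 _ (insupp i' j' w)).
    have <- := @cmM k (insupp i' j' w) (insupp i' j' u) (insupp i' j' w) hu.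
    by rewrite !mulmxA -e mul0mx.
  move=> v; have -> : 0 = rzero (prj k n w.+1) (intv i' j') v by [].
  by apply: (@top_eq k n _ w a (rzero _ _)); rewrite e /top /= mulmx0.
have [c ec] := rV_bool (top (a : rhom (prj k n u.+1) (intv i' j'))).
exists (rscale c (@elt k n (intv i' j') w (const_mx 1))) => v.
have -> : prj_incl k n h v *m rscale c (@elt k n (intv i' j') w (const_mx 1)) v
   = rcomp (rscale c (@elt k n (intv i' j') w (const_mx 1))) (prj_incl k n h) v by [].
apply: (@top_eq k n _ u a (rcomp (rscale c (@elt k n (intv i' j') w (const_mx 1))) (prj_incl k n h))); rewrite ec /top /=.
have := @prj_incl_path _ _ h _ (rscale c (@elt k n (intv i' j') w (const_mx 1))) w u erefl erefl.
rewrite /= => ->.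
rewrite pE -scalemxAr -scalemxAl; congr (_ *: _).
have := top_elt (const_mx 1 : 'rV[k]_(rdim (intv i' j') w)); rewrite /top => ->.
by apply/esym; apply: (@cmM k true (insupp i' j' w) (insupp i' j' u)).
Qed.

End Intervals.

(** * Morphisms between shifted intervals *)

Section Labels.
Variables (k : fieldType) (n : nat).
Implicit Types (X Y : cplx k n) (V W : rep k n).

(** The label (q,i,j) stands for the interval M(i,j) in cohomological degree
    q+2, so that its projective resolution lives in the degrees q+1 and q+2;
    writing degrees as successors avoids all transports along equalities of
    integers. *)
Record label := Label { lq : int; li : nat; lj : nat; lok : (li.+1 < lj)%N && (lj <= n.+1)%N }.

Lemma label_eq (L L' : label) : lq L = lq L' -> li L = li L' -> lj L = lj L' -> L = L'.
Proof.
case: L L' => q i j h [q' i' j' h'] /= e1 e2 e3; subst q' i' j'.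
by rewrite (bool_irrelevance h h').
Qed.

Lemma lok_le L : (li L <= (lj L).-1)%N.
Proof. by have := lok L; lia. Qed.

Lemma li_le L : (li L <= n)%N. Proof. by have := lok L; lia. Qed.
Lemma lj_le L : ((lj L).-1 <= n)%N. Proof. by have := lok L; lia. Qed.

Definition res (L : label) : cplx k n := two_term (lq L) (prj_incl k n (lok_le L)).

Program Definition stk V (p : int) : cplx k n :=
  @Cplx k n (fun t => dlt (t == p) V) (fun t => rzero _ _) _ _.
Next Obligation. by rewrite mulmx0. Qed.
Next Obligation.
exists `|p|%N => t ht v /=; case: eqP => // e.
by move: ht; rewrite e ltnn.
Qed.

Definition ind (L : label) : cplx k n := stk (intv k n (li L) (lj L)) (lq L + 1 + 1).

(** In equal degrees the quotients of M(i,j) are the M(c,j) and the submodules of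
    M(i',j') the M(i',c), whence the first clause; in the second clause the target
    is M(i',j')[1], and the condition is that of a nonsplit extension. *)
Definition homl (L L' : label) : bool :=
  ((lq L' == lq L) && [&& (li L <= li L')%N, (li L' < (lj L).-1)%N & (lj L <= lj L')%N]) ||
  ((lq L' + 1 == lq L) && [&& (li L' < li L)%N, (li L < lj L')%N & (lj L' < lj L)%N]).

Lemma quot_cond L (u : nat) : (u.+1 < n)%N -> (u.+1 < (lj L).-1)%N ->
  insupp (li L) (lj L) u -> (u < (lj L).-1)%N = insupp (li L) (lj L) u.+1.
Proof. by rewrite /insupp; lia. Qed.

Program Definition res_ind (L : label) : chain (res L) (ind L) :=
  Chain (cmap := fun t => rcol (rzero (dlt (t == lq L + 1) _) _)
    (dmm (t == lq L + 1 + 1) (t == lq L + 1 + 1) (bhom k (@quot_cond L)))) _.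
Next Obligation.
rewrite mul_block_col !mulmx0 !mul0mx !add0r -[RHS]col_mx0.
congr col_mx; case: (p == _); case: (p + 1 == _); rewrite /= ?mulmx0 ?mul0mx //.
have [h|h] := boolP (v < li L)%N; last by apply: cm_bound.
by apply: cm_bound; rewrite /insupp; lia.
Qed.

Lemma cm_inj (a b c : bool) (x : 'M[k]_(a : nat, b : nat)) : (b -> c) ->
  x *m (const_mx 1 : 'M[k]_(b : nat, c : nat)) = 0 -> x = 0.
Proof.
case: b x => x; last by move=> _ _; apply/matrixP => ? [[]].
case: c => [_|/(_ isT)//]; rewrite -cm1 mulmx1.
by [].
Qed.

Lemma qis_res_ind L : qis (res_ind L).
Proof.
move=> p v; split.
  move=> x; rewrite -[x]hsubmxK; set xa := lsubmx x; set xb := rsubmx x.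
  rewrite /= mul_row_block !mulmx0 !addr0 => /eqP.
  rewrite row_mx_eq0 eqxx /= => /eqP h1 [y].
  rewrite mul_row_col !mulmx0 add0r => h2.
  suff [z hz] : exists z, xb = z *m dmm (p == lq L + 1) (p + 1 == lq L + 1 + 1) (prj_incl k n (lok_le L)) v.
    exists (row_mx z 0); rewrite mul_row_block !mulmx0 !addr0 -hz; congr row_mx.
    move: xa h1; rewrite (_ : (p + 1 + 1 == lq L + 1 + 1) = (p + 1 == lq L + 1)); last by apply/eqP/eqP; lia.
    case: (p + 1 == lq L + 1) => xa; last by move=> _; apply/matrixP => ? [[]].
    by apply: (@cm_inj true); move=> h; have := lok L; lia.
  move: xb h2; rewrite (_ : (p + 1 == lq L + 1 + 1) = (p == lq L + 1)); last by apply/eqP/eqP; lia.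
  case: (p == lq L + 1) => xb h2; last by exists 0; apply/matrixP => ? [[]].
  have [vi|vi] := boolP (v < li L)%N.
    exists (xb *m (const_mx 1 : 'M[k]_((v < (lj L).-1)%N : nat, (v < li L)%N : nat))).
    rewrite -mulmxA /= (@cmM k (v < (lj L).-1)%N (v < li L)%N (v < (lj L).-1)%N) // -cm1 mulmx1.
    by [].
  exists 0; rewrite mul0mx; apply: (@cm_inj true _ (insupp (li L) (lj L) v)) h2.
  by rewrite /insupp; lia.
move=> y _; suff [z hz] : exists z, y = z *m dmm (p + 1 == lq L + 1 + 1) (p + 1 == lq L + 1 + 1)
    (bhom k (@quot_cond L)) v.
  exists (row_mx 0 z); first by rewrite /= mul_row_block !mulmx0 mul0mx !addr0 row_mx0.
  by exists 0; rewrite mul0mx addr0 /= mul_row_col mulmx0 add0r.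
move: y => /=; case: (p + 1 == lq L + 1 + 1) => y; last by exists 0; apply/matrixP => ? [[]].
exists (y *m (const_mx 1 : 'M[k]_(insupp (li L) (lj L) v : nat, (v < (lj L).-1)%N : nat))).
case/orP: (orbN (insupp (li L) (lj L) v)) => h; last exact: (@cm_bound k true (insupp (li L) (lj L) v)).
rewrite -mulmxA /= (@cmM k (insupp (li L) (lj L) v) (v < (lj L).-1)%N (insupp (li L) (lj L) v)).
  by rewrite -cm1 mulmx1.
by move: h; rewrite /insupp; lia.
Qed.

Lemma res_ind_diso L : diso (res L) (ind L).
Proof. exact: qis_diso (@qis_res_ind L). Qed.

Let pA L : lifts (prj k n (li L)) := @lifts_prj k n _ (li_le L).
Let pB L : lifts (prj k n (lj L).-1) := @lifts_prj k n _ (lj_le L).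

Lemma mk_scale (L : label) X c (e e' : pair (lq L) (prj k n (li L)) (prj k n (lj L).-1) X)
    (ce : cocycle (prj_incl k n (lok_le L)) e) (ce' : cocycle (prj_incl k n (lok_le L)) e') :
  (forall v, e'.1 v = c *: e.1 v /\ e'.2 v = c *: e.2 v) ->
  deq (dmap (mk ce')) (dscale c (dmap (mk ce))).
Proof.
move=> h; have h' : cohomologous (prj_incl k n (lok_le L)) e' (pscale c e) by apply: cohom_ext.
rewrite (mk_cohom ce' (cocycle_scale c ce) h') /dscale -deq_map_comp.
apply: deq_map => t v /=; rewrite -scalemxAr mulmx1 scale_col_mx; congr col_mx.
  by rewrite /ins; case: eqP => e1 /=; [subst t | rewrite scaler0].
by rewrite /ins; case: eqP => e1 /=; [subst t | rewrite scaler0].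
Qed.

(** Through the projective resolution of the source, a morphism is given by an
    element of the target at one vertex, modulo the elements that come from the
    other term of the resolution. *)
Lemma hom_res L L' :
  (~~ homl L L' -> dhom0 (res L) (ind L')) /\
  (homl L L' -> exists g : dmor (res L) (ind L'), (~ deq g (dzero _ _)) /\
     forall g', exists c, deq g' (dscale c g)).
Proof.
have mkf := @mk_full k n (lq L) _ _ (prj_incl k n (lok_le L)) (pA L) (pB L).
have mk0 := @mk_eq0 k n (lq L) _ _ (prj_incl k n (lok_le L)) (pA L) (pB L).
have lA := li_le L; have lB := lj_le L; have o := lok L; have o' := lok L'.
case: (eqVneq (lq L') (lq L)) => [eq|neq].
  have noA (a : rhom (prj k n (li L)) (ind L' (lq L + 1)%R)) : forall v, a v = 0.
    apply: (hom_prj_intv0 (b := (lq L + 1 == lq L' + 1 + 1)%R)) => //.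
    by rewrite eq; apply/negP => /andP[/eqP h _]; lia.
  have hb : (lq L + 1 + 1 == lq L' + 1 + 1)%R by rewrite eq.
  split=> hL.
    move=> g; have [e [ce ->]] := mkf _ g; apply: mk_cohom0 => //.
    apply: cohom_ext => v; rewrite noA; split=> //=.
    have [h|h] := boolP ((li L' < (lj L).-1) && ((lj L).-1 < lj L'))%N; last first.
      by apply: (hom_prj_intv0 (b := (lq L + 1 + 1 == lq L' + 1 + 1)%R)) => //; rewrite hb.
    have /andP[h1 h2] := h.
    have h3 : (li L' < li L)%N by move: hL; rewrite /homl eq eqxx /=; lia.
    have [r _] := @intv_restr k n (li L) _ _ _ (lq L + 1 + 1 == lq L' + 1 + 1)%R (lok_le L) lB h3 h2.
    by apply: r => u; have [_ ->] := ce u; rewrite noA mul0mx.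
  have {}hL : [&& li L <= li L', li L' < (lj L).-1 & lj L <= lj L']%N.
    by move: hL; rewrite /homl eq eqxx /=; case: eqP => //= h; lia.
  have [|a [a0 ha]] := @hom_prj_intv1 k n (lj L).-1 (li L') (lj L') (lq L + 1 + 1 == lq L' + 1 + 1)%R lB.
    by rewrite hb; lia.
  pose e : pair (lq L) (prj k n (li L)) (prj k n (lj L).-1) (ind L') := (a, rzero _ _).
  have ce : cocycle (prj_incl k n (lok_le L)) e.
    move=> v; rewrite /= mulmx0 mul0mx; split=> //.
    apply: (@hom_prj_intv0 k n (li L) (li L') (lj L') (lq L + 1 + 1 == lq L' + 1 + 1)%R (rcomp a (prj_incl k n (lok_le L)))) => //.
    by apply/negP; lia.
  exists (dmap (mk ce)); split.
    move=> /mk0[g [h H]]; by case: a0 => v; have [+ _] := H v; rewrite /e /= mulmx0 addr0.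
  move=> g'; have [e' [ce' E]] := mkf _ g'; have [c hc] := ha e'.1.
  by exists c; rewrite E; apply: mk_scale => v; rewrite noA hc scaler0.
have noB (a : rhom (prj k n (lj L).-1) (ind L' (lq L + 1 + 1)%R)) : forall v, a v = 0.
  apply: (hom_prj_intv0 (b := (lq L + 1 + 1 == lq L' + 1 + 1)%R)) => //.
  by apply/negP => /andP[/eqP h _]; case/eqP: neq; lia.
have [eq|neq'] := eqVneq (lq L' + 1) (lq L); last first.
  split=> [hL g|]; last by rewrite /homl (negbTE neq) (negbTE neq').
  have [e [ce ->]] := mkf _ g; apply: mk_cohom0 => //.
  apply: cohom_ext => v; rewrite noB; split=> //=.
  apply: (hom_prj_intv0 (b := (lq L + 1 == lq L' + 1 + 1)%R)) => //.
  by apply/negP => /andP[/eqP h _]; case/eqP: neq'; lia.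
have hb : (lq L + 1 == lq L' + 1 + 1)%R by rewrite eq.
split=> hL.
  move=> g; have [e [ce ->]] := mkf _ g; apply: mk_cohom0 => //.
  have [/andP[h1 h2]|h] := boolP ((li L' < li L) && (li L < lj L'))%N; last first.
    apply: cohom_ext => v; rewrite noB; split=> //=.
    by apply: (hom_prj_intv0 (b := (lq L + 1 == lq L' + 1 + 1)%R)) => //; rewrite hb.
  have h3 : ((lj L).-1 < lj L')%N by move: hL; rewrite /homl eq eqxx (negbTE neq) /=; lia.
  have [_ r] := @intv_restr k n (li L) _ _ _ (lq L + 1 == lq L' + 1 + 1)%R (lok_le L) lB h1 h3.
  have [c hc] := r e.2; exists c, (rzero _ _) => v /=.
  by rewrite noB !mulmx0 !addr0 add0r; split=> //; rewrite hc.
have {}hL : [&& li L' < li L, li L < lj L' & lj L' < lj L]%N.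
  by move: hL; rewrite /homl eq eqxx (negbTE neq).
have [|a [a0 ha]] := @hom_prj_intv1 k n (li L) (li L') (lj L') (lq L + 1 == lq L' + 1 + 1)%R lA.
  by rewrite hb; lia.
pose e : pair (lq L) (prj k n (li L)) (prj k n (lj L).-1) (ind L') := (rzero _ _, a).
have ce : cocycle (prj_incl k n (lok_le L)) e by move=> v; rewrite /= !mulmx0.
exists (dmap (mk ce)); split.
  move=> /mk0[g [h H]]; case: a0 => v; have [_] := H v; rewrite /e /= mulmx0 addr0 add0r => ->.
  rewrite (@hom_prj_intv0 k n (lj L).-1 (li L') (lj L') (lq L + 1 == lq L' + 1 + 1)%R g) ?mulmx0 //.
  by apply/negP; lia.
move=> g'; have [e' [ce' E]] := mkf _ g'; have [c hc] := ha e'.2.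
by exists c; rewrite E; apply: mk_scale => v; rewrite noB hc scaler0.
Qed.

Lemma hom_ind0 L L' : ~~ homl L L' -> dhom0 (ind L) (ind L').
Proof.
move=> h; apply: (dhom0_iso (res_ind_diso L) (@diso_refl _ _ _)).
by have [h0 _] := hom_res L L'; apply: h0.
Qed.

Lemma hom_ind1 L L' : homl L L' -> exists g : dmor (ind L) (ind L'),
  (~ deq g (dzero _ _)) /\ forall g', exists c, deq g' (dscale c g).
Proof.
move=> h; have [_ /(_ h) [g [g0 hg]]] := hom_res L L'.
have [f [f' [h1 h2]]] := res_ind_diso L.
exists (dcomp g f'); split.
  by move=> e; apply: g0; rewrite -[g]deq_comp1 -h1 deq_compA e comp0d.
move=> g'; have [c e] := hg (dcomp g' f); exists c.
by rewrite -[g']deq_comp1 -h2 deq_compA e dscale_compl.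
Qed.

Lemma homl_refl L : homl L L.
Proof. by rewrite /homl eqxx; have := lok L; lia. Qed.

Lemma ind_id L : ~ deq (did (ind L)) (dzero _ _).
Proof.
move=> h; have [g [g0 _]] := hom_ind1 (homl_refl L).
by apply: g0; rewrite -[g]deq_comp1 h compd0.
Qed.

Definition lsh (L : label) : label := @Label (lq L - 1) _ _ (lok L).

Lemma ind_lsh L : diso (cshift (ind L)) (ind (lsh L)).
Proof.
have e t : (t + 1 == lq L + 1 + 1)%R = (t == lq L - 1 + 1 + 1)%R by apply/eqP/eqP; lia.
unshelve apply: chain_diso.
- unshelve refine (@Chain k n (cshift (ind L)) (ind (lsh L)) (fun t =>
    dmm (t + 1 == lq L + 1 + 1)%R (t == lq L - 1 + 1 + 1)%R (rid (intv k n (li L) (lj L)))) _).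
  by move=> p v; rewrite /= scaler0 mulmx0 mul0mx.
- unshelve refine (@Chain k n (ind (lsh L)) (cshift (ind L)) (fun t =>
    dmm (t == lq L - 1 + 1 + 1)%R (t + 1 == lq L + 1 + 1)%R (rid (intv k n (li L) (lj L)))) _).
  by move=> p v; rewrite /= scaler0 mulmx0 mul0mx.
- move=> p v /=; rewrite e; case: eqP => _ /=; first by rewrite mulmx1.
  by apply/matrixP => [[]].
- move=> p v /=; rewrite e; case: eqP => _ /=; first by rewrite mulmx1.
  by apply/matrixP => [[]].
Qed.

End Labels.

(** * Every complex is a direct sum of shifted intervals *)

Section Cohomology.
Variables (k : fieldType) (n : nat).
Implicit Types (X Y : cplx k n).

(** Dimension of the cohomology in degree p+1 *)
Definition hdim X (p : int) (v : 'I_n) : nat :=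
  (rdim (X (p + 1)%R) v - \rank (cd X (p + 1)%R v) - \rank (cd X p v))%N.

Lemma cd_ker X p v : (cd X p v <= kermx (cd X (p + 1)%R v))%MS.
Proof. by apply/sub_kermxP; rewrite cdd. Qed.

Lemma hdim_ker X p v : hdim X p v = (\rank (kermx (cd X (p + 1)%R v)) - \rank (cd X p v))%N.
Proof. by rewrite mxrank_ker. Qed.

Lemma hdim_qis X Y (f : chain X Y) p v : qis f -> hdim X p v = hdim Y p v.
Proof.
move=> hf; have [inj surj] := hf p v; rewrite !hdim_ker.
have KX := cd_ker X p v; have KY := cd_ker Y p v.
set Zx := kermx (cd X _ v) in KX *; set Zy := kermx (cd Y _ v) in KY *.
set Bx := cd X p v in KX inj *; set By := cd Y p v in KY inj surj *.
pose c := cokermx By.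
have hx := mxrank_mul_ker Zx (f (p + 1)%R v *m c).
have hy := mxrank_mul_ker Zy c.
have e1 : (Zx :&: kermx (f (p + 1)%R v *m c) == Bx)%MS.
  apply/andP; split.
    apply/rV_subP => x; rewrite sub_capmx => /andP[/sub_kermxP xd /sub_kermxP xc].
    have [|z ->] := inj x xd; last exact: submxMl.
    have : (x *m f (p + 1)%R v <= By)%MS by rewrite submxE -mulmxA xc.
    by case/submxP => y ->; exists y.
  rewrite sub_capmx KX; apply/sub_kermxP.
  by rewrite /Bx mulmxA cmapP -mulmxA mulmx_coker mulmx0.
have e2 : (Zy :&: kermx c == By)%MS.
  apply/andP; split.
    apply/rV_subP => x; rewrite sub_capmx => /andP[_ /sub_kermxP xc].
    by rewrite submxE xc.
  by rewrite sub_capmx KY; apply/sub_kermxP; rewrite mulmx_coker.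
have e3 : (Zx *m (f (p + 1)%R v *m c) == Zy *m c)%MS.
  apply/andP; split.
    rewrite mulmxA; apply: submxMr; apply/sub_kermxP.
    by rewrite -mulmxA -cmapP mulmxA mulmx_ker mul0mx.
  apply/rV_subP => y /submxP[t ->]; rewrite mulmxA.
  have [|x xd [z ->]] := surj (t *m Zy); first by rewrite -mulmxA mulmx_ker mulmx0.
  rewrite mulmxDl -[z *m _ *m c]mulmxA mulmx_coker mulmx0 addr0.
  have /submxP[s ->] : (x <= Zx)%MS by apply/sub_kermxP.
  by rewrite -!mulmxA submxMl.
rewrite (eqmxP e1) in hx; rewrite (eqmxP e2) in hy; rewrite (eqmxP e3) in hx.
by rewrite -hx -hy !addnK.
Qed.

Lemma hdim_csum X Y p v : hdim (csum X Y) p v = (hdim X p v + hdim Y p v)%N.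
Proof.
rewrite /hdim /= !rank_diag_block_mx.
have lex := mxrankS (cd_ker X p v); have ley := mxrankS (cd_ker Y p v).
rewrite !mxrank_ker in lex ley.
have := rank_leq_row (cd X (p + 1)%R v); have := rank_leq_row (cd Y (p + 1)%R v).
lia.
Qed.

Lemma not_boundary m p (D : 'M[k]_(m, p)) (w : 'rV[k]_p) : (~ exists y, w = y *m D) ->
  exists2 phi : 'cV[k]_p, D *m phi = 0 & w *m phi = 1%:M.
Proof.
move=> h; have /matrix0Pn[i [j ij]] : w *m cokermx D != 0.
  by apply: contra_notN h => /eqP e; apply/submxP; rewrite submxE e.
pose d : 'cV[k]_p := cokermx D *m delta_mx j 0.
have Dd : D *m d = 0 by rewrite mulmxA mulmx_coker mul0mx.
have wd : w *m d = ((w *m cokermx D) i j)%:M.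
  rewrite mulmxA -colE; apply/matrixP => a b; rewrite !ord1 [LHS]mxE [RHS]mxE.
  by rewrite ?(ord1 i) mulr1n.
exists (((w *m cokermx D) i j)^-1 *: d); first by rewrite -scalemxAr Dd scaler0.
by rewrite -scalemxAr wd scale_scalar_mx mulVf.
Qed.

Lemma factor_through m p r (D : 'M[k]_(m, p)) (rho : 'M[k]_(m, r)) :
  (forall x : 'rV_m, x *m D = 0 -> x *m rho = 0) -> exists psi, rho = D *m psi.
Proof.
move=> h; exists (pinvmx D *m rho).
have e : (1%:M - D *m pinvmx D) *m rho = 0.
  apply/row_matrixP => i; rewrite row_mul row0; apply: h.
  rewrite -row_mul mulmxBl mul1mx mulmxKpV // subrr; exact: row0.
by move: e; rewrite mulmxBl mul1mx => /eqP; rewrite subr_eq0 mulmxA => /eqP.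
Qed.

(** Up to the isomorphism w u, the map w is a retraction of u, and X is the sum of
    R and of the cone of u; with J in the place of R this is a single chain map. *)
Lemma qis_split R X J (u : chain R X) (w : chain X J) :
  qis (chcomp w u) -> exists s : chain X (csum J (cone u)), qis s.
Proof.
move=> h; unshelve epose (s := @Chain k n X (csum J (cone u)) (fun p =>
   @RHom k n (X p) (csum J (cone u) p) (fun v => row_mx (w p v) (row_mx 0 1%:M)) _) _).
- by move=> i j a; rewrite /= mul_mx_row mul_row_block !mulmx0 add0r addr0 rmapP
    mul_mx_row mul_row_block !mul0mx !mulmx0 !add0r mulmx1 mul1mx.
- by move=> p v; rewrite /= mul_mx_row mul_row_block !mulmx0 add0r addr0 cmapP
    mul_mx_row mul_row_block !mul0mx !mulmx0 !add0r mulmx1 mul1mx.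
exists s => p v; have [inj surj] := h p v; split.
  move=> x xd [y]; rewrite -[y]hsubmxK -[rsubmx y]hsubmxK.
  set j := lsubmx y; set r := lsubmx (rsubmx y); set x' := rsubmx (rsubmx y).
  rewrite /= mul_mx_row mul_row_block !mulmx0 addr0 add0r mul_mx_row mulmx0 mulmx1.
  rewrite mul_row_block mulmx0 addr0 => /eq_row_mx[h1 /eq_row_mx[h2 h3]].
  have rd : r *m cd R (p + 1)%R v = 0.
    by move/esym/eqP: h2; rewrite mulmxN oppr_eq0 => /eqP.
  have [|t rt] := inj r rd.
    exists (j - x' *m w p v); rewrite /= mulmxBl -h1 h3 mulmxDl -!mulmxA cmapP.
    by rewrite addrK.
  exists (t *m u p v + x'); rewrite h3 rt mulmxDl -!mulmxA cmapP.
  by [].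
move=> y; rewrite -[y]hsubmxK -[rsubmx y]hsubmxK.
set j := lsubmx y; set r := lsubmx (rsubmx y); set x' := rsubmx (rsubmx y).
rewrite /= mul_row_block !mulmx0 addr0 add0r mul_row_block mulmx0 addr0 => /eqP.
rewrite !row_mx_eq0 => /and3P[/eqP jd /eqP rd /eqP rx].
have {}rd : r *m cd R (p + 1 + 1)%R v = 0.
  by move/eqP: rd; rewrite mulmxN oppr_eq0 => /eqP.
have [|t rt] := (h (p + 1)%R v).1 r rd.
  exists (- (x' *m w (p + 1)%R v)); rewrite /= mulmxA mulNmx -(mulmxA x') -cmapP.
  by rewrite (mulmxA x') -mulNmx; congr (_ *m _); apply/eqP; rewrite -addr_eq0 rx.
pose x1 := x' + t *m u (p + 1)%R v.
have x1d : x1 *m cd X (p + 1)%R v = 0.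
  rewrite -[RHS]rx mulmxDl -mulmxA -cmapP mulmxA -rt; mx_zmod.
have [|t2 t2d [z hz]] := surj (j - x1 *m w (p + 1)%R v).
  by rewrite mulmxBl jd -mulmxA -cmapP mulmxA x1d mul0mx subr0.
exists (x1 + t2 *m u (p + 1)%R v).
  by rewrite mulmxDl x1d -mulmxA -cmapP mulmxA t2d mul0mx addr0.
exists (row_mx z (row_mx (- (t + t2)) 0)).
rewrite !mul_mx_row !mul_row_block !mulmx0 !mul0mx !addr0 !add0r !add_row_mx; congr row_mx.
  rewrite mulmxDl -mulmxA /= in hz *.
  rewrite -addrA -hz; mx_zmod.
rewrite mulmx1 mulmxN mulNmx opprK add0r; congr row_mx; first by rewrite mulmxDl -rt t2d addr0.
rewrite /x1 mulNmx mulmxDl; mx_zmod.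
Qed.

End Cohomology.

Section Decomposition.
Variables (k : fieldType) (n : nat).
Implicit Types (X Y : cplx k n) (V W : rep k n).

Lemma lift_boundary m X p (a : rhom (prj k n m) (X (p + 1))) : (m <= n)%N ->
  (forall (u : 'I_n) (x : 'rV_(rdim (X (p + 1)) u)), m = u.+1 ->
     x *m cd X (p + 1) u = 0 -> exists y, x = y *m cd X p u) ->
  (forall v, a v *m cd X (p + 1) v = 0) ->
  exists c : rhom (prj k n m) (X p), forall v, a v = c v *m cd X p v.
Proof.
case: m a => [|m] a mn h ad; first by exists (rzero _ _) => v; apply/matrixP => [[]].
pose w := Ordinal mn; have [||y hy] := h w (top (a : rhom (prj k n w.+1) _)) => //.
  by rewrite /top -mulmxA ad mulmx0.
exists (elt y) => v; apply: (@top_eq k n _ w a (rcomp (cd X p) (elt y))).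
by rewrite top_comp top_elt.
Qed.

(** Dually to [elt], linear forms at a vertex are the morphisms to its injective *)
Program Definition coelt V (w : 'I_n) (phi : 'cV[k]_(rdim V w)) : rhom V (intv k n w n.+1) :=
  RHom (rmap := fun v => path V v w *m phi *m (const_mx 1 : 'rV[k]_(insupp w n.+1 v : nat))) _.
Next Obligation.
have ij : i = j.+1 :> nat by apply/eqP.
have [wj|wj] := leqP w j; last first.
  case/orP: (orbN (insupp w n.+1 j)) => h; first by move: h; rewrite /insupp; lia.
  by move: h; rewrite /intv /=; case: (insupp w n.+1 j) => // _; apply/matrixP => ? [[]].
rewrite (path_stepl V a) // !mulmxA -!mulmxA; do 3!congr (_ *m _).
apply/esym; apply: (@cmM k true (insupp w n.+1 i) (insupp w n.+1 j)).
by rewrite /insupp; have := ltn_ord i; lia.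
Qed.

Definition outs V X (p : int) (a : rhom (X p) V) (t : int) : rhom (X t) (dlt (t == p) V) :=
  match t =P p in reflect _ b return rhom (X t) (dlt b V) with
  | ReflectT e => ecast z (rhom (X z) V) (esym e) a
  | ReflectF _ => rzero _ _ end.

Program Definition mk_out X (q : int) (A B : rep k n) (f : rhom A B)
    (a : rhom (X (q + 1)) A) (b : rhom (X (q + 1 + 1)) B)
    (h1 : forall v, cd X q v *m a v = 0)
    (h2 : forall v, a v *m f v = cd X (q + 1) v *m b v) : chain X (two_term q f) :=
  Chain (cmap := fun t => RHom (rmap := fun v => row_mx (outs a t v) (outs b t v)) _) _.
Next Obligation. by rewrite mul_mx_row mul_row_block !mulmx0 add0r addr0 !rmapP. Qed.
Next Obligation.
rewrite mul_mx_row mul_row_block !mulmx0 !addr0; congr row_mx.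
  rewrite /outs; case: (p + 1 =P q + 1) => e1; last by rewrite mulmx0.
  have e2 : p = q by lia.
  by subst p; rewrite (eq_axiomK e1) /= h1.
rewrite /outs; case: (p + 1 =P q + 1 + 1) => e2; case: (p =P q + 1) => e1;
  try (exfalso; lia); last by rewrite /= !mulmx0.
by subst p; rewrite (eq_axiomK e2) /= h2.
Qed.

Definition inj1 (L : label n) : rep k n := intv k n (li L) n.+1.
Definition inj2 (L : label n) : rep k n := intv k n (lj L).-1 n.+1.

Program Definition inj_map (L : label n) : rhom (inj1 L) (inj2 L) :=
  @bhom k n (insupp (li L) n.+1) (insupp (lj L).-1 n.+1) _.
Next Obligation. by have := lok L; move: H0 H1; rewrite /insupp; lia. Qed.

Definition cores (L : label n) : cplx k n := two_term (lq L + 1) (inj_map L).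

(** A chain map between the projective and the injective resolutions of an
    interval is invertible as soon as it is the identity on the interval. *)
Lemma qis_comparison (L : label n) (w : chain (res k L) (cores L)) (G : rhom (prj k n (lj L).-1) (inj1 L)) :
  (forall v, G v = const_mx 1) ->
  (forall t v, w t v = block_mx 0 0 (dmm (t == lq L + 1 + 1) (t == lq L + 1 + 1) G v) 0) ->
  qis w.
Proof.
move=> hG hw p v; split.
  move=> x; rewrite -[x]hsubmxK; set xa := lsubmx x; set xb := rsubmx x.
  rewrite hw /= mul_row_block !mulmx0 !addr0 => /eqP.
  rewrite row_mx_eq0 eqxx /= => /eqP h1 [y]; rewrite -[y]hsubmxK.
  rewrite !mul_row_block !mulmx0 !addr0 add0r => /eq_row_mx[h2 _].
  suff [z hz] : exists z, xb = z *m dmm (p == lq L + 1) (p + 1 == lq L + 1 + 1) (prj_incl k n (lok_le L)) v.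
    exists (row_mx z 0); rewrite mul_row_block !mulmx0 !addr0 -hz; congr row_mx.
    move: xa h1; rewrite (_ : (p + 1 + 1 == lq L + 1 + 1) = (p + 1 == lq L + 1)); last by apply/eqP/eqP; lia.
    case: (p + 1 == lq L + 1) => xa; last by move=> _; apply/matrixP => ? [[]].
    by apply: (@cm_inj k true); move=> h; have := lok L; lia.
  move: xb h2; rewrite (_ : (p + 1 == lq L + 1 + 1) = (p == lq L + 1)); last by apply/eqP/eqP; lia.
  case: (p == lq L + 1) => xb h2; last by exists 0; apply/matrixP => ? [[]].
  have [vi|vi] := boolP (v < li L)%N.
    exists (xb *m (const_mx 1 : 'M[k]_((v < (lj L).-1)%N : nat, (v < li L)%N : nat))).
    rewrite -mulmxA /= (@cmM k (v < (lj L).-1)%N (v < li L)%N (v < (lj L).-1)%N) // -cm1 mulmx1.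
    by [].
  exists 0; rewrite mul0mx; apply: (@cm_inj k true _ (insupp (li L) n.+1 v)).
    by rewrite /insupp; have := ltn_ord v; lia.
  by move: h2; rewrite /= hG.
move=> y; rewrite -[y]hsubmxK; set ya := lsubmx y; set yb := rsubmx y.
rewrite /= mul_row_block !mulmx0 !addr0 => /eqP.
rewrite row_mx_eq0 eqxx /= => /eqP h1.
suff [x [hx [z hz]]] : exists x, ya = x *m dmm (p + 1 == lq L + 1 + 1) (p + 1 == lq L + 1 + 1) G v /\
    exists z, yb = z *m dmm (p == lq L + 1 + 1) (p + 1 == lq L + 1 + 1 + 1) (inj_map L) v.
  exists (row_mx 0 x); first by rewrite mul_row_block !mulmx0 ?mul0mx !addr0 row_mx0.
  exists (row_mx z 0); rewrite hw !mul_row_block !mulmx0 ?mul0mx ?addr0 ?add0r -hz -hx.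
  by rewrite add_row_mx addr0 add0r.
have [x hx] : exists x, ya = x *m dmm (p + 1 == lq L + 1 + 1) (p + 1 == lq L + 1 + 1) G v.
  move: ya h1; rewrite (_ : (p + 1 + 1 == lq L + 1 + 1 + 1) = (p + 1 == lq L + 1 + 1)); last by apply/eqP/eqP; lia.
  case: (p + 1 == lq L + 1 + 1) => ya h1; last by exists 0; apply/matrixP => ? [[]].
  have [vj|vj] := boolP (v < (lj L).-1)%N.
    exists (ya *m (const_mx 1 : 'M[k]_(insupp (li L) n.+1 v : nat, (v < (lj L).-1)%N : nat))).
    rewrite /= hG -mulmxA (@cmM k (insupp (li L) n.+1 v) (v < (lj L).-1)%N (insupp (li L) n.+1 v)) //.
    by rewrite -cm1 mulmx1.
  exists 0; rewrite mul0mx; apply: (@cm_inj k true (insupp (li L) n.+1 v) (insupp (lj L).-1 n.+1 v)) h1.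
  by rewrite /insupp; have := ltn_ord v; lia.
exists x; split=> //; move: yb; rewrite (_ : (p + 1 == lq L + 1 + 1 + 1) = (p == lq L + 1 + 1)); last by apply/eqP/eqP; lia.
case: (p == lq L + 1 + 1) => yb; last by exists 0; apply/matrixP => ? [[]].
exists (yb *m (const_mx 1 : 'M[k]_(insupp (lj L).-1 n.+1 v : nat, insupp (li L) n.+1 v : nat))).
case/orP: (orbN (insupp (lj L).-1 n.+1 v)) => h; last exact: (@cm_bound k true (insupp (lj L).-1 n.+1 v)).
rewrite -mulmxA /= (@cmM k (insupp (lj L).-1 n.+1 v) (insupp (li L) n.+1 v) (insupp (lj L).-1 n.+1 v)).
  by rewrite -cm1 mulmx1.
by move: h; rewrite /insupp; have := lok L; lia.
Qed.

End Decomposition.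

Section Splitting.
Variables (k : fieldType) (n : nat).
Implicit Types (X Y : cplx k n) (V W : rep k n).

Lemma ex_min (P : nat -> Prop) : (exists m, P m) ->
  exists2 m, P m & forall m', (m' < m)%N -> ~ P m'.
Proof.
move=> [m]; elim/ltn_ind: m => m IHm Pm.
have [[m' m'm Pm']|h] := classic (exists2 m', (m' < m)%N & P m'); first exact: IHm Pm'.
by exists m => // m' m'm Pm'; apply: h; exists m'.
Qed.

Lemma outs_ins V W X p (a : rhom V (X p)) (b : rhom (X p) W) t v :
  ins a t v *m outs b t v = dmm (t == p) (t == p) (rcomp b a) v.
Proof.
rewrite /ins /outs; case: (t =P p) => e; last by rewrite mul0mx.
by subst t.
Qed.

Lemma outs_ins0 V W X p p' (a : rhom V (X p)) (b : rhom (X p') W) t v : p != p' ->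
  ins a t v *m outs b t v = 0.
Proof.
move=> /eqP pp; rewrite /ins /outs; case: (t =P p) => e; case: (t =P p') => e';
  rewrite ?mul0mx ?mulmx0 //; by subst t.
Qed.

(** The vertex a is minimal with nonzero cohomology there, and b is maximal such
    that some class x at b survives at a; then x generates a direct summand
    M(a,b) of the cohomology, and both the inclusion and a retraction lift to
    chain maps from the projective and to the injective resolution. *)
Lemma split_summand X : ~ acyclic X -> exists L C (s : chain X (csum (cores k L) C)),
  qis s /\ (li L < n)%N.
Proof.
move=> nX; pose ncls (a : 'I_n) p (x : 'rV_(rdim (X (p + 1)) a)) :=
  x *m cd X (p + 1) a = 0 /\ ~ exists y, x = y *m cd X p a.
have [|a0 [a [ea [p [x0 nx0]]]] mina] := @ex_min (fun m => exists a : 'I_n, m = a /\ exists p x, ncls a p x).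
  apply: NNPP => h; apply: nX => p v x xd; apply: NNPP => h'; apply: h.
  by exists v, v; split=> //; exists p, x.
subst a0.
have [q eq] : exists q, p = q + 1 by exists (p - 1); lia.
subst p.
pose surv (b : 'I_n) := exists x : 'rV_(rdim (X (q + 1 + 1)) b), [/\ x *m cd X (q + 1 + 1) b = 0, (a <= b)%N &
   ~ exists y : 'rV_(rdim (X (q + 1)) a), x *m path (X (q + 1 + 1)) b a = y *m cd X (q + 1) a].
have [|d [b [eb sb]] maxb] := @ex_min (fun m => exists b : 'I_n, m = (n - b)%N /\ surv b).
  exists (n - a)%N, a; split=> //; exists x0; rewrite path_id mulmx1.
  by case: nx0.
have {eb maxb} maxb (b' : 'I_n) : (b < b')%N -> ~ surv b'.
  move=> bb' sb'; apply: (maxb (n - b')%N); last by exists b'.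
  by rewrite eb; have := ltn_ord b'; lia.
have [x [xd ab xb]] := sb.
have Lok : (a.+1 < b.+2)%N && (b.+2 <= n.+1)%N by have := ltn_ord b; lia.
pose L := @Label n q a b.+2 Lok.
have aN := ltn_ord a; have bN := ltn_ord b.
pose al : rhom (prj k n (lj L).-1) (X (q + 1 + 1)) := elt x.
have ald v : al v *m cd X (q + 1 + 1) v = 0.
  by rewrite /= -!mulmxA path_rmap (mulmxA x) xd mul0mx mulmx0.
have [|||be hbe] := @lift_boundary k n (li L) X (q + 1) (rcomp al (prj_incl k n (lok_le L))).
- exact: ltnW.
- move=> u y ua yd; apply: NNPP => h; apply: (mina u); first by move: ua => /= ->.
  by exists u; split=> //; exists (q + 1), y.
- by move=> v /=; rewrite -mulmxA ald mulmx0.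
pose e : pair (lq L) (prj k n (li L)) (prj k n (lj L).-1) X := (al, be).
have ce : cocycle (prj_incl k n (lok_le L)) e by move=> v; split; [exact: ald|exact: hbe].
have [phi dphi xphi] := not_boundary xb.
(* by the choice of b the form phi kills the cycles at b+1, and so it factors
   through the differential *)
have [psi hpsi] : exists psi : rhom (X (q + 1 + 1 + 1)) (inj2 k L), forall v,
    coelt phi v *m inj_map k L v = cd X (q + 1 + 1) v *m psi v.
  have [bn|bn] := boolP (b.+1 < n)%N; last first.
    exists (rzero _ _) => v.
    rewrite mulmx0; apply/matrixP => i' j'; exfalso; case: j' => j' /=.
    by rewrite /insupp (_ : (b < v)%N = false) //=; apply/negbTE; have := ltn_ord v; lia.
  pose b' := Ordinal bn; have [|ps hps] := @factor_through k _ _ _ (cd X (q + 1 + 1) b') (path (X (q + 1 + 1)) b' a *m phi).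
    move=> y yd; have [[z hz]|h] := classic (exists z, y *m path (X (q + 1 + 1)) b' a = z *m cd X (q + 1) a).
      by rewrite mulmxA hz -mulmxA dphi mulmx0.
    by case: (maxb b'); rewrite //=; exists y; split=> //=; lia.
  exists (coelt ps : rhom _ (intv k n b' n.+1)) => v /=.
  case/orP: (orbN (insupp b.+1 n.+1 v)) => h; last first.
    by move: h; rewrite /intv /=; case: (insupp b.+1 n.+1 v) => // _; apply/matrixP => ? [[]].
  rewrite -mulmxA (@cmM k true (insupp a n.+1 v) (insupp b.+1 n.+1 v)); last first.
    by move: h; rewrite /insupp; lia.
  rewrite !mulmxA; congr (_ *m _).
  rewrite -(path_rmap (cd X (q + 1 + 1))) -[RHS]mulmxA -hps mulmxA path_trans //=;
    by move: h; rewrite /insupp /=; lia.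
have h1 v : cd X (q + 1) v *m coelt phi v = 0.
  by rewrite /= !mulmxA -path_rmap -[path _ _ _ *m _ *m _]mulmxA dphi mulmx0 mul0mx.
pose w : chain X (cores k L) := mk_out h1 hpsi.
have hq : qis (chcomp w (mk ce)).
  apply: (@qis_comparison k n L _ (rcomp (coelt phi) al)) => [v|t v].
    case/orP: (orbN ((v < b.+1)%N && insupp a n.+1 v)) => h; last exact: cm_bound.
    have [h1' h2'] : (v <= b)%N /\ (a <= v)%N by move: h; rewrite /insupp; lia.
    rewrite /= -!mulmxA (mulmxA (path _ b v)) path_trans // (mulmxA (path _ b a)) (mulmxA x) (mulmxA x) xphi mul1mx.
    exact: (@cmM k (v < b.+1)%N true (insupp a n.+1 v)).
  rewrite /= mul_col_row outs_ins; congr block_mx; apply: outs_ins0; apply/eqP; rewrite /=; lia.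
have [s hs] := qis_split hq.
by exists L, (cone (mk ce)), s.
Qed.
End Splitting.

Section Decompose.
Variables (k : fieldType) (n : nat).
Implicit Types (X Y : cplx k n).

Lemma qis_res_cores_diso (L : label n) : diso (cores k L) (ind k L).
Proof.
apply: diso_sym; apply: (diso_trans (diso_sym (@res_ind_diso k n L))).
pose G := @bhom k n (fun v => v < (lj L).-1)%N (insupp (li L) n.+1).
have hG u : (u.+1 < n)%N -> (u.+1 < (lj L).-1)%N -> insupp (li L) n.+1 u ->
    (u < (lj L).-1)%N = insupp (li L) n.+1 u.+1 by rewrite /insupp; lia.
unshelve epose (w := @Chain k n (res k L) (cores k L) (fun t =>
  rblock (rzero (dlt (t == lq L + 1) _) (dlt (t == lq L + 1 + 1) _)) (rzero (dlt (t == lq L + 1) _) (dlt (t == lq L + 1 + 1 + 1) _))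
   (dmm (t == lq L + 1 + 1) (t == lq L + 1 + 1) (G hG)) (rzero (dlt (t == lq L + 1 + 1) _) (dlt (t == lq L + 1 + 1 + 1) _))) _).
- move=> p v /=; rewrite !mulmx_block !mulmx0 !mul0mx !addr0 !add0r.
  have FG b c d : dmm b c (prj_incl k n (lok_le L)) v *m dmm c d (G hG) v = 0.
    case: b c d => [] [] [] /=; rewrite ?mulmx0 ?mul0mx //.
    by apply: (@cm_bound k (v < li L)%N (insupp (li L) n.+1 v)); rewrite /insupp; lia.
  have GI b c d : dmm b c (G hG) v *m dmm c d (inj_map k L) v = 0.
    case: b c d => [] [] [] /=; rewrite ?mulmx0 ?mul0mx //.
    by apply: (@cm_bound k (v < (lj L).-1)%N (insupp (lj L).-1 n.+1 v)); rewrite /insupp; lia.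
  by rewrite FG GI.
by apply: (@qis_diso _ _ _ _ w); apply: (@qis_comparison k n L w (G hG)).
Qed.

Lemma hdim_cores (L : label n) (a : 'I_n) : a = li L :> nat ->
  hdim (cores k L) (lq L + 1) a != 0%N.
Proof.
move=> ea; rewrite /hdim /cores.
set D := cd _ _ _; set D' := cd _ (lq L + 1) _.
have -> : \rank D = 0%N.
  apply/eqP; rewrite -leqn0 (leq_trans (rank_leq_col _)) //=.
  rewrite (_ : (lq L + 1 + 1 + 1 == lq L + 1 + 1) = false); last by apply/eqP; lia.
  by rewrite eqxx /= /insupp ea; have := lok L; lia.
have -> : \rank D' = 0%N.
  apply/eqP; rewrite -leqn0 (leq_trans (rank_leq_row _)) //=.
  rewrite (_ : (lq L + 1 == lq L + 1 + 1) = false); last by apply/eqP; lia.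
  by rewrite (_ : (lq L + 1 == lq L + 1 + 1 + 1) = false) //; apply/eqP; lia.
by rewrite /= eqxx /= /insupp ea; have := lok L; have := ltn_ord a; lia.
Qed.

Definition hsum X (N : nat) := (\sum_(t < N.*2.+1) \sum_(v < n) hdim X (t%:Z - N%:Z)%R v)%N.

(** Induction on the total dimension of the cohomology *)
Theorem decompose X : exists ls : seq (label n), diso X (csums ls (@ind k n)).
Proof.
have [N hN] : exists N, forall p v, (N < `|p|)%N -> hdim X p v = 0%N.
  have [N h] := cbounded X; exists N.+1 => p v hp; rewrite /hdim.
  have e : rdim (X (p + 1)) v = 0%N by apply: h; lia.
  by move: (\rank _) (\rank _) => r r'; rewrite e; lia.
have [m] := ubnP (hsum X N); elim: m X hN => // m IHm X hN hm.
have [aX|nX] := classic (acyclic X); first by exists [::]; apply: acyclic_diso0.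
have [L [C [s [hs li_n]]]] := split_summand nX.
pose a := Ordinal li_n.
have hd p v : hdim X p v = (hdim (cores k L) p v + hdim C p v)%N.
  by rewrite (hdim_qis _ _ hs) hdim_csum.
have hL : (hdim (cores k L) (lq L + 1) a != 0)%N by apply: hdim_cores.
have qN : (`|(lq L + 1)%R| <= N)%N.
  by rewrite leqNgt; apply/negP => /(hN _ a); rewrite hd; lia.
have [||ls hls] := IHm C.
- by move=> p v /(hN _ v); rewrite hd; lia.
- apply: (@leq_trans (hsum X N)); last by rewrite -ltnS.
  have tN : (`|(lq L + 1 + N%:Z)%R| < N.*2.+1)%N by lia.
  rewrite /hsum (bigD1 (Ordinal tN)) //= [X in (_ < X)%N](bigD1 (Ordinal tN)) //=.
  rewrite -addSn; apply: leq_add; last first.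
    by apply: leq_sum => t _; apply: leq_sum => v _; rewrite hd leq_addl.
  have -> : (`|(lq L + 1 + N%:Z)%R|%:Z - N%:Z)%R = lq L + 1 by lia.
  rewrite (bigD1 a) //= [X in (_ < X)%N](bigD1 a) //=.
  rewrite -addSn; apply: leq_add; last first.
    by apply: leq_sum => v _; rewrite hd leq_addl.
  by rewrite hd; lia.
exists (L :: ls); apply: diso_trans (qis_diso hs) _ => /=.
exact: csum_diso (qis_res_cores_diso L) hls.
Qed.

Lemma decompose_bip X (L0 : label n) : exists (m : nat) (T : nat -> label n),
  has_bip (iota 0 m) (fun l => ind k (T l)) X.
Proof.
have [ls d] := decompose X; exists (size ls), (nth L0 ls).
have e : csums ls (@ind k n) = csums (iota 0 (size ls)) (fun l => ind k (nth L0 ls l)).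
  by rewrite -{1}[ls](mkseq_nth L0) /csums /mkseq foldr_map.
have [io [pi [h1 h2 h3]]] : has_bip (iota 0 (size ls)) (fun l => ind k (nth L0 ls l)) (csums ls (@ind k n)).
  by rewrite e; apply/has_bip_csums/iota_uniq.
have [f [g [gf fg]]] := d.
exists (fun l => dcomp g (io l)), (fun l => dcomp (pi l) f); split.
- by move=> i hi; rewrite -deq_compA (deq_compA f) fg deq_1comp h1.
- by move=> i j hi hj ij; rewrite -deq_compA (deq_compA f) fg deq_1comp h2.
- rewrite -gf -[f in X in deq _ X]deq_1comp -h3 dsumm_compl dsumm_compr.
  by apply: dsumm_eq => i hi; rewrite !deq_compA.
Qed.

End Decompose.

(** * Shifting is faithful *)

Section Shift.
Variables (k : fieldType) (n : nat).
Implicit Types (X Y : cplx k n).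
Variables (q : int) (A B : rep k n) (f : rhom A B).
Hypotheses (pA : lifts A) (pB : lifts B).

(** A class in degree q + 1 of X, read in degree q of the shift of X *)
Definition pshift X (e : pair (q + 1) A B X) : pair q A B (cshift X) :=
  (e.1, rscale (-1) e.2).

Lemma cocycle_shift X e : @cocycle k n (q + 1) A B f X e -> cocycle f (pshift e).
Proof.
move=> ce v; have [h1 h2] := ce v; rewrite /= -!scalemxAr -scalemxAl h1 scaler0 h2.
by rewrite scalerA mulrNN mulr1 scale1r.
Qed.

Lemma cohom_shift X e e' : @cohomologous k n (q + 1) A B f X e e' <->
  cohomologous f (pshift e) (pshift e').
Proof.
split=> [[g [h H]]|[g [h H]]].
  exists (rscale (-1) g), h => v; have [h1 h2] := H v; rewrite /= h1 h2.
  rewrite -!scalemxAr -!scalemxAl !scaleN1r; split; mx_zmod.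
exists (rscale (-1) g), h => v; have := H v; rewrite /= -!scalemxAr -!scalemxAl !scaleN1r.
move=> [-> h2]; split => //.
by rewrite -[LHS]opprK h2; mx_zmod.
Qed.

(** On classes the shift only relabels degrees, and so it cannot kill a morphism
    from a two-term complex of projectives; sums of these are all objects. *)
Lemma act_shift X Y (u : dmor X Y) e e' : @act k n (q + 1) A B f X Y u e e' ->
  act f (dshift_mor u) (pshift e) (pshift e').
Proof.
have cs := fun X e e' => (@cohom_shift X e e').1.
elim: u e e' => {X Y} [X Y u|X Y s hs|X Y W g IHg u IHu|X Y u IHu g IHg] e e' /=.
- move=> /cs; apply: cohom_trans; apply: cohom_ext => v /=.
  by rewrite -scalemxAl.
- move=> [c /cs h]; split; first exact: cocycle_shift.
  apply: cohom_trans h; apply: cohom_ext => v /=.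
  by rewrite -scalemxAl.
- move=> [e1 c [a b]]; exists (pshift e1); first exact: cocycle_shift.
  by split; [exact: IHu|exact: IHg].
- move=> [e1 [e2 [a b c1 c2 /cs h]]]; exists (pshift e1), (pshift e2).
  split; [exact: IHu|exact: IHg|exact: cocycle_shift..|].
  by apply: cohom_trans h; apply: cohom_ext => v /=; rewrite scalerDr.
Qed.

Lemma shift_faithful_R Y (u : dmor (two_term (q + 1) f) Y) :
  deq (dshift_mor u) (dzero _ _) -> deq u (dzero _ _).
Proof.
move=> h; have cu := @upair_cocycle k n (q + 1) A B f.
have [e' ce' a] := act_total pA pB u cu.
rewrite -[u]deq_comp1.
have -> : deq (did (two_term (q + 1) f)) (dmap (mk cu)).
  by apply: deq_map => t v; rewrite mk_upair.
rewrite (mk_act cu ce' a); apply: mk_cohom0; apply/cohom_shift.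
have [e2 c2 [a2 /= b2]] := act_deq pA pB h (cocycle_shift cu).
apply: cohom_trans (cohom_trans (act_fun pA pB (cocycle_shift cu) (cocycle_shift cu) (cocycle_shift ce') c2 (cohom_refl f _) (act_shift a) a2) (cohom_sym b2)) _.
by apply: cohom_ext => v /=; rewrite !mulmx0 scaler0.
Qed.

End Shift.

Lemma shift_faithful (k : fieldType) n (X Y : cplx k n) (u : dmor X Y) :
  deq (dshift_mor u) (dzero _ _) -> deq u (dzero _ _).
Proof.
move=> h; have [[L0 _]|L0] := classic (exists L : label n, True).
  have [m [T [io [pi b]]]] := decompose_bip X L0.
  apply: (bip_eq0l b) => l _.
  have [f [g [gf fg]]] := res_ind_diso k (T l).
  rewrite -[io l]deq_comp1 -fg (deq_compA (io l)) deq_compA.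
  suff -> : deq (dcomp u (dcomp (io l) f)) (dzero _ _) by rewrite comp0d.
  move: (dcomp (io l) f) => {b io pi gf fg g f} f.
  have H (v : dmor (res k (T l)) Y) : deq (dshift_mor v) (dzero _ _) -> deq v (dzero _ _).
    case: (T l) v => q i j o; have [q' ->] : exists q', q = q' + 1 by exists (q - 1); lia.
    by move=> v hv; apply: shift_faithful_R hv; [exact: (lifts_prj (@li_le n (Label q o)))|exact: (lifts_prj (@lj_le n (Label q o)))].
  by apply: H; rewrite /= h comp0d.
have [[|L ls] d] := decompose X; last by case: L0; exists L.
by move: d => /diso0_id e; rewrite -[u]deq_comp1 e compd0.
Qed.

(** * The Auslander-Reiten translation of a shifted interval *)

Section TauLabels.
Variable n : nat.
Implicit Types L V : label n.

Definition ltau_q L : int := if (lj L <= n)%N then lq L else lq L - 1.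
Definition ltau_i L : nat := if (lj L <= n)%N then (li L).+1 else 0%N.
Definition ltau_j L : nat := if (lj L <= n)%N then (lj L).+1 else (li L).+2.

Lemma ltau_ok L : ((ltau_i L).+1 < ltau_j L)%N && (ltau_j L <= n.+1)%N.
Proof. by rewrite /ltau_i /ltau_j; have := lok L; case: (leqP (lj L) n); lia. Qed.

(** The inverse translation rotates M(i,j) to M(i+1,j+1); the injective M(i,n+1)
    goes to the shifted projective whose top is the socle of M(i,n+1). *)
Definition ltau L : label n := @Label n (ltau_q L) _ _ (ltau_ok L).
Definition lF L : label n := lsh (ltau L).

(** The combinatorial form of Serre duality *)
Lemma homl_serre L V : homl (ltau L) V = homl V (lsh L).
Proof.
rewrite /homl /ltau /lsh /= /ltau_i /ltau_j /ltau_q.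
have := lok L; have := lok V; case: (leqP (lj L) n) => h /= h1 h2; lia.
Qed.

Lemma homl_lsh L V : homl (lsh L) (lsh V) = homl L V.
Proof. rewrite /homl /lsh /=; lia. Qed.

Lemma homl_ltau L V : homl (ltau L) (ltau V) = homl L V.
Proof. by rewrite !homl_serre homl_lsh. Qed.

Lemma homl_lF L V : homl (lF L) (lF V) = homl L V.
Proof. by rewrite homl_lsh homl_ltau. Qed.

Lemma homl_antisym L V : homl L V -> homl V L -> L = V.
Proof.
move=> h1 h2; apply: label_eq; move: h1 h2; rewrite /homl; have := lok L; have := lok V; lia.
Qed.

End TauLabels.

Section Serre.
Variables (k : fieldType) (n : nat) (T : dfunctor k n).
Hypothesis hT : is_AR_inverse T.
Implicit Types X Y : cplx k n.

Lemma serre0 X Y : dhom0 (T Y) X <-> dhom0 X (cshift Y).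
Proof.
have [pr [pe pl _ _ [n1 n2]]] := hT.
have z1 (g : dmor X (cshift Y)) : pr X Y (dzero _ _) g = 0.
  have [+ _] := pl X Y 1 (dzero _ _) (dzero _ _) g g.
  rewrite (pe _ _ _ (dzero _ _) g g) ?dscaler0 ?deq_add0 // mul1r => e.
  by apply/eqP; rewrite -[X in X == _]addr0 -[X in _ + X](subrr (pr X Y (dzero _ _) g)) addrA -e subrr.
have z2 (f : dmor (T Y) X) : pr X Y f (dzero _ _) = 0.
  have [_ +] := pl X Y 1 f f (dzero _ _) (dzero _ _).
  rewrite (pe _ _ f f _ (dzero _ _)) ?dscaler0 ?deq_add0 // mul1r => e.
  by apply/eqP; rewrite -[X in X == _]addr0 -[X in _ + X](subrr (pr X Y f (dzero _ _))) addrA -e subrr.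
split=> h f.
  by apply: n2 => g; rewrite -(z1 f); apply: pe.
by apply: n1 => g; rewrite -(z2 f); apply: pe.
Qed.

(** By naturality, pairing with u[1] is pairing with T u. *)
Lemma tau_faithful X Y (u : dmor X Y) : deq (dfmor T u) (dzero _ _) -> deq u (dzero _ _).
Proof.
have [pr [pe pl _ pn [n1 n2]]] := hT => h.
apply: shift_faithful; rewrite -[dshift_mor u]deq_comp1.
apply: n2 => f; rewrite -(pn _ _ _ f u (did _)).
have [+ _] := pl (cshift X) X 1 (dzero _ _) (dzero _ _) (did _) (did _).
rewrite (pe _ _ _ (dzero _ _) _ (did _)) ?dscaler0 ?deq_add0 // mul1r => e.
transitivity (pr (cshift X) X (dzero _ _) (did _)).
  by apply: pe => //; rewrite h compd0.
by apply/eqP; rewrite -[X in X == _]addr0 -[X in _ + X](subrr (pr _ _ (dzero _ _) (did (cshift X)))) addrA -e subrr.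
Qed.

(** When D(X, Y[1]) is at most a line, so is its dual D(TY, X). *)
Lemma serre_line X Y (g : dmor X (cshift Y)) :
  (forall g', exists c, deq g' (dscale c g)) ->
  forall f1 f2 : dmor (T Y) X, exists c1 c2, (c1 != 0) || (c2 != 0) /\
     deq (dadd (dscale c1 f1) (dscale c2 f2)) (dzero _ _).
Proof.
have [pr [pe pl _ pn [n1 n2]]] := hT => hg f1 f2.
have z2 (f : dmor (T Y) X) : pr X Y f (dzero _ _) = 0.
  have [_ +] := pl X Y 1 f f (dzero _ _) (dzero _ _).
  rewrite (pe _ _ f f _ (dzero _ _)) ?dscaler0 ?deq_add0 // mul1r => e.
  by apply/eqP; rewrite -[X in X == _]addr0 -[X in _ + X](subrr (pr X Y f (dzero _ _))) addrA -e subrr.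
have prs (f : dmor (T Y) X) c h : pr X Y f (dscale c h) = c * pr X Y f h.
  have [_ +] := pl X Y c f f h (dzero _ _); rewrite z2 addr0 => <-.
  by apply: pe => //; rewrite deq_add0.
have pg (f : dmor (T Y) X) : pr X Y f g = 0 -> deq f (dzero _ _).
  by move=> h; apply: n1 => g'; have [c hc] := hg g'; rewrite (pe _ _ f f g' (dscale c g)) // prs h mulr0.
have [h|h] := eqVneq (pr X Y f2 g) 0.
  exists 0, 1; split; first by rewrite oner_eq0 orbT.
  by rewrite dscale0 deq0D (pg f2 h) dscaler0.
have z1 : pr X Y (dzero _ _) g = 0.
  have [+ _] := pl X Y 1 (dzero _ _) (dzero _ _) g g.
  rewrite (pe _ _ _ (dzero _ _) g g) ?dscaler0 ?deq_add0 // mul1r => e.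
  by apply/eqP; rewrite -[X in X == _]addr0 -[X in _ + X](subrr (pr X Y (dzero _ _) g)) addrA -e subrr.
exists (pr X Y f2 g), (- pr X Y f1 g); split; first by rewrite h.
apply: pg; have [-> _] := pl X Y (pr X Y f2 g) f1 (dscale (- pr X Y f1 g) f2) g g.
have -> : pr X Y (dscale (- pr X Y f1 g) f2) g = - pr X Y f1 g * pr X Y f2 g.
  have [+ _] := pl X Y (- pr X Y f1 g) f2 (dzero _ _) g g; rewrite z1 addr0 => <-.
  by apply: pe => //; rewrite deq_add0.
by rewrite mulNr mulrC subrr.
Qed.

(** Serre duality determines which intervals T(M) maps to, and this pattern is that
    of the expected translate Z.  A decomposition of T(M) therefore contains Z, and
    has no further summand because the morphisms from T(M) to a summand are at most
    a line. *)
Lemma tau_ind L : diso (T (ind k L)) (ind k (ltau L)).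
Proof.
have hm V : dhom0 (T (ind k L)) (ind k V) <-> ~~ homl (ltau L) V.
  rewrite serre0 homl_serre; split=> h.
    apply/negP => /(@hom_ind1 k) [g [g0 _]]; apply: g0.
    exact: (dhom0_iso (@diso_refl _ _ _) (@ind_lsh k n L) h).
  apply: (@dhom0_iso k n (ind k V) (ind k (lsh L))); [exact: diso_refl|exact/diso_sym/ind_lsh|exact: hom_ind0].
have [m [t [io [pi b]]]] := decompose_bip (T (ind k L)) L.
have [b1 b2 b3] := b; set Z := ltau L in hm *.
have hZ l : l \in iota 0 m -> homl Z (t l).
  move=> hl; apply: contraT => /hm h; case: (@ind_id k n (t l)).
  by rewrite -(b1 l hl) (h (pi l)) comp0d.
have [l0 hl0 h0] : exists2 l0, l0 \in iota 0 m & homl (t l0) Z.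
  apply: NNPP => h; suff /hm : dhom0 (T (ind k L)) (ind k Z) by rewrite homl_refl.
  move=> f; apply: (bip_eq0l b) => l hl; apply: hom_ind0; apply/negP => hh.
  by apply: h; exists l.
have e0 : t l0 = Z by apply: homl_antisym => //; apply: hZ.
(* a summand l other than l0 would give two independent morphisms to M(t l): its
   projection, and that of l0 followed by Z -> M(t l) *)
have uni l : l \in iota 0 m -> l = l0.
  move=> hl; apply/eqP; apply: contraT => ll0.
  have := hZ l hl; rewrite -e0 => hh; have [h [hn _]] := @hom_ind1 k n _ _ hh.
  have hs : homl (t l) (lsh L) by rewrite -homl_serre -/Z -e0.
  have [g0 [_ hg0]] := @hom_ind1 k n _ _ hs.
  have [a [a' [aa aa']]] := ind_lsh k L.
  have [|c1 [c2 [cc hc]]] := serre_line (g := dcomp a' g0) _ (pi l) (dcomp h (pi l0)).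
    move=> g'; have [c hc] := hg0 (dcomp a g'); exists c.
    by rewrite -[g']deq_1comp -aa -deq_compA hc dscale_compr.
  have c10 : c1 = 0.
    apply/eqP; apply: contraT => c1n; case: (@ind_id k n (t l)).
    apply: (dscale_eq0 c1n); rewrite -(b1 l hl) -dscale_compl.
    have : deq (dcomp (dadd (dscale c1 (pi l)) (dscale c2 (dcomp h (pi l0)))) (io l)) (dzero _ _).
      by rewrite hc comp0d.
    rewrite deq_compDl (dscale_compl c2) -deq_compA (b2 l l0) // compd0 dscaler0 deq_add0.
    by [].
  have c20 : c2 = 0.
    apply/eqP; apply: contraT => c2n; case: hn.
    apply: (dscale_eq0 c2n).
    have : deq (dcomp (dadd (dscale c1 (pi l)) (dscale c2 (dcomp h (pi l0)))) (io l0)) (dzero _ _).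
      by rewrite hc comp0d.
    rewrite deq_compDl !dscale_compl -deq_compA (b2 l0 l) 1?eq_sym // dscaler0 deq0D.
    by rewrite (b1 l0) // deq_comp1.
  by rewrite c10 c20 eqxx in cc.
rewrite -e0; exists (pi l0), (io l0); split; last exact: b1.
rewrite -b3 (dsumm1 (F := fun i => dcomp (io i) (pi i)) (iota_uniq _ _) hl0) // => j hj.
by rewrite (uni j hj) eqxx.
Qed.

Local Notation F := (tau_inv_shift T).

Lemma F_faithful X Y (u : dmor X Y) : deq (dfmor F u) (dzero _ _) -> deq u (dzero _ _).
Proof. by move=> /shift_faithful/tau_faithful. Qed.

Lemma F_ind L : diso (F (ind k L)) (ind k (lF L)).
Proof.
apply: diso_trans (ind_lsh k (ltau L)).
exact: (dfmor_diso (dshift k n) (tau_ind L)).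
Qed.

Lemma iterF_diso m X Y : diso X Y -> diso (iter m F X) (iter m F Y).
Proof. by move=> h; elim: m => //= m /(dfmor_diso F). Qed.

Lemma iterF_ind m L : diso (iter m F (ind k L)) (ind k (iter m (@lF n) L)).
Proof.
elim: m => [|m IHm] /=; first exact: diso_refl.
exact: diso_trans (dfmor_diso F IHm) (F_ind _).
Qed.

End Serre.

(** * The orbit category *)

Section Orbit.
Variables (k : fieldType) (n : nat) (F : dfunctor k n).
Implicit Types X Y Z : cplx k n.

Fixpoint iterF (m : nat) X Y (f : dmor X Y) : dmor (iter m F X) (iter m F Y) :=
  if m is m'.+1 then dfmor F (iterF m' f) else f.

(** The m-th raising of a homogeneous term, with explicit source and target *)
Fixpoint fit X Y a b (f : dmor (iter a F X) (iter b F Y)) (m : nat) :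
    dmor (iter (m + a) F X) (iter (m + b) F Y) :=
  if m is m'.+1 then dfmor F (fit f m') else f.

Lemma hraise_fit X Y a b (f : dmor (iter a F X) (iter b F Y)) m :
  iter m (@hraise k n F X Y) (HTerm f) = HTerm (fit f m).
Proof. by elim: m => //= m ->. Qed.

#[global] Instance oeq_equivalence X Y : Equivalence (@oeq k n F X Y).
Proof. split; [exact: oeq_refl | exact: oeq_sym | exact: oeq_trans]. Qed.

#[global] Instance iterF_proper m X Y : Proper (@deq k n X Y ==> @deq k n _ _) (@iterF m X Y).
Proof. by move=> f g h; elim: m => //= m IHm; rewrite IHm. Qed.

Lemma iterF_comp m X Y Z (g : dmor Y Z) (f : dmor X Y) :
  deq (iterF m (dcomp g f)) (dcomp (iterF m g) (iterF m f)).
Proof. by elim: m => //= m ->; rewrite dfmor_comp. Qed.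

Lemma iterF_id m X : deq (iterF m (did X)) (did _).
Proof. by elim: m => //= m ->; rewrite dfmor_id. Qed.

Lemma iterF0 m X Y : deq (iterF m (dzero X Y)) (dzero _ _).
Proof. by elim: m => //= m ->; rewrite dfmor0. Qed.

#[global] Instance fit_proper X Y a b m :
  Proper (@deq k n _ _ ==> @deq k n _ _) (fun f => @fit X Y a b f m).
Proof. by move=> f g h; elim: m => //= m IHm; rewrite IHm. Qed.

Lemma fit_comp X Y Z a b c (g : dmor (iter b F Y) (iter c F Z)) (f : dmor (iter a F X) (iter b F Y)) m :
  deq (fit (dcomp g f : dmor (iter a F X) (iter c F Z)) m) (dcomp (fit g m) (fit f m)).
Proof. by elim: m => //= m ->; rewrite dfmor_comp. Qed.

Lemma fit_iterF X Y (f : dmor X Y) a m : fit (iterF a f) m = iterF (m + a) f.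
Proof. by elim: m => //= m ->. Qed.

Lemma oeq_fit X Y a b (f : dmor (iter a F X) (iter b F Y)) m :
  oeq [:: HTerm (fit f m)] [:: HTerm f].
Proof.
elim: m => [|m IHm] /=; first exact: oeq_refl.
by apply: oeq_trans IHm; exact: (oeq_raise (HTerm (fit f m))).
Qed.

Lemma oeq_iterF X Y (f : dmor X Y) m :
  oeq [:: @HTerm k n F X Y m m (iterF m f)] [:: @HTerm k n F X Y 0 0 f].
Proof.
elim: m => [|m IHm] /=; first exact: oeq_refl.
by apply: oeq_trans IHm; exact: (oeq_raise (@HTerm k n F X Y m m (iterF m f))).
Qed.

Lemma oeq_term0 X Y (t : hterm F X Y) : deq (hmor t) (dzero _ _) -> oeq [:: t] [::].
Proof.
case: t => a b f /= h; apply: (oeq_trans (@oeq_mor k n F X Y a b _ _ h)); exact: oeq_zero.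
Qed.

(** The composite of two homogeneous morphisms, with its transport made explicit *)
Lemma hcompE X Y Z a b c d (g : dmor (iter c F Y) (iter d F Z))
    (f : dmor (iter a F X) (iter b F Y)) (e : (c + b)%N = (b + c)%N) :
  hcomp (HTerm g) (HTerm f) = @HTerm k n F X Z (c + a) (b + d)
    (dcomp (fit g b) (ecast x (dmor (iter (c + a) F X) (iter x F Y)) e (fit f c))).
Proof.
rewrite /hcomp; move: (hcomp_subproof _ _) => /=.
rewrite (hraise_fit f c) (hraise_fit g b) /= => e'.
by rewrite (eq_irrelevance e' e).
Qed.

Lemma ecast_comp_r X Y Z W m m' (e : m = m') (g : dmor (iter m F Y) (iter m F Z)) (h : dmor X (iter m F Y))
  (w : dmor (iter m' F Z) W) :
  dcomp w (ecast x (dmor X (iter x F Z)) e (dcomp g h)) =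
  dcomp w (dcomp (ecast x (dmor (iter x F Y) (iter x F Z)) e g) (ecast x (dmor X (iter x F Y)) e h)).
Proof. by subst m'. Qed.

Lemma ecast_iterF m m' (e : m = m') Y Z (g : dmor Y Z) :
  ecast x (dmor (iter x F Y) (iter x F Z)) e (iterF m g) = iterF m' g.
Proof. by subst m'. Qed.

Lemma ecast_proper X Y m m' (e : m = m') (f g : dmor X (iter m F Y)) : deq f g ->
  deq (ecast x (dmor X (iter x F Y)) e f) (ecast x (dmor X (iter x F Y)) e g).
Proof. by subst m'. Qed.

Lemma oeq_sum X Y (I : Type) (s : seq I) a b (f : I -> dmor (iter a F X) (iter b F Y)) :
  oeq [seq HTerm (f i) | i <- s] [:: @HTerm k n F X Y a b (dsumm s f)].
Proof.
elim: s => [|i s IHs] /=; first exact/oeq_sym/oeq_zero.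
apply: oeq_sym; apply: oeq_trans (oeq_add _ _) _.
apply: (@oeq_cat k n F X Y [:: _] [:: _] [:: _]); [exact: oeq_refl|exact: oeq_sym].
Qed.

Lemma oeq_all0 X Y (I : eqType) (s : seq I) (t : I -> hterm F X Y) :
  {in s, forall j, oeq [:: t j] [::]} -> oeq [seq t j | j <- s] [::].
Proof.
elim: s => [|j s IHs] h /=; first exact: oeq_refl.
apply: (oeq_cat (h j (mem_head _ _))); apply: IHs => l ls; apply: h.
by rewrite in_cons ls orbT.
Qed.

Lemma oeq_single X Y (I : eqType) (s : seq I) (t : I -> hterm F X Y) i u :
  uniq s -> i \in s -> {in s, forall j, j != i -> oeq [:: t j] [::]} ->
  oeq [:: t i] u -> oeq [seq t j | j <- s] u.
Proof.
move=> us si h0 h; elim: s us si h0 => //= j s IHs /andP[js us]; rewrite in_cons.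
have [e _ h0|ij /= si h0] := eqVneq i j.
  subst j.
  apply: oeq_trans h; apply: (oeq_cat (oeq_refl [:: t i])); apply: oeq_all0 => l ls.
  apply: h0; first by rewrite in_cons ls orbT.
  by apply: contraNneq js => <-.
have hj : oeq [:: t j] [::] by apply: h0; rewrite ?mem_head // eq_sym.
apply: (oeq_cat hj); apply: IHs => // l ls; apply: h0.
by rewrite in_cons ls orbT.
Qed.

Lemma oeq_flatten X Y (I : eqType) (s : seq I) (f g : I -> omor F X Y) :
  {in s, forall i, oeq (f i) (g i)} ->
  oeq (flatten [seq f i | i <- s]) (flatten [seq g i | i <- s]).
Proof.
elim: s => [|i s IHs] h /=; first exact: oeq_refl.
apply: oeq_cat; first by apply: h; rewrite mem_head.
by apply: IHs => j js; apply: h; rewrite in_cons js orbT.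
Qed.

Lemma orbit_half (I : eqType) (s : seq I) (U V : I -> cplx k n) (O P : cplx k n) io pi io' pi'
   (x y : I -> nat) (phi : forall i, dmor (iter (x i) F (U i)) (iter (y i) F (V i)))
   (psi : forall i, dmor (iter (y i) F (V i)) (iter (x i) F (U i))) : uniq s ->
  @bip k n I s U O io pi -> @bip k n I s V P io' pi' ->
  (forall i, deq (dcomp (psi i) (phi i)) (did _)) ->
  oeq (ocomp [seq @HTerm k n F P O (y i) (x i) (dcomp (iterF (x i) (io i)) (dcomp (psi i) (iterF (y i) (pi' i)))) | i <- s]
             [seq @HTerm k n F O P (x i) (y i) (dcomp (iterF (y i) (io' i)) (dcomp (phi i) (iterF (x i) (pi i)))) | i <- s])
      (oid F O).
Proof.
move=> us [_ _ b3] [c1 c2 _] hp; rewrite /ocomp -map_comp.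
apply: oeq_trans (_ : oeq (flatten [seq [:: @HTerm k n F O O 0 0 (dcomp (io i) (pi i))] | i <- s]) _); last first.
  rewrite (_ : flatten _ = [seq @HTerm k n F O O 0 0 (dcomp (io i) (pi i)) | i <- s]); last by elim: (s) => //= i l ->.
  by apply: oeq_trans (oeq_sum _ _) _; apply: oeq_mor.
apply: oeq_flatten => j js /=; rewrite -map_comp.
apply: (@oeq_single O O I s _ j) => // [i si ij|] /=.
  rewrite (hcompE _ _ (addnC (y j) (y i))); apply: oeq_term0 => /=.
  set e := addnC _ _.
  have E1 := fit_comp (iterF (y i) (io' i)) (dcomp (phi i) (iterF (x i) (pi i))) (y j).
  have E2 := fit_comp (iterF (x j) (io j)) (dcomp (psi j) (iterF (y j) (pi' j))) (y i).
  have E3 := fit_comp (psi j) (iterF (y j) (pi' j)) (y i).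
  rewrite E2 E3 fit_iterF fit_iterF.
  rewrite (ecast_proper e E1) fit_iterF -!deq_compA ecast_comp_r ecast_iterF.
  rewrite (deq_compA (iterF _ (pi' j))) -iterF_comp.
  by rewrite (c2 i j) // iterF0 comp0d !compd0.
rewrite (hcompE _ _ (erefl _)) /=.
apply: (@oeq_trans k n F O O _ [:: HTerm (fit (iterF (x j) (dcomp (io j) (pi j))) (y j))]).
  apply: oeq_mor; rewrite -fit_comp; apply: fit_proper.
  rewrite -!deq_compA (deq_compA (iterF _ (pi' j))) -iterF_comp c1 // iterF_id deq_1comp.
  by rewrite (deq_compA (psi j)) hp deq_1comp iterF_comp.
apply: oeq_trans (oeq_fit _ _) _.
exact: (@oeq_iterF O O (dcomp (io j) (pi j)) (x j)).
Qed.

(** The isomorphisms F^x U_i -> F^y V_i are homogeneous morphisms U_i -> V_i of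
    the orbit category, possibly of different degrees; their sum is inverted by the
    sum of their inverses. *)
Lemma bip_orbit_iso (I : eqType) (s : seq I) (U V : I -> cplx k n) (O P : cplx k n) (x y : I -> nat) :
  uniq s -> has_bip s U O -> has_bip s V P ->
  (forall i, diso (iter (x i) F (U i)) (iter (y i) F (V i))) -> orbit_iso F O P.
Proof.
move=> us [io [pi b]] [io' [pi' b']] h.
pose phi i := sval (constructive_indefinite_description _ (h i)).
have h' i := proj2_sig (constructive_indefinite_description _ (h i)).
pose psi i := sval (constructive_indefinite_description _ (h' i)).
have h'' i := proj2_sig (constructive_indefinite_description _ (h' i)).
eexists; eexists; split.
  exact: (@orbit_half I s U V O P io pi io' pi' x y phi psi us b b' (fun i => (h'' i).1)).
exact: (@orbit_half I s V U P O io' pi' io pi y x psi phi us b' b (fun i => (h'' i).2)).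
Qed.

Lemma diso_orbit_iso x y (U V : cplx k n) : diso (iter x F U) (iter y F V) -> orbit_iso F U V.
Proof.
have b W : @has_bip k n unit [:: tt] (fun=> W) W.
  exists (fun=> did W), (fun=> did W); split=> [[] _|[] []|] //=; first by rewrite deq_comp1.
  by rewrite deq_add0 deq_comp1.
by move=> h; apply: (bip_orbit_iso (x := fun=> x) (y := fun=> y) _ (b U) (b V)).
Qed.

(** * Morphisms that vanish in the orbit category *)

(** The morphism from F^m X to F^m' Y obtained by raising a homogeneous term, and
    zero if there is none *)
Fixpoint up m m' X Y a b (f : dmor (iter a F X) (iter b F Y)) :
    dmor (iter m F X) (iter m' F Y) :=
  match a =P m, b =P m' with
  | ReflectT e, ReflectT e' =>
      ecast z (dmor (iter z F X) (iter m' F Y)) e (ecast z (dmor (iter a F X) (iter z F Y)) e' f)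
  | _, _ => match m, m' return dmor (iter m F X) (iter m' F Y) with
            | m1.+1, m1'.+1 => dfmor F (up m1 m1' f)
            | _, _ => dzero _ _ end
  end.

Lemma up_id X Y a b (f : dmor (iter a F X) (iter b F Y)) : up a b f = f.
Proof. by case: a f => [|a] f /=; case: eqP => // e; case: eqP => // e'; rewrite (eq_axiomK e) (eq_axiomK e'). Qed.

Lemma up_proper m m' X Y a b (f g : dmor (iter a F X) (iter b F Y)) :
  deq f g -> deq (up m m' f) (up m m' g).
Proof.
move=> h; elim: m m' => [|m IHm] [|m'] /=;
  case: eqP => e; rewrite ?IHm //; case: eqP => e'; rewrite ?IHm //;
  by subst a b.
Qed.

Lemma up_add m m' X Y a b (f g : dmor (iter a F X) (iter b F Y)) :
  deq (up m m' (dadd f g)) (dadd (up m m' f) (up m m' g)).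
Proof.
elim: m m' => [|m IHm] [|m'] /=;
  case: eqP => e; rewrite ?IHm ?dfmor_add ?deq_add0 //; case: eqP => e'; rewrite ?IHm ?dfmor_add ?deq_add0 //;
  by subst a b.
Qed.

Lemma up_zero m m' X Y a b : deq (up m m' (dzero (iter a F X) (iter b F Y))) (dzero _ _).
Proof.
elim: m m' => [|m IHm] [|m'] /=;
  case: eqP => e; rewrite ?IHm ?dfmor0 //; case: eqP => e'; rewrite ?IHm ?dfmor0 //;
  by subst a b.
Qed.

Lemma up_raise m m' X Y a b (f : dmor (iter a F X) (iter b F Y)) :
  ~ (a = m /\ b = m') ->
  deq (@up m m' X Y a.+1 b.+1 (dfmor F f)) (up m m' f).
Proof.
elim: m m' => [|m IHm] [|m'] nab.
- by rewrite /=; repeat (case: eqP => // ?); case: nab.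
- by rewrite /=; repeat (case: eqP => // ?); case: nab.
- by rewrite /=; repeat (case: eqP => // ?); case: nab.
- rewrite [up m.+1 m'.+1 f]/=.
  have -> : deq (match a =P m.+1, b =P m'.+1 with
    | ReflectT e, ReflectT e' => ecast z (dmor (iter z F X) (iter m'.+1 F Y)) e (ecast z (dmor (iter a F X) (iter z F Y)) e' f)
    | _, _ => dfmor F (up m m' f) end) (dfmor F (up m m' f)).
    by case: (a =P m.+1) => // e; case: (b =P m'.+1) => // e'; case: nab.
  rewrite /=; case: (a.+1 =P m.+1) => e; last first.
    by apply: dfmor_eq; apply: IHm => -[ea _]; apply: e; rewrite ea.
  case: (b.+1 =P m'.+1) => e'; last first.
    by apply: dfmor_eq; apply: IHm => -[_ ea]; apply: e'; rewrite ea.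
  have [ea eb] : a = m /\ b = m' by split; lia.
  by subst a b; rewrite (eq_axiomK e) (eq_axiomK e') up_id.
Qed.

Definition usum m m' X Y (f : omor F X Y) : dmor (iter m F X) (iter m' F Y) :=
  foldr (fun t g => dadd (up m m' (hmor t)) g) (dzero _ _) f.

Lemma usum_cat m m' X Y (f g : omor F X Y) :
  deq (usum m m' (f ++ g)) (dadd (usum m m' f) (usum m m' g)).
Proof. by elim: f => [|t f IHf] /=; rewrite ?deq0D // IHf deq_addA. Qed.

(** Equal morphisms of the orbit category have, in each degree, components that
    become equal in the derived category after applying F sufficiently often. *)
Lemma usum_oeq a b X Y (f g : omor F X Y) : oeq f g ->
  exists m0, forall m, (m0 <= m)%N -> deq (usum (m + a) (m + b) f) (usum (m + a) (m + b) g).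
Proof.
elim=> {f g}.
- by move=> f; exists 0%N.
- by move=> f g _ [m h]; exists m => m' /h ->.
- move=> f g h _ [m1 h1] _ [m2 h2]; exists (maxn m1 m2) => m; rewrite geq_max => /andP[l1 l2].
  by rewrite h1 ?h2.
- move=> f f' g g' _ [m1 h1] _ [m2 h2]; exists (maxn m1 m2) => m; rewrite geq_max => /andP[l1 l2].
  by rewrite !usum_cat h1 ?h2.
- by move=> f g; exists 0%N => m _; rewrite !usum_cat deq_addC.
- by move=> c d f g h; exists 0%N => m _ /=; rewrite (up_proper _ _ h).
- by move=> c d f g; exists 0%N => m _ /=; rewrite up_add deq_addA.
- by move=> c d; exists 0%N => m _ /=; rewrite up_zero deq_add0.
- move=> t; exists (hsrc t).+1 => m hm /=; rewrite !deq_add0; apply: up_raise => -[e _].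
  by move: hm; rewrite e; lia.
Qed.

Hypothesis Ff : forall X Y (u : dmor X Y), deq (dfmor F u) (dzero _ _) -> deq u (dzero _ _).

Lemma oeq0_deq X Y a b (f : dmor (iter a F X) (iter b F Y)) :
  oeq [:: HTerm f] [::] -> deq f (dzero _ _).
Proof.
case/(usum_oeq a b) => m /(_ m (leqnn m)) /=; rewrite deq_add0.
elim: m => [|m IHm]; first by rewrite up_id.
rewrite /=; case: eqP => e; first by exfalso; lia.
by move/Ff/IHm.
Qed.

(** As F is faithful, no component becomes zero by raising it. *)
Lemma ext1_eq0 X Y : orbit_Ext1_eq0 F X Y <->
  forall a b, dhom0 (iter a F X) (iter b F (cshift Y)).
Proof.
split=> h; first by move=> a b f; apply: (@oeq0_deq X (cshift Y)); apply: h.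
elim=> [|[a b f] g IHg]; first exact: oeq_refl.
by apply: (@oeq_cat k n F X (cshift Y) [:: _] [::] g [::]) => //; apply: oeq_term0; apply: h.
Qed.

End Orbit.

(** * Cluster variables as lambda lengths *)

Section Lambda.
Variables (n : nat) (K : fieldType) (xv yv zv : 'I_n -> K).

(** Indices are counted from 1, and x_0 = x_(n+1) = 1. *)
Definition xx (c : nat) : K := \prod_(i < n | i.+1 == c) xv i.
Definition yprod (b c : nat) : K := \prod_(i < n | (b <= i < c)%N) yv i.
Definition zprod (b c : nat) : K := \prod_(i < n | (b <= i.+1 < c)%N) zv i.
Definition Yp (c : nat) : K := \prod_(i < n | (i < c)%N) yv i.
Definition Zp (c : nat) : K := \prod_(i < n | (i < c)%N) zv i.
Definition wt (c : nat) : K := Yp c / (Zp c * xx c * xx c.+1).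

(** With S_j the sum of the w_c for c < j, the quantity x_i x_j (S_j - S_i) is a
    2x2 minor; these minors satisfy Ptolemy relations, and the monomials in y and
    z turn them into exchange relations with coefficients. *)
Definition gX (d : nat * nat) : K :=
  if d.2 == n.+2 then xx d.1
  else xx d.1 * xx d.2 * Zp d.2.-1 / Yp d.1 * \sum_(d.1 <= c < d.2) wt c.

Hypotheses (x0 : forall i, xv i != 0) (y0 : forall i, yv i != 0) (z0 : forall i, zv i != 0).

Lemma xx_neq0 c : xx c != 0. Proof. by apply/prodf_neq0 => i _; apply: x0. Qed.
Lemma Yp_neq0 c : Yp c != 0. Proof. by apply/prodf_neq0 => i _; apply: y0. Qed.
Lemma Zp_neq0 c : Zp c != 0. Proof. by apply/prodf_neq0 => i _; apply: z0. Qed.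

Lemma xx_out c : (c == 0%N) || (n < c)%N -> xx c = 1.
Proof. by move=> h; rewrite /xx big_pred0 // => i; apply/negbTE; have := ltn_ord i; lia. Qed.

Lemma xx_ord (i : 'I_n) : xx i.+1 = xv i.
Proof. by rewrite /xx (big_pred1 i) // => j; rewrite eqSS. Qed.

Lemma Yp_split b c : (b <= c)%N -> Yp c = Yp b * yprod b c.
Proof.
move=> bc; rewrite /Yp (bigID (fun i : 'I_n => i < b)%N) /=; congr (_ * _).
  by apply: eq_bigl => i; lia.
by apply: eq_bigl => i; lia.
Qed.

Lemma Zp_split b c : (0 < b <= c)%N -> Zp c.-1 = Zp b.-1 * zprod b c.
Proof.
move=> bc; rewrite /Zp (bigID (fun i : 'I_n => i < b.-1)%N) /=; congr (_ * _).
  by apply: eq_bigl => i; lia.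
by apply: eq_bigl => i; lia.
Qed.

Lemma gX_side j : (j <= n)%N -> gX (j, j.+1) = 1.
Proof.
move=> jn; rewrite /gX /= eqSS (_ : (j == n.+1) = false); last by apply/eqP; lia.
rewrite big_nat1 /wt; field.
by rewrite !xx_neq0 Yp_neq0 Zp_neq0.
Qed.

Lemma gX_side0 : gX (0%N, n.+2) = 1.
Proof. by rewrite /gX /= eqxx xx_out. Qed.

Lemma gX_siden : gX (n.+1, n.+2) = 1.
Proof. by rewrite /gX /= eqxx xx_out ?ltnSn ?orbT. Qed.

(** The Ptolemy relation; the coefficient of two opposite sides is the product of the
    y_r and z_r whose arcs cross both of the other sides. *)
Lemma gX_exchange a b c d : (a < b)%N -> (b < c)%N -> (c < d)%N -> (d <= n.+2)%N ->
  gX (a, c) * gX (b, d) =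
    (if d == n.+2 then yprod a b else 1) * (gX (b, c) * gX (a, d)) +
    (if d == n.+2 then 1 else yprod b c) * zprod b c * (gX (a, b) * gX (c, d)).
Proof.
move=> ab bc cd dn; rewrite /gX /=.
have -> : (c == n.+2) = false by apply/eqP; lia.
have -> : (b == n.+2) = false by apply/eqP; lia.
have Zc := @Zp_split b c; have Yc := @Yp_split b c; have Yb := @Yp_split a b.
rewrite Zc; last by lia.
have Ya0 := Yp_neq0 a; have Yb0 := Yp_neq0 b; have Yc0 := Yp_neq0 c.
rewrite (@big_cat_nat _ _ _ b a c) /=; [|lia..].
have yab0 : yprod a b != 0 by apply/prodf_neq0 => i _; apply: y0.
have ybc0 : yprod b c != 0 by apply/prodf_neq0 => i _; apply: y0.
have [ed|nd] := eqVneq d n.+2.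
  by rewrite Yb; [field; rewrite yab0 Ya0 | lia].
rewrite (@big_cat_nat _ _ _ c b d) /=; [|lia..].
rewrite (@big_cat_nat _ _ _ b a d) /=; [|lia..].
rewrite (@big_cat_nat _ _ _ c b d) /=; [|lia..].
by rewrite Yc; [field; rewrite ybc0 Ya0 Yb0 | lia].
Qed.

End Lambda.

(** * Specialization of rational functions at rational points *)

Section Eval.
Variable n : nat.
Local Notation m := (n + n + n)%N.
Local Notation K := (ratfun n).
Local Notation tofrac := (@FracField.tofrac {mpoly rat[m]}).
Variable pt : 'I_m -> rat.

(** The value of a rational function at a point where a denominator does not
    vanish, as a functional relation *)
Definition EV (f : K) (r : rat) : Prop := exists p q : {mpoly rat[m]},
  [/\ q.@[pt] != 0, f * tofrac q = tofrac p & r * q.@[pt] = p.@[pt]].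

Lemma EV_fun f r s : EV f r -> EV f s -> r = s.
Proof.
move=> [p [q [q0 e h]]] [p' [q' [q0' e' h']]].
have E : p * q' = p' * q.
  by apply/eqP; rewrite -tofrac_eq !rmorphM /= -e -e'; apply/eqP; ring.
have := congr1 (meval pt) E; rewrite !rmorphM /= -h -h' => H.
apply: (mulIf q0); apply: (mulIf q0'); rewrite H; ring.
Qed.

Lemma EV_add f g r s : EV f r -> EV g s -> EV (f + g) (r + s).
Proof.
move=> [p [q [q0 e h]]] [p' [q' [q0' e' h']]].
exists (p * q' + p' * q), (q * q'); rewrite !rmorphM !rmorphD !rmorphM /= -e -e' -h -h'.
by split; [rewrite mulf_neq0 | ring | ring].
Qed.

Lemma EV_mul f g r s : EV f r -> EV g s -> EV (f * g) (r * s).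
Proof.
move=> [p [q [q0 e h]]] [p' [q' [q0' e' h']]].
exists (p * p'), (q * q'); rewrite !rmorphM /= -e -e' -h -h'.
by split; [rewrite mulf_neq0 | ring | ring].
Qed.

Lemma EV_neq0 f r : EV f r -> r != 0 -> f != 0.
Proof.
move=> h r0; apply: contra_neqN r0 => /eqP f0; subst f.
apply: (EV_fun h); exists 0, 1; rewrite mul0r rmorph0 !rmorph1 mul0r.
by rewrite rmorph0 oner_eq0.
Qed.

Lemma EV_inv f r : EV f r -> r != 0 -> EV f^-1 r^-1.
Proof.
move=> hf r0; have f0 := EV_neq0 hf r0; have [p [q [q0 e h]]] := hf.
exists q, p; rewrite -e -h; split; first by rewrite mulf_neq0.
  by rewrite mulrA mulVf // mul1r.
by rewrite mulrA mulVf // mul1r.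
Qed.

Lemma EV1 : EV 1 1.
Proof. by exists 1, 1; rewrite !rmorph1 !mul1r oner_eq0. Qed.

Lemma EV0 : EV 0 0.
Proof. by exists 0, 1; rewrite !rmorph1 !rmorph0 !mul0r oner_eq0. Qed.

Lemma EV_indet v : EV (indet v) (pt v).
Proof. by exists 'X_v, 1; rewrite !rmorph1 !mulr1 mevalXU oner_eq0. Qed.

Lemma EV_prod (I : Type) (s : seq I) (P : pred I) (F : I -> K) G :
  (forall i, P i -> EV (F i) (G i)) -> EV (\prod_(i <- s | P i) F i) (\prod_(i <- s | P i) G i).
Proof. by move=> h; elim/big_rec2: _ => [|i x y Pi]; [exact: EV1 | apply: EV_mul (h i Pi)]. Qed.

Lemma EV_sum (I : Type) (s : seq I) (P : pred I) (F : I -> K) G :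
  (forall i, P i -> EV (F i) (G i)) -> EV (\sum_(i <- s | P i) F i) (\sum_(i <- s | P i) G i).
Proof. by move=> h; elim/big_rec2: _ => [|i x y Pi]; [exact: EV0 | apply: EV_add (h i Pi)]. Qed.

End Eval.

Section Specialize.
Variable n : nat.
Local Notation K := (ratfun n).

Definition Xd : nat * nat -> K := gX (@xvar n) (@yvar n) (@zvar n).

Definition mkpt (x y z : 'I_n -> rat) (v : 'I_(n + n + n)) : rat :=
  match split v with
  | inl u => match split u with inl i => x i | inr i => y i end
  | inr i => z i end.

Variables (x y z : 'I_n -> rat).
Local Notation ev := (EV (mkpt x y z)).

Lemma EV_x i : ev (xvar i) (x i).
Proof. by have := EV_indet (mkpt x y z) (xvertex i); rewrite /mkpt (unsplitK (inl _)) (unsplitK (inl _)). Qed.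

Lemma EV_y i : ev (yvar i) (y i).
Proof. by have := EV_indet (mkpt x y z) (yvertex i); rewrite /mkpt (unsplitK (inl _)) (unsplitK (inr _)). Qed.

Lemma EV_z i : ev (zvar i) (z i).
Proof. by have := EV_indet (mkpt x y z) (zvertex i); rewrite /mkpt (unsplitK (inr _)). Qed.

Hypotheses (x0 : forall i, x i != 0) (y0 : forall i, y i != 0) (z0 : forall i, z i != 0).

Lemma EV_Xd d : ev (Xd d) (gX x y z d).
Proof.
have ex c : ev (xx (@xvar n) c) (xx x c) by apply: EV_prod => i _; apply: EV_x.
have ey c : ev (Yp (@yvar n) c) (Yp y c) by apply: EV_prod => i _; apply: EV_y.
have ez c : ev (Zp (@zvar n) c) (Zp z c) by apply: EV_prod => i _; apply: EV_z.
rewrite /Xd /gX; case: eqP => // _; apply: EV_mul; last first.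
  apply: EV_sum => c _; apply: (EV_mul (ey _)).
  apply: EV_inv; first exact: (EV_mul (EV_mul (ez _) (ex _)) (ex _)).
  by rewrite !mulf_neq0 ?Zp_neq0 ?xx_neq0.
apply: EV_mul; first exact: (EV_mul (EV_mul (ex _) (ex _)) (ez _)).
by apply: (EV_inv (ey _)); apply: Yp_neq0.
Qed.

End Specialize.

Import Order.TTheory Num.Theory.

Definition isdiag (n : nat) (d : nat * nat) :=
  [&& (d.1.+1 < d.2)%N, (d.2 <= n.+2)%N & (d.2 < n.+2)%N || (0 < d.1)%N].

(** * Multiplicative independence of the cluster variables *)

Section Narrow.
Variable R : realFieldType.
Implicit Types u v p : R.

Lemma narrow_neq0 v : 6%:R / 5%:R <= v -> v != 0.
Proof. by move=> h; apply: lt0r_neq0; lra. Qed.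

Lemma narrow_ge1 v p : 6%:R / 5%:R <= v -> 1 <= p -> 1 <= v * p.
Proof. by move=> h hp; apply: mulr_ege1 => //; lra. Qed.

Lemma narrow_neq1 v p : 6%:R / 5%:R <= v -> 1 <= p -> v * p <> 1.
Proof.
move=> h hp e; have : v * 1 <= v * p by rewrite ler_pM2l //; lra.
by rewrite mulr1; lra.
Qed.

Lemma narrow_prod u v p : 6%:R / 5%:R <= u -> 6%:R / 5%:R <= v -> 1 <= p ->
  4%:R / 3%:R <= u * (v * p).
Proof.
move=> hu hv hp.
have huv : 6%:R / 5%:R * (6%:R / 5%:R) <= u * v by apply: ler_pM => //; lra.
have : u * v * 1 <= u * v * p by rewrite ler_pM2l //; lra.
by rewrite mulr1 -mulrA => hh; lra.
Qed.

Lemma two_mul_neq1 p : 1 <= p -> 2%:R * p <> 1.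
Proof. by move=> h e; lra. Qed.

Lemma tail_small (q q' : R) : 0 < q -> 0 < q' ->
  (q - q') / 3%:R / (4%:R * q) < 1 / 12%:R.
Proof. by move=> h h'; rewrite ltr_pdivrMr ?mulr_gt0 //; lra. Qed.

Lemma tail_step (u v w : R) : v <= (w - u) / 3%:R -> v + w <= (4%:R * w - u) / 3%:R.
Proof. by move=> h; lra. Qed.

Lemma narrow_sum (u v r : R) : 0 <= r <= u -> 4%:R / 5%:R <= v <= 1 -> u < 1 / 12%:R ->
  6%:R / 5%:R <= r + v * (1 / 4%:R) + 1 < 4%:R / 3%:R.
Proof. by move=> h1 h2 h3; lra. Qed.

End Narrow.

Section Values.
Variable n : nat.
Local Notation Xd := (@Xd n).

Lemma diag_inf b j : isdiag n (b, j) -> ~~ (j < n.+2)%N ->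
  [/\ (b.-1 < n)%N, b.-1.+1 = b & j = n.+2].
Proof. by rewrite /isdiag /= => h1 h2; split; lia. Qed.

(** A specialization under which exactly one lambda length vanishes: all x_i and
    z_i are 1 and the points S_0, S_1, ... are distinct, except that S_i = S_j. *)
Lemma kill_diag d : isdiag n d -> (d.2 < n.+2)%N ->
  exists pt (val : nat * nat -> rat),
    (forall d', EV pt (Xd d') (val d')) /\
    (forall d', isdiag n d' -> (val d' == 0) = (d' == d)).
Proof.
case: d => i j dij jn; rewrite /isdiag /= in dij jn.
pose S (a : nat) : rat := if a == j then i%:R else a%:R.
have Sinj a b : (a < b)%N -> (S a == S b) = ((a == i) && (b == j)).
  rewrite /S; case: (eqVneq b j) => eb; case: (eqVneq a j) => ea ab; rewrite ?eqr_nat; lia.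
pose w c := S c.+1 - S c.
have w0 c : w c != 0.
  rewrite subr_eq0 eq_sym Sinj //; lia.
have w01 : w 0%N = 1 by rewrite /w /S !ifF ?subr0 //; lia.
(* for x = z = 1, this choice of y makes the weight of c equal to w c *)
pose x (t : 'I_n) : rat := 1; pose y (t : 'I_n) := w t.+1 / w t.
have x0 t : x t != 0 by rewrite oner_eq0.
have y0 t : y t != 0 by rewrite mulf_neq0 ?invr_neq0.
exists (mkpt x y x), (gX x y x); split=> [d'|[a b]]; first exact: EV_Xd.
have xx1 c : xx x c = 1 by rewrite /xx big1.
have Zp1 c : Zp x c = 1 by rewrite /Zp big1.
have YpE c : (c <= n)%N -> Yp y c = w c.
  elim: c => [|c IHc] cn; first by rewrite /Yp big1 ?w01 // => t; rewrite ltn0.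
  rewrite /Yp (bigD1 (Ordinal cn)) //= (eq_bigl (fun t : 'I_n => t < c)%N) => [|t]; last first.
    by rewrite -(inj_eq val_inj) /=; lia.
  by rewrite -/(Yp y c) IHc 1?ltnW // /y /= divfK.
rewrite /isdiag /gX /= xpair_eqE => dab; rewrite !xx1 !Zp1 !mul1r.
have [eb|nb] := eqVneq b n.+2.
  by rewrite oner_eq0; apply/esym/negbTE/negP; lia.
rewrite mulf_eq0 invr_eq0 (negbTE (Yp_neq0 y0 a)) /=.
rewrite (eq_big_nat _ _ (F2 := w)) => [|c cab]; last first.
  by rewrite /wt !xx1 Zp1 !mulr1 ?invr1 ?mulr1 YpE //; lia.
rewrite telescope_sumr; last by lia.
by rewrite subr_eq0 eq_sym Sinj //; lia.
Qed.

(** At x = y = 1 and z = 0 all lambda lengths are 1, and for x_b = y_1 = 1 + t,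
    z_b = t they are all 1 + t to the first order.  The value t = 1/4 is small
    enough to control the higher terms, which form a geometric series. *)
Lemma narrow_values : exists pt (val : nat * nat -> rat),
    (forall d, EV pt (Xd d) (val d)) /\
    (forall d, isdiag n d -> 6%:R / 5%:R <= val d < 4%:R / 3%:R).
Proof.
pose x (t : 'I_n) : rat := 5%:R / 4%:R; pose y (t : 'I_n) : rat := if t == 0%N :> nat then 5%:R / 4%:R else 1.
pose z (t : 'I_n) : rat := 1 / 4%:R.
have x0 t : x t != 0 by [].
have y0 t : y t != 0 by rewrite /y; case: ifP.
have z0 t : z t != 0 by [].
exists (mkpt x y z), (gX x y z); split=> [d|[i j]]; first exact: EV_Xd.
rewrite /isdiag /gX /= => dij.
have xxE c : (0 < c <= n)%N -> xx x c = 5%:R / 4%:R.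
  by case: c => // c cn; rewrite (xx_ord x (Ordinal cn)).
have xxE1 c : (c == 0%N) || (n < c)%N -> xx x c = 1 by apply: xx_out.
have YpE c : (c <= n)%N -> Yp y c = xx x c.
  case: c => [|c] cn; first by rewrite xxE1 // /Yp big1.
  have n0 : (0 < n)%N by lia.
  rewrite xxE // /Yp (bigD1 (Ordinal n0)) //= big1 ?mulr1 // => t /andP[_ ht].
  by rewrite /y ifF //; apply: contraNF ht => /eqP e; apply/eqP/val_inj.
have ZpE c : (c <= n)%N -> Zp z c = 4%:R ^- c.
  elim: c => [|c IHc] cn; first by rewrite /Zp big1 ?expr0 ?invr1.
  rewrite /Zp (bigD1 (Ordinal cn)) //= (eq_bigl (fun t : 'I_n => t < c)%N) => [|t]; last first.
    by rewrite -(inj_eq val_inj) /=; lia.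
  by rewrite -/(Zp z c) IHc 1?ltnW // /z exprS invfM mul1r.
have [ej|nj] := eqVneq j n.+2.
  by rewrite xxE //; lia.
have jn : (j <= n.+1)%N by lia.
have i0 : xx x i != 0 by apply: xx_neq0.
have e4 c : 4%:R ^+ c != 0 :> rat by rewrite expf_neq0.
have -> : xx x i * xx x j * Zp z j.-1 / Yp y i * \sum_(i <= c < j) wt x y z c =
    \sum_(i <= c < j) xx x j / xx x c.+1 * (4%:R ^+ c / 4%:R ^+ j.-1).
  rewrite mulr_sumr; apply: eq_big_nat => c cij.
  rewrite /wt !YpE ?ZpE; [|lia..].
  have c0 : xx x c != 0 by apply: xx_neq0.
  have c1 : xx x c.+1 != 0 by apply: xx_neq0.
  by field; rewrite i0 c0 c1 !e4.
have xle c : 1 <= xx x c <= 5%:R / 4%:R.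
  have [h|h] := boolP (0 < c <= n)%N; first by rewrite xxE.
  by rewrite xxE1 //; lia.
have xpos c : 0 < xx x c by have /andP[h _] := xle c; apply: lt_le_trans h.
case: j => // j in dij nj jn *; case: j => [|j] in dij nj jn *; first by lia.
rewrite !big_nat_recr /=; [|lia..].
set rest := \sum_(i <= c < j) _.
have e44 : 4%:R ^+ j.+1 = 4%:R * 4%:R ^+ j :> rat by rewrite exprS.
have q0 : 0 < (4%:R : rat) ^+ j by rewrite exprn_gt0.
(* the terms before the last two, which are at most 1/4 and equal to 1 *)
have tail : 0 <= rest <= (4%:R ^+ j - 4%:R ^+ i) / 3%:R / 4%:R ^+ j.+1.
  have ij : (i <= j)%N by lia.
  rewrite /rest; apply/andP; split.
    by apply: sumr_ge0 => c _; rewrite !mulr_ge0 ?invr_ge0 ?exprn_ge0 ?ltW.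
  apply: (@le_trans _ _ (\sum_(i <= c < j) (4%:R ^+ c / 4%:R ^+ j.+1))).
    rewrite big_nat [X in _ <= X]big_nat; apply: ler_sum => c cij.
    rewrite ler_piMl ?divr_ge0 ?exprn_ge0 // ler_pdivrMr // mul1r.
    by rewrite [X in _ <= X]xxE; [have /andP[] := xle j.+2 | lia].
  rewrite -mulr_suml ler_pM2r ?invr_gt0 ?exprn_gt0 //.
  elim: (j) ij => [|l IHl]; first by rewrite leqn0 => /eqP ->; rewrite big_geq // subrr mul0r.
  rewrite leq_eqVlt => /orP[/eqP<-|il]; first by rewrite big_geq // subrr mul0r.
  rewrite big_nat_recr //=; have := IHl il; move: (4%:R ^+ i) (\sum_(_ <= _ < _) _) => u v.
  by rewrite exprS; apply: tail_step.
have r1 : 4%:R / 5%:R <= xx x j.+2 / xx x j.+1 <= 1.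
  rewrite (xxE j.+1); last by lia.
  by have := xle j.+2; lra.
have -> : xx x j.+2 / xx x j.+2 * (4%:R ^+ j.+1 / 4%:R ^+ j.+1) = 1.
  by rewrite !divff ?mulr1 // ?e4 // gt_eqF.
have -> : (4%:R : rat) ^+ j / 4%:R ^+ j.+1 = 1 / 4%:R.
  by rewrite exprS; field; rewrite e4.
have t3 : (4%:R ^+ j - 4%:R ^+ i) / 3%:R / 4%:R ^+ j.+1 < 1 / 12%:R :> rat.
  have q1 : 0 < (4%:R : rat) ^+ i by rewrite exprn_gt0.
  by rewrite e44; apply: tail_small.
exact: narrow_sum tail r1 t3.
Qed.

Lemma Xd_neq0 d : isdiag n d -> Xd d != 0.
Proof.
have [pt [val [h1 h2]]] := narrow_values => hd.
apply: EV_neq0 (h1 d) _; have /andP[h _] := h2 d hd.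
exact: narrow_neq0 h.
Qed.

(** The product of two numbers from [6/5,4/3) is at least 4/3. *)
Lemma Xd_indecomposable d ds : isdiag n d -> all (isdiag n) ds ->
  Xd d = \prod_(e <- ds) Xd e -> size ds = 1%N.
Proof.
have [pt [val [h1 h2]]] := narrow_values => hd hds e.
have ep : EV pt (Xd d) (\prod_(e <- ds) val e) by rewrite e; apply: EV_prod => ? _; exact: h1.
have {ep e} e := EV_fun (h1 d) ep; have := h2 d hd; rewrite e => {e hd}.
case: ds hds => [|a [|b ds]] //=; first by rewrite big_nil.
move=> /and3P[/h2/andP[ha _] /h2/andP[hb _] hds]; rewrite !big_cons => /andP[_ hlt].
have p1 : 1 <= \prod_(j <- ds) val j.
  rewrite big_seq; elim/big_rec: _ => // i x /(allP hds)/h2/andP[hi _] hx; exact: narrow_ge1.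
by have := narrow_prod ha hb p1; rewrite leNgt hlt.
Qed.

Lemma Xd_prod1 ds : all (isdiag n) ds -> \prod_(e <- ds) Xd e = 1 -> ds = [::].
Proof.
have [pt [val [h1 h2]]] := narrow_values => hds e.
have ep : EV pt 1 (\prod_(e <- ds) val e) by rewrite -e; apply: EV_prod => ? _; exact: h1.
have {ep e} := EV_fun (EV1 pt) ep.
case: ds hds => [|a ds] //= /andP[/h2/andP[ha _] hds]; rewrite big_cons => h.
have p1 : 1 <= \prod_(j <- ds) val j.
  rewrite big_seq; elim/big_rec: _ => // i x /(allP hds)/h2/andP[hi _] hx; exact: narrow_ge1.
by case: (narrow_neq1 ha p1).
Qed.

Lemma prod_Xd_sub D D' : all (isdiag n) D -> all (isdiag n) D' ->
  \prod_(e <- D) Xd e = \prod_(e <- D') Xd e ->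
  forall d, d \in D -> (d.2 < n.+2)%N -> d \in D'.
Proof.
move=> hD hD' e d dD dn.
have [pt [val [h1 h2]]] := kill_diag (allP hD d dD) dn.
have ev s : EV pt (\prod_(e <- s) Xd e) (\prod_(e <- s) val e) by apply: EV_prod => ? _; exact: h1.
have := ev D; rewrite e => /(EV_fun (ev D')) eq.
have : \prod_(e <- D') val e == 0.
  by rewrite eq prodf_seq_eq0; apply/hasP; exists d => //=; rewrite h2 // (allP hD).
rewrite prodf_seq_eq0 => /hasP[d' d'D' /=]; rewrite h2 ?(allP hD') // => /eqP <-.
by [].
Qed.

(** Diagonals (i,j) with j <= n+1 are detected by specializations at which only
    their lambda length vanishes; after cancelling them, monomials in the x_b
    remain. *)
Lemma prod_Xd_inj D D' : uniq D -> uniq D' -> all (isdiag n) D -> all (isdiag n) D' ->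
  \prod_(e <- D) Xd e = \prod_(e <- D') Xd e -> D =i D'.
Proof.
move=> uD uD' hD hD' e.
pose fin := [pred d : nat * nat | (d.2 < n.+2)%N].
have pf : perm_eq (filter fin D) (filter fin D').
  apply: uniq_perm; rewrite ?filter_uniq // => d; rewrite !mem_filter /=.
  case: leqP => //= dn; apply/idP/idP => h; first exact: prod_Xd_sub e _ h dn.
  exact: prod_Xd_sub (esym e) _ h dn.
have split s : \prod_(e <- s) Xd e = \prod_(e <- filter fin s) Xd e * \prod_(e <- filter (predC fin) s) Xd e.
  by rewrite (bigID fin) /= !big_filter.
have nz s : all (isdiag n) s -> \prod_(e <- filter fin s) Xd e != 0.
  move=> hs; rewrite prodf_seq_neq0; apply/allP => d; rewrite mem_filter => /andP[_ ds] /=.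
  by apply/Xd_neq0/(allP hs).
have einf : \prod_(e <- filter (predC fin) D) Xd e = \prod_(e <- filter (predC fin) D') Xd e.
  apply: (mulfI (nz D hD)); rewrite -split (perm_big _ pf) -split.
  exact: e.
have sub s s' : all (isdiag n) s -> uniq s' -> all (isdiag n) s' ->
   \prod_(e <- filter (predC fin) s) Xd e = \prod_(e <- filter (predC fin) s') Xd e ->
   {subset filter (predC fin) s <= s'}.
  move=> hs us' hs' E d ds; apply: contraT => ds'.
  have /andP[dn dS] : ~~ fin d && (d \in s) by move: ds; rewrite mem_filter.
  have hd := allP hs d dS; case: d => b j in ds ds' dn dS hd *.
  have [b0 bb ej] := diag_inf hd dn.
  (* for x_b = 2 and all other variables 1, one product is at least 2, the other 1 *)
  pose x (t : 'I_n) : rat := if t.+1 == b then 2%:R else 1.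
  have x1 t : 1 <= x t by rewrite /x; case: ifP.
  have x0 t : x t != 0 by have := x1 t; lra.
  have o0 (t : 'I_n) : (1 : rat) != 0 by rewrite oner_eq0.
  have ev u : EV (mkpt x (fun=> 1) (fun=> 1)) (\prod_(e <- filter (predC fin) u) Xd e)
     (\prod_(e <- filter (predC fin) u) gX x (fun=> 1) (fun=> 1) e).
    by apply: EV_prod => ? _; exact: EV_Xd.
  have := EV_fun (ev s); rewrite E => /(_ _ (ev s')) H; exfalso.
  have g1 c : 1 <= xx x c by rewrite /xx; elim/big_rec: _ => // i y _ hy; exact: mulr_ege1.
  have eb : xx x b = 2%:R.
    by have := xx_ord x (Ordinal b0); rewrite /= bb => ->; rewrite /x /= bb eqxx.
  have : \prod_(e <- filter (predC fin) s') gX x (fun=> 1) (fun=> 1) e = 1.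
    rewrite big_seq big1 // => -[c l]; rewrite mem_filter /= => /andP[cl cs'].
    have [_ _ el] := diag_inf (allP hs' _ cs') cl.
    rewrite /gX /= el eqxx /xx big1 // => t /eqP tc; rewrite /x ifF // tc.
    apply/negP => /eqP cb; case/negP: ds'.
    by rewrite -cb ej -el.
  rewrite -H (big_rem (b, j)) //= {1}/gX /= ej eqxx.
  rewrite eb; set p := \prod_(_ <- _) _ => hp.
  have p1 : 1 <= p.
    rewrite /p big_seq; elim/big_rec: _ => // -[c l] v /mem_rem.
    rewrite mem_filter /= => /andP[cl cs] hv; have [_ _ el] := diag_inf (allP hs _ cs) cl.
    by rewrite /gX /= el eqxx; exact: mulr_ege1.
  exact: two_mul_neq1 p1 hp.
have pi : perm_eq (filter (predC fin) D) (filter (predC fin) D').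
  apply: uniq_perm; rewrite ?filter_uniq // => d; apply/idP/idP => h.
    have := sub D D' hD uD' hD' einf d h; rewrite !mem_filter in h * => ->.
    by case/andP: h => ->.
  have := sub D' D hD' uD hD (esym einf) d h; rewrite !mem_filter in h * => ->.
  by case/andP: h => ->.
move=> d; have [hf|hf] := boolP (fin d).
  by have := perm_mem pf d; rewrite !mem_filter hf.
by have := perm_mem pi d; rewrite !mem_filter /= hf.
Qed.

Lemma Xd_inj d d' : isdiag n d -> isdiag n d' -> Xd d = Xd d' -> d = d'.
Proof.
move=> hd hd' e; have := @prod_Xd_inj [:: d] [:: d'] isT isT.
rewrite /= hd hd' !big_seq1 => /(_ isT isT e d).
by rewrite !inE eqxx => /esym/eqP.
Qed.

Lemma Xd_frozen d (v : 'I_(n + n + n)) : isdiag n d -> (n <= v)%N -> Xd d <> indet v.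
Proof.
case: d => i j; rewrite /isdiag /= => dij vn e.
(* where y = z = 1, the lambda length of (b,n+2) is 2 for x = 2, and that of (i,j)
   is j - i for x = 1 *)
pose x (t : 'I_n) : rat := 2%:R; pose o (t : 'I_n) : rat := 1.
have ptv y : mkpt y o o v = 1.
  by rewrite /mkpt; case: splitP => // u eu; case: splitP => // t et; exfalso; have := ltn_ord t; lia.
have [ej|nj] := eqVneq j n.+2.
  have b0 : (i.-1 < n)%N by lia.
  have ex : Xd (i, j) = xvar (Ordinal b0).
    by rewrite /Xd /gX /= ej eqxx -(xx_ord (@xvar n) (Ordinal b0)) /= prednK //; lia.
  have h1 := EV_x x o o (Ordinal b0); rewrite -ex e in h1.
  by have := EV_fun h1 (EV_indet (mkpt x o o) v); rewrite ptv.
have o0 t : o t != 0 by [].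
have h1 := EV_Xd (n := n) o0 o0 o0 (i, j); rewrite e in h1.
have := EV_fun h1 (EV_indet (mkpt o o o) v); rewrite ptv /gX /= (negbTE nj).
have e1 c : xx o c = 1 by rewrite /xx big1.
have e2 c : Zp o c = 1 by rewrite /Zp big1.
have e3 c : Yp o c = 1 by rewrite /Yp big1.
rewrite !e1 e2 e3.
have -> : \sum_(i <= c < j) wt o o o c = (j - i)%:R.
  rewrite (eq_bigr (fun=> 1)) => [|c _]; last by rewrite /wt /Yp /Zp /xx !big1 // !mulr1 invr1.
  by rewrite sumr_const_nat.
move: (j - i)%N (ltac:(lia) : (1 < j - i)%N) => l l1 H.
have aux (R : fieldType) (t : R) : 1 * 1 * 1 / 1 * t = t by rewrite !mul1r invr1 mul1r.
have /eqP : l%:R = 1%:R :> rat by rewrite -[LHS]aux; exact: H.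
by rewrite eqr_nat => /eqP el; move: l1; rewrite el.
Qed.

End Values.

(** * Triangulations of the polygon with vertices 0, ..., n+2 *)

Section Triangulations.
Variable n : nat.
Implicit Types (e f : nat * nat) (D : 'I_n -> nat * nat).

Definition crossd e f :=
  [&& e.1 < f.1, f.1 < e.2 & e.2 < f.2]%N || [&& f.1 < e.1, e.1 < f.2 & f.2 < e.2]%N.

Definition triangulation D := [/\ injective D, forall i, isdiag n (D i) &
  forall i j, ~~ crossd (D i) (D j)].

(** Chords: the diagonals of the triangulation and the long side (0,n+2) *)
Definition chord D e := (e == (0%N, n.+2)) || [exists i, D i == e].
Definition edge D e := [&& e.2 == e.1.+1 & (e.2 <= n.+2)%N] || chord D e.

(** Cut the polygon at the last vertex t < q such that (p,t) is a chord of s or a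
    side: every chord lies on one side of t, except for (p,q). *)
Lemma noncrossing_bound s p q : (p < q)%N -> uniq s ->
  (forall e, e \in s -> [&& p <= e.1, e.1.+1 < e.2 & e.2 <= q]%N) ->
  (forall e f, e \in s -> f \in s -> ~~ crossd e f) -> (size s <= q - p - 1)%N.
Proof.
have [m] := ubnP (q - p)%N; elim: m s p q => // m IHm s p q qm pq us hs nc.
have [q1|q2] := leqP q p.+1.
  case: s us hs nc => [|e s] // _ /(_ e (mem_head _ _)); lia.
pose P t := (t == p.+1) || (((p, t) \in s) && (t < q)%N).
have exP : exists t, P t by exists p.+1; rewrite /P eqxx.
have ubP t : P t -> (t <= q)%N by rewrite /P => /orP[/eqP->|/andP[_ /ltnW]] //; lia.
have [t Pt maxt] := ex_maxnP exP ubP.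
have pt : (p < t < q)%N.
  case/orP: Pt => [/eqP->|/andP[ps tq]]; first by lia.
  by have := hs _ ps; rewrite /=; lia.
have cut e : e \in s -> [|| (e.2 <= t)%N, (t <= e.1)%N | e == (p, q)].
  move=> es; have he := hs _ es; case: e es he => i j es /= he; rewrite xpair_eqE.
  apply: contraT; rewrite !negb_or => nn.
  have nci : ~~ crossd (i, j) (p, t).
    case/orP: Pt => [/eqP->|/andP[ps tq]]; last exact: nc.
    by rewrite /crossd /=; lia.
  have ip : i = p by move: nci; rewrite /crossd /=; lia.
  by have := maxt j; rewrite /P -ip es /=; lia.
have c1 := IHm (filter (fun e => e.2 <= t)%N s) p t.
have c2 := IHm (filter (fun e => t <= e.1)%N s) t q.
have c3 : (count (pred1 (p, q)) s <= 1)%N by rewrite count_uniq_mem //; case: (_ \in _).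
have H1 : (size (filter (fun e => e.2 <= t) s) <= t - p - 1)%N.
  apply: c1; [lia|lia|exact: filter_uniq| |].
    by move=> e; rewrite mem_filter => /andP[et /hs]; lia.
  by move=> e f; rewrite !mem_filter => /andP[_ es] /andP[_ fs]; apply: nc.
have H2 : (size (filter (fun e => t <= e.1) s) <= q - t - 1)%N.
  apply: c2; [lia|lia|exact: filter_uniq| |].
    by move=> e; rewrite mem_filter => /andP[et /hs]; lia.
  by move=> e f; rewrite !mem_filter => /andP[_ es] /andP[_ fs]; apply: nc.
rewrite !size_filter in H1 H2.
have : (size s <= count (fun e => e.2 <= t) s + count (fun e => t <= e.1) s + count (pred1 (p, q)) s)%N.
  clear -cut; elim: s cut => //= e l IHl cut; have := cut e (mem_head _ _).
  have /IHl : forall x, x \in l -> [|| (x.2 <= t)%N, (t <= x.1)%N | x == (p, q)].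
    by move=> x xl; apply: cut; rewrite in_cons xl orbT.
  lia.
clear -H1 H2 c3 pt; lia.
Qed.

Section Fixed.
Variable D : 'I_n -> nat * nat.
Hypothesis tD : triangulation D.

Lemma chordP e : reflect (e = (0%N, n.+2) \/ exists i, D i = e) (chord D e).
Proof.
apply: (iffP orP) => -[h|h].
- by left; apply/eqP.
- by right; case/existsP: h => i /eqP; exists i.
- by left; apply/eqP.
- by right; case: h => i h; apply/existsP; exists i; apply/eqP.
Qed.

Lemma chord_bounds e : chord D e -> (e.1.+1 < e.2)%N && (e.2 <= n.+2)%N.
Proof.
have [_ hd _] := tD; case/chordP => [->|[i <-]]; first by rewrite /=.
by have := hd i; rewrite /isdiag; lia.
Qed.

Lemma edge_bounds e : edge D e -> (e.1 < e.2)%N && (e.2 <= n.+2)%N.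
Proof. by case/orP=> [|/chord_bounds]; lia. Qed.

Lemma chord_nc e f : chord D e -> chord D f -> ~~ crossd e f.
Proof.
have [_ hd nc] := tD => he hf; have := chord_bounds he; have := chord_bounds hf.
move: he hf => /chordP[->|[i <-]] /chordP[->|[j <-]]; rewrite ?nc /crossd //=; lia.
Qed.

Lemma edge_nc e f : edge D e -> edge D f -> ~~ crossd e f.
Proof.
move=> he hf; have := edge_bounds he; have := edge_bounds hf.
move: he hf; rewrite /edge => /orP[he|he] /orP[hf|hf]; last by rewrite chord_nc.
- by rewrite /crossd; lia.
- by rewrite /crossd; lia.
- by rewrite /crossd; lia.
Qed.

Lemma chord_edge e : chord D e -> edge D e.
Proof. by rewrite /edge => ->; rewrite orbT. Qed.

Lemma D_chord i : chord D (D i).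
Proof. by apply/chordP; right; exists i. Qed.

(** A triangulation is a maximal noncrossing set, by counting. *)
Lemma chord_max e : (e.1.+1 < e.2)%N -> (e.2 <= n.+2)%N ->
  (forall f, chord D f -> ~~ crossd e f) -> chord D e.
Proof.
have [inj hd nc] := tD => e1 e2 h; apply: contraT => ne.
have nce f : chord D f -> ~~ crossd f e by move/h; rewrite /crossd orbC.
pose s := e :: (0%N, n.+2) :: [seq D i | i <- enum 'I_n].
have sP f : f \in s -> f = e \/ chord D f.
  rewrite !inE => /or3P[/eqP->|/eqP->|/mapP[i _ ->]]; [by left|right..].
    by rewrite /chord eqxx.
  exact: D_chord.
have us : uniq s.
  rewrite /= map_inj_uniq // enum_uniq andbT; apply/andP; split.
    apply: contra ne; rewrite inE => /orP[/eqP->|/mapP[i _ ->]]; first by rewrite /chord eqxx.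
    exact: D_chord.
  apply/negP => /mapP[i _ ei]; have := hd i; rewrite -ei /isdiag /=; lia.
have := @noncrossing_bound s 0 n.+2 isT us.
rewrite /= size_map size_enum_ord => /(_ _ _)H.
have : (n.+2 <= n.+2 - 0 - 1)%N; last by lia.
apply: H => [f /sP[->|/chord_bounds]|f g /sP[->|hf] /sP[->|hg]]; [lia|lia| | | |].
- by rewrite /crossd; lia.
- exact: h.
- exact: nce.
- exact: chord_nc.
Qed.

(** The apex is the last vertex before q joined to p; the remaining side belongs to
    the triangulation by maximality. *)
Lemma apex_in p q : chord D (p, q) -> exists m, [/\ (p < m < q)%N, edge D (p, m) & edge D (m, q)].
Proof.
move=> hpq; have /= bpq := chord_bounds hpq.
pose P t := (t == p.+1) || (chord D (p, t) && (t < q)%N).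
have exP : exists t, P t by exists p.+1; rewrite /P eqxx.
have ubP t : P t -> (t <= q)%N by rewrite /P => /orP[/eqP->|/andP[_ /ltnW]] //; lia.
have [m Pm maxm] := ex_maxnP exP ubP.
have pm : edge D (p, m).
  by case/orP: Pm => [/eqP->|/andP[h _]]; rewrite /edge /= ?eqxx ?h ?orbT //; lia.
have mq : (p < m < q)%N.
  case/orP: (Pm) => [/eqP->|/andP[/chord_bounds /= h mq]]; lia.
exists m; split=> //; rewrite /edge /=; have [//|hm] := boolP ((q == m.+1) && (q <= n.+2))%N.
apply: chord_max => /=; [lia|lia|move=> [i j] hij].
have n1 := chord_nc hpq hij; have n2 := edge_nc pm (chord_edge hij).
have /= b := chord_bounds hij; rewrite /crossd /= in n1 n2 *.
have := maxm j; rewrite /P; case: (eqVneq i p) => [<-|ip]; first by rewrite hij; lia.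
lia.
Qed.

(** The triangle behind a diagonal is the inner triangle of the shortest chord
    above it. *)
Lemma apex_out i : exists r,
  [/\ ((D i).2 < r)%N, edge D ((D i).1, r) & edge D ((D i).2, r)] \/
  [/\ (r < (D i).1)%N, edge D (r, (D i).1) & edge D (r, (D i).2)].
Proof.
have [inj hd nc] := tD; have := hd i; case eD : (D i) => [p q]; rewrite /isdiag /= => hpq.
have cpq : chord D (p, q) by rewrite -eD D_chord.
pose P l := exists e, [/\ chord D e, (e.1 <= p)%N, (q <= e.2)%N, e <> (p, q) & l = (e.2 - e.1)%N].
have [|l [[u v] [/= huv up qv ne ->]] minl] := @ex_min P.
  exists n.+2, (0%N, n.+2); split=> //; [by rewrite /chord eqxx|by rewrite /=; lia|].
  by move=> [e1 e2]; move: hpq; rewrite -e1 -e2; lia.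
have {}ne : (u, v) != (p, q) by apply/eqP.
have [m [um um1 um2]] := apex_in huv.
have n1 := edge_nc um1 (chord_edge cpq); have n2 := edge_nc um2 (chord_edge cpq).
rewrite /crossd /= xpair_eqE in n1 n2 ne.
have {}minl u' v' : edge D (u', v') -> (v' - u' < v - u)%N -> (u' <= p)%N -> (q <= v')%N -> (u', v') = (p, q).
  move=> /orP[/=|h] lt up' qv'; first by lia.
  apply/eqP; apply: contraT => ne'; case: (minl (v' - u')%N lt).
  by exists (u', v'); split=> //; apply/eqP.
have [mp|qm] : (m <= p)%N \/ (q <= m)%N by lia.
  have [e1 e2] := minl m v um2 ltac:(lia) mp qv.
  by subst m v; exists u; right; split=> //; [lia | exact: chord_edge].
have [e1 e2] := minl u m um1 ltac:(lia) up qm.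
by subst u m; exists v; left; split=> //; [lia | exact: chord_edge].
Qed.

Definition quad a b c d := [/\ (a < b < c)%N, (c < d <= n.+2)%N, edge D (a, b) /\ edge D (b, c) &
  edge D (c, d) /\ edge D (a, d)].

Lemma quad_ex i : exists a b c d, quad a b c d /\ (D i = (a, c) \/ D i = (b, d)).
Proof.
have [_ hd _] := tD; have := apex_in (p := (D i).1) (q := (D i).2).
have := apex_out i; have := D_chord i; case: (D i) => p q /= cpq [r hr] /(_ cpq)[m [pm m1 m2]].
case: hr => [[qr r1 r2]|[rp r1 r2]].
  exists p, m, q, r; split; last by left.
  by split=> //; have := edge_bounds r1; rewrite /=; lia.
exists r, p, m, q; split; last by right.
by split=> //; [lia | have := edge_bounds m2; rewrite /=; lia].
Qed.

End Fixed.

Definition flip D (i : 'I_n) e := fun j => if j == i then e else D j.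

(** The chords and sides other than the i-th diagonal *)
Definition edge0 D (i : 'I_n) e :=
  [&& e.2 == e.1.+1 & (e.2 <= n.+2)%N] || (e == (0%N, n.+2)) || [exists j, (j != i) && (D j == e)].

Lemma edge_edge0 D i e : edge D e = edge0 D i e || (e == D i).
Proof.
rewrite /edge /edge0 /chord -!orbA; congr (_ || (_ || _)).
apply/existsP/orP => [[j /eqP<-]|[/existsP[j /andP[_ h]]|/eqP->]].
- by have [->|ji] := eqVneq j i; [right | left; apply/existsP; exists j; rewrite ji eqxx].
- by exists j.
- by exists i.
Qed.

Lemma edge0_flip D i e : edge0 (flip D i e) i =1 edge0 D i.
Proof.
move=> f; rewrite /edge0; congr (_ || _); apply: eq_existsb => j.
by rewrite /flip; case: eqP.
Qed.

Lemma edge0_edge D i e : edge0 D i e -> edge D e.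
Proof. by rewrite (edge_edge0 _ i) => ->. Qed.

Lemma edge0_nc D i e f : triangulation D -> edge0 D i e -> edge0 D i f -> ~~ crossd e f.
Proof. by move=> tD /edge0_edge he /edge0_edge hf; apply: (edge_nc tD). Qed.

Lemma flipE D i e : flip D i e i = e. Proof. by rewrite /flip eqxx. Qed.
Lemma flip_neq D i e j : j != i -> flip D i e j = D j.
Proof. by rewrite /flip => /negbTE ->. Qed.

(** Quadrilaterals of D around its i-th diagonal only involve other edges. *)
Definition quad0 D i a b c d := [/\ (a < b < c)%N, (c < d <= n.+2)%N, edge0 D i (a, b) /\ edge0 D i (b, c) &
  edge0 D i (c, d) /\ edge0 D i (a, d)].

Lemma quad_quad0 D i a b c d : quad D a b c d -> D i = (a, c) \/ D i = (b, d) -> quad0 D i a b c d.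
Proof.
move=> [h1 h2 []]; rewrite !(edge_edge0 D i) => h3 h4 [h5 h6] e; split=> //; split.
- by case/orP: h3 => // /eqP h; exfalso; rewrite -h in e; case: e => -[]; lia.
- by case/orP: h4 => // /eqP h; exfalso; rewrite -h in e; case: e => -[]; lia.
- by case/orP: h5 => // /eqP h; exfalso; rewrite -h in e; case: e => -[]; lia.
- by case/orP: h6 => // /eqP h; exfalso; rewrite -h in e; case: e => -[]; lia.
Qed.

Lemma quad0_flip D i e a b c d : quad0 D i a b c d -> quad0 (flip D i e) i a b c d.
Proof. by move=> [h1 h2 h3 h4]; split; rewrite ?edge0_flip. Qed.

Lemma quad0_quad D i a b c d : quad0 D i a b c d -> quad D a b c d.
Proof. by move=> [h1 h2 [h3 h4] [h5 h6]]; split=> //; split; apply: edge0_edge; eassumption. Qed.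

Lemma flip_tri D i a b c d e : triangulation D -> quad0 D i a b c d ->
  (D i = (a, c) /\ e = (b, d)) \/ (D i = (b, d) /\ e = (a, c)) -> triangulation (flip D i e).
Proof.
move=> tD [h1 h2 [h3 h4] [h5 h6]] he; have [inj hd nc] := tD.
have hde : isdiag n e.
  by have := hd i; case: he => -[-> ->]; rewrite /isdiag /=; lia.
have nce j : j != i -> ~~ crossd e (D j).
  move=> ji; have hj : edge0 D i (D j).
    by rewrite /edge0; apply/orP; right; apply/existsP; exists j; rewrite ji eqxx.
  have := edge0_nc tD h3 hj; have := edge0_nc tD h4 hj; have := edge0_nc tD h5 hj; have := edge0_nc tD h6 hj.
  have ne : D j != D i by apply: contra ji => /eqP/inj->.
  have := hd j; rewrite /isdiag.
  case: he => -[e1 ->]; move: ne; rewrite e1; case: (D j) => u v; rewrite xpair_eqE /crossd /=; lia.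
have nce' j : j != i -> D j != e.
  move=> ji; apply/eqP => ej; have := nc j i; rewrite ej.
  by case: he => -[-> ->]; rewrite /crossd /=; lia.
split.
- move=> j l; rewrite /flip; case: (eqVneq j i) => ji; case: (eqVneq l i) => li.
  + by rewrite ji li.
  + by move=> el; have := nce' l li; rewrite -el eqxx.
  + by move=> el; have := nce' j ji; rewrite el eqxx.
  + exact: inj.
- by move=> j; rewrite /flip; case: eqP.
- move=> j l; rewrite /flip; case: (eqVneq j i) => ji; case: (eqVneq l i) => li.
  + by rewrite /crossd; lia.
  + exact: nce.
  + by have := nce j ji; rewrite /crossd; lia.
  + exact: nc.
Qed.

End Triangulations.

(** * The quiver of a triangulation and its mutations *)

Section Arrows.
Variable n : nat.
Implicit Types (e f : nat * nat) (D : 'I_n -> nat * nat).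

(** Arrows qr -> pr -> pq -> qr in every triangle p < q < r *)
Definition arr (E : nat * nat -> bool) e f :=
  [|| [&& e.2 == f.2, (f.1 < e.1)%N & E (f.1, e.1)],
      [&& e.1 == f.1, (f.2 < e.2)%N & E (f.2, e.2)] |
      (e.2 == f.1) && E (e.1, f.2)].

Lemma arr_2cycle E E' e f : (e.1 < e.2)%N -> (f.1 < f.2)%N -> ~~ (arr E e f && arr E' f e).
Proof.
move=> he hf; rewrite /arr.
move: (E _) (E _) (E _) (E' _) (E' _) (E' _) => t1 t2 t3 t4 t5 t6; lia.
Qed.

Lemma arr_irr E e : (e.1 < e.2)%N -> arr E e e = false.
Proof. by move=> he; rewrite /arr !ltnn !andbF /= [_ == _]gtn_eqF. Qed.

Section Quad.
Variables (D : 'I_n -> nat * nat) (i : 'I_n) (a b c d : nat).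
Hypotheses (tD : triangulation D) (qD : quad0 D i a b c d).

Lemma edge0_ac : (D i = (a, c) \/ D i = (b, d)) -> edge0 D i (a, c) = false /\ edge0 D i (b, d) = false.
Proof.
have [h1 h2 [h3 h4] [h5 h6]] := qD; have [inj hd nc] := tD.
have ex e : edge0 D i e -> (e.1.+1 < e.2)%N -> e <> (0%N, n.+2) -> exists2 j, j != i & D j = e.
  rewrite /edge0 => /orP[/orP[/andP[/eqP-> _]|/eqP-> //]|/existsP[j /andP[ji /eqP]]]; first by lia.
  by exists j.
have nf e : (e = (a, c) \/ e = (b, d)) -> (D i = (a, c) \/ D i = (b, d)) -> edge0 D i e = false.
  move=> he hi; apply/negP => /ex[||j ji ej].
  - by case: he => ->; rewrite /=; lia.
  - by case: he => -> [e1 e2]; lia.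
  have : D i != e by rewrite -ej; apply: contra ji => /eqP/inj->.
  have := nc i j; rewrite ej.
  by case: he hi => -> [] ->; rewrite ?eqxx // /crossd /= => + _; lia.
by move=> h; rewrite !nf //; [right|left].
Qed.

(** A triangle over the diagonal (a,c) or (b,d) has its apex in the quadrilateral;
    the six cases are the positions of the third side of a triangle with sides e
    and f. *)
Lemma apex_uniq e f : edge0 D i e -> edge0 D i f ->
  [/\ e.2 == f.2 -> f.1 = a -> e.1 = c -> e.2 = d,
      e.1 == f.1 -> f.2 = a -> e.2 = c -> False,
      e.2 == f.1 -> e.1 = a -> f.2 = c -> e.2 = b,
      e.2 == f.2 -> f.1 = b -> e.1 = d -> False &
      [/\ e.1 == f.1 -> f.2 = b -> e.2 = d -> e.1 = a &
      e.2 == f.1 -> e.1 = b -> f.2 = d -> e.2 = c]].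
Proof.
have [h1 h2 [h3 h4] [h5 h6]] := qD => he hf.
have /= := edge_bounds tD (edge0_edge he); have /= := edge_bounds tD (edge0_edge hf).
have N g g' : edge0 D i g -> edge0 D i g' -> ~~ crossd g g' by apply: edge0_nc.
case: e f he hf => e1 e2 [f1 f2] /= he hf bf be; split; [..|split]; move=> /eqP E1 E2 E3; subst.
- have := N _ _ hf h5; have := N _ _ he h6; rewrite /crossd /=; clear -h1 h2 bf be; lia.
- have := N _ _ he h6; rewrite /crossd /=; clear -h1 h2 bf be; lia.
- have := N _ _ hf h3; have := N _ _ he h4; rewrite /crossd /=; clear -h1 h2 bf be; lia.
- have := N _ _ hf h6; rewrite /crossd /=; clear -h1 h2 bf be; lia.
- have := N _ _ hf h6; have := N _ _ he h3; rewrite /crossd /=; clear -h1 h2 bf be; lia.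
- have := N _ _ hf h4; have := N _ _ he h5; rewrite /crossd /=; clear -h1 h2 bf be; lia.
Qed.

Lemma pairE (e : nat * nat) (u v : nat) : (e == (u, v)) = (e.1 == u) && (e.2 == v).
Proof. by case: e. Qed.

Lemma or3_or (t1 t2 t3 u1 u2 u3 : bool) (w1 w2 : bool) : u1 = w1 -> u2 = false -> u3 = w2 ->
  [|| t1 || u1, t2 || u2 | t3 || u3] = [|| [|| t1, t2 | t3], w2 | w1].
Proof. by move=> -> -> ->; case: t1 t2 t3 w1 w2 => [] [] [] [] []. Qed.

Lemma or3_or' (t1 t2 t3 u1 u2 u3 : bool) (w1 w2 : bool) : u1 = false -> u2 = w1 -> u3 = w2 ->
  [|| t1 || u1, t2 || u2 | t3 || u3] = [|| [|| t1, t2 | t3], w1 | w2].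
Proof. by move=> -> -> ->; case: t1 t2 t3 w1 w2 => [] [] [] [] []. Qed.

(** The arrows which come from a triangle with the i-th diagonal as third side *)
Lemma arr_ac e f : D i = (a, c) -> edge0 D i e -> edge0 D i f ->
  arr (edge D) e f = [|| arr (edge0 D i) e f, (e == (a, b)) && (f == (b, c)) | (e == (c, d)) && (f == (a, d))].
Proof.
move=> ei he hf; have [h1 h2 _ _] := qD.
have [u1 u2 u3 _ _] := apex_uniq he hf.
rewrite /arr !(edge_edge0 D i) ei !pairE /= !andb_orr; apply: or3_or.
- by apply/idP/idP => [/and4P[/eqP E1 _ /eqP E2 /eqP E3]|/andP[/andP[/eqP E1 /eqP E2] /andP[/eqP E3 /eqP E4]]];
    [have := u1 (introT eqP E1) E2 E3; lia | lia].
- by apply/negP => /and4P[E1 _ /eqP E2 /eqP E3]; case: (u2 E1 E2 E3).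
- by apply/idP/idP => [/and3P[/eqP E1 /eqP E2 /eqP E3]|/andP[/andP[/eqP E1 /eqP E2] /andP[/eqP E3 /eqP E4]]];
    [have := u3 (introT eqP E1) E2 E3; lia | lia].
Qed.

Lemma arr_bd e f : D i = (b, d) -> edge0 D i e -> edge0 D i f ->
  arr (edge D) e f = [|| arr (edge0 D i) e f, (e == (a, d)) && (f == (a, b)) | (e == (b, c)) && (f == (c, d))].
Proof.
move=> ei he hf; have [h1 h2 _ _] := qD.
have [_ _ _ u1 [u2 u3]] := apex_uniq he hf.
rewrite /arr !(edge_edge0 D i) ei !pairE /= !andb_orr; apply: or3_or'.
- by apply/negP => /and4P[E1 _ /eqP E2 /eqP E3]; case: (u1 E1 E2 E3).
- by apply/idP/idP => [/and4P[/eqP E1 _ /eqP E2 /eqP E3]|/andP[/andP[/eqP E1 /eqP E2] /andP[/eqP E3 /eqP E4]]];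
    [have := u2 (introT eqP E1) E2 E3; lia | lia].
- by apply/idP/idP => [/and3P[/eqP E1 /eqP E2 /eqP E3]|/andP[/andP[/eqP E1 /eqP E2] /andP[/eqP E3 /eqP E4]]];
    [have := u3 (introT eqP E1) E2 E3; lia | lia].
Qed.

Lemma arr_diag e : edge0 D i e ->
  (D i = (a, c) -> (arr (edge D) e (D i) = (e == (b, c)) || (e == (a, d))) /\
                   (arr (edge D) (D i) e = (e == (a, b)) || (e == (c, d)))) /\
  (D i = (b, d) -> (arr (edge D) e (D i) = (e == (a, b)) || (e == (c, d))) /\
                   (arr (edge D) (D i) e = (e == (b, c)) || (e == (a, d)))).
Proof.
move=> he; have [h1 h2 [h3 h4] [h5 h6]] := qD.
have Hb f (hf : edge D f) := edge_bounds tD hf.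
have H1 f (hf : edge D f) := edge_nc tD (edge0_edge h3) hf.
have H2 f (hf : edge D f) := edge_nc tD (edge0_edge h4) hf.
have H3 f (hf : edge D f) := edge_nc tD (edge0_edge h5) hf.
have H4 f (hf : edge D f) := edge_nc tD (edge0_edge h6) hf.
have eb := edge_bounds tD (edge0_edge he).
have n1 := H1 _ (edge0_edge he); have n2 := H2 _ (edge0_edge he).
have n3 := H3 _ (edge0_edge he); have n4 := H4 _ (edge0_edge he).
have e3 := edge0_edge h3; have e4 := edge0_edge h4; have e5 := edge0_edge h5; have e6 := edge0_edge h6.
have ne f : D i = f -> e != f.
  move=> ef; apply/negP => /eqP ee; have [inj hd nc] := tD.
  move: he; rewrite /edge0 ee -ef => /orP[/orP[|/eqP]|/existsP[j /andP[ji /eqP/inj jj]]].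
  - by have := hd i; rewrite /isdiag; clear; lia.
  - by move=> h; have := hd i; rewrite h /isdiag /=; clear; lia.
  - by rewrite jj eqxx in ji.
case: e he eb n1 n2 n3 n4 ne => u v he eb n1 n2 n3 n4 ne.
rewrite /crossd /= in n1 n2 n3 n4 eb.
split=> ei; rewrite ei; have {ne} := ne _ ei; rewrite !pairE /= => ne; split; apply/idP/idP.
- case/or3P => /=.
  + move=> /and3P[/eqP ev au hE]; have := Hb _ hE; have := H2 _ hE; have := ne; have := n1; clear -eb h1 h2 ev au; rewrite ?/crossd /=; lia.
  + move=> /and3P[/eqP ev au hE]; have := Hb _ hE; have := H4 _ hE; have := ne; have := n3; clear -eb h1 h2 ev au; rewrite ?/crossd /=; lia.
  + move=> /andP[/eqP ev hE]; have := Hb _ hE; have := H4 _ hE; have := ne; clear -eb h1 h2 ev ; rewrite ?/crossd /=; lia.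
- case/orP => /andP[/eqP-> /eqP->]; rewrite /arr /=.
  + by rewrite eqxx e3 andbT /=; apply/orP; left; clear -h1 h2; lia.
  + by rewrite eqxx e5 andbT /=; apply/orP; right; apply/orP; left; clear -h1 h2; lia.
- case/or3P => /=.
  + move=> /and3P[/eqP ev au hE]; have := Hb _ hE; have := ne; have := n4; clear -eb h1 h2 ev au; rewrite ?/crossd /=; lia.
  + move=> /and3P[/eqP ev au hE]; have := Hb _ hE; have := H1 _ hE; have := ne; have := n2; clear -eb h1 h2 ev au; rewrite ?/crossd /=; lia.
  + move=> /andP[/eqP ev hE]; have := Hb _ hE; have := H3 _ hE; have := ne; have := n4; clear -eb h1 h2 ev ; rewrite ?/crossd /=; lia.
- case/orP => /andP[/eqP-> /eqP->]; rewrite /arr /=.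
  + by rewrite eqxx e4 andbT /=; apply/orP; right; apply/orP; left; clear -h1 h2; lia.
  + by rewrite eqxx e6 /= !orbT.
- case/or3P => /=.
  + move=> /and3P[/eqP ev au hE]; have := Hb _ hE; have := H3 _ hE; have := ne; have := n2; clear -eb h1 h2 ev au; rewrite ?/crossd /=; lia.
  + move=> /and3P[/eqP ev au hE]; have := Hb _ hE; have := ne; have := n4; clear -eb h1 h2 ev au; rewrite ?/crossd /=; lia.
  + move=> /andP[/eqP ev hE]; have := Hb _ hE; have := H1 _ hE; have := ne; have := n4; clear -eb h1 h2 ev ; rewrite ?/crossd /=; lia.
- case/orP => /andP[/eqP-> /eqP->]; rewrite /arr /=.
  + by rewrite eqxx e6 /= !orbT.
  + by rewrite eqxx e4 andbT /=; apply/orP; left; clear -h1 h2; lia.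
- case/or3P => /=.
  + move=> /and3P[/eqP ev au hE]; have := Hb _ hE; have := H4 _ hE; have := ne; have := n1; clear -eb h1 h2 ev au; rewrite ?/crossd /=; lia.
  + move=> /and3P[/eqP ev au hE]; have := Hb _ hE; have := H2 _ hE; have := ne; have := n3; clear -eb h1 h2 ev au; rewrite ?/crossd /=; lia.
  + move=> /andP[/eqP ev hE]; have := Hb _ hE; have := H4 _ hE; have := ne; clear -eb h1 h2 ev ; rewrite ?/crossd /=; lia.
- case/orP => /andP[/eqP-> /eqP->]; rewrite /arr /=.
  + by rewrite eqxx e5 andbT /=; apply/orP; right; apply/orP; left; clear -h1 h2; lia.
  + by rewrite eqxx e3 andbT /=; apply/orP; left; clear -h1 h2; lia.
Qed.

End Quad.

Lemma quad_uniq D a b c d a' b' c' d' e : triangulation D -> quad D a b c d -> quad D a' b' c' d' ->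
  e = (a, c) \/ e = (b, d) -> e = (a', c') \/ e = (b', d') -> [/\ a = a', b = b', c = c' & d = d'].
Proof.
move=> tD [h1 h2 [h3 h4] [h5 h6]] [k1 k2 [k3 k4] [k5 k6]].
move=> he he'; suff : [&& a == a', b == b', c == c' & d == d'] by move=> /and4P[/eqP-> /eqP-> /eqP-> /eqP->].
case: he he' => -> [[e1 e2]|[e1 e2]]; subst.
- have := edge_nc tD h3 k4; have := edge_nc tD k3 h4; have := edge_nc tD h6 k5; have := edge_nc tD k6 h5.
  rewrite /crossd /=; clear -h1 h2 k1 k2; lia.
- by have := edge_nc tD h6 k6; rewrite /crossd /=; clear -h1 h2 k1 k2; lia.
- by have := edge_nc tD h6 k6; rewrite /crossd /=; clear -h1 h2 k1 k2; lia.
- have := edge_nc tD h4 k5; have := edge_nc tD k4 h5; have := edge_nc tD h3 k6; have := edge_nc tD k3 h6.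
  rewrite /crossd /=; clear -h1 h2 k1 k2; lia.
Qed.

End Arrows.

Section Lamination.
Variable n : nat.
Implicit Types (e f : nat * nat) (D : 'I_n -> nat * nat).

Definition outb b c d P R := (b <= P < c)%N && (d <= R)%N.
Definition inb a b c d P R := (a <= P < b)%N && (c <= R < d)%N.

(** The arrows between a diagonal and a frozen vertex are read off from the
    quadrilateral of the diagonal: the frozen vertex is an arc which starts
    between the vertices P and P+1 and ends between the vertices R and R+1 of the
    polygon, and the arrows are its signed crossings with opposite sides of the
    quadrilateral (shear coordinates). *)
Definition shear D i P R (o w : nat) := exists a b c d, quad D a b c d /\
  (D i = (a, c) /\ (o = outb b c d P R /\ w = inb a b c d P R) \/
   D i = (b, d) /\ (o = inb a b c d P R /\ w = outb b c d P R)).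

Lemma shear_ac D i P R o w a b c d : triangulation D -> quad D a b c d -> D i = (a, c) ->
  shear D i P R o w -> o = outb b c d P R /\ w = inb a b c d P R.
Proof.
move=> tD q1 ei [a' [b' [c' [d' [q2 h]]]]].
have [||e1 e2 e3 e4] := quad_uniq (e := D i) tD q1 q2; first by left.
  by case: h => [[-> _]|[-> _]]; [left|right].
subst; case: h => [[_ //]|[e1 _]]; have [h1 h2 _ _] := q1; move: e1; rewrite ei => -[]; lia.
Qed.

Lemma shear_bd D i P R o w a b c d : triangulation D -> quad D a b c d -> D i = (b, d) ->
  shear D i P R o w -> o = inb a b c d P R /\ w = outb b c d P R.
Proof.
move=> tD q1 ei [a' [b' [c' [d' [q2 h]]]]].
have [||e1 e2 e3 e4] := quad_uniq (e := D i) tD q1 q2; first by right.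
  by case: h => [[-> _]|[-> _]]; [left|right].
subst; case: h => [[e1 _]|[_ //]]; have [h1 h2 _ _] := q1; move: e1; rewrite ei => -[]; lia.
Qed.

Lemma quad_arr D a b c d e f : quad D a b c d -> e = (a, c) \/ e = (b, d) ->
  edge D e -> f \in [:: (a, b); (b, c); (c, d); (a, d)] -> arr (edge D) e f || arr (edge D) f e.
Proof.
move=> [h1 h2 [h3 h4] [h5 h6]] he hE; rewrite !inE.
case: he hE => -> hE /or4P[] /eqP->; rewrite /arr /= ?h3 ?h4 ?h5 ?h6 ?eqxx ?andbT /=; clear -h1 h2; lia.
Qed.

Lemma D_edge0 D i j : j != i -> edge0 D i (D j).
Proof. by move=> ji; rewrite /edge0; apply/orP; right; apply/existsP; exists j; rewrite ji eqxx. Qed.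

Section Fixed.
Variables (D : 'I_n -> nat * nat) (r : 'I_n) (a b c d : nat).
Hypotheses (tD : triangulation D) (qD : quad0 D r a b c d) (hr : D r = (a, c) \/ D r = (b, d)).

(** A side of the quadrilateral which is itself a diagonal bounds a second triangle
    outside of the quadrilateral. *)
Lemma inner_apex i : i != r -> D i \in [:: (a, b); (b, c); (c, d)] ->
  exists x, [/\ ((D i).1 < x < (D i).2)%N, edge0 D r ((D i).1, x) & edge0 D r (x, (D i).2)].
Proof.
move=> ir hi; have [h1 h2 _ _] := qD.
have := D_chord D i; have := apex_in (p := (D i).1) (q := (D i).2) tD.
rewrite -surjective_pairing => /[apply] -[x [hx e1 e2]]; exists x.
move: hi e1 e2 hx; rewrite !inE !(edge_edge0 D r).
case: (D i) hr => u v [] -> /or3P[] /eqP[-> ->]; rewrite !xpair_eqE /= => e1 e2 hx; split=> //.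
all: first [by case/orP: e1 => //; clear -h1 h2 hx; lia|by case/orP: e2 => //; clear -h1 h2 hx; lia].
Qed.

Lemma outer_apex i : i != r -> D i = (a, d) -> exists x,
  (d < x)%N /\ edge0 D r (a, x) /\ edge0 D r (d, x) \/
  (x < a)%N /\ edge0 D r (x, a) /\ edge0 D r (x, d).
Proof.
move=> ir ei; have [h1 h2 _ _] := qD.
have [x hx] := apex_out tD i; exists x; rewrite ei /= !(edge_edge0 D r) in hx.
have nx u v : (u, v) = (a, x) \/ (u, v) = (d, x) \/ (u, v) = (x, a) \/ (u, v) = (x, d) -> (d < x)%N || (x < a)%N ->
   (u, v) == D r -> False.
  by case: hr => -> hu hl /eqP[e1 e2]; subst; case: hu => [|[|[]]] []; clear -h1 h2 hl; lia.
case: hx => -[hl /orP e1 /orP e2]; [left|right]; split=> //; split.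
- by case: e1 => // /nx[]; [left|rewrite hl].
- by case: e2 => // /nx[]; [right; left|rewrite hl].
- by case: e1 => // /nx[]; [right; right; left|rewrite hl orbT].
- by case: e2 => // /nx[]; [right; right; right|rewrite hl orbT].
Qed.

End Fixed.

(** The mutation rule for the arrows between two edges e and f: the Booleans e1,
    ..., e4 tell whether e is the side ab, bc, cd or ad of the quadrilateral, A and
    A' are the arrows from e to f and back that are not due to the diagonal. *)
Lemma mut_bool (A A' e1 e2 e3 e4 f1 f2 f3 f4 : bool) : ~~ (A && A') ->
  (e1 + e2 + e3 + e4 <= 1)%N -> (f1 + f2 + f3 + f4 <= 1)%N ->
  ([|| e1, e2, e3 | e4] -> [|| f1, f2, f3 | f4] -> A || A' = false) ->
  ([|| A, e1 && f2 | e3 && f4] + ((e2 || e4) : nat) * ((f1 || f3) : nat) -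
   ([|| A', f1 && e2 | f3 && e4] + ((f2 || f4) : nat) * ((e1 || e3) : nat)))%N =
  [|| A, e4 && f1 | e2 && f3].
Proof.
by case: A A' e1 e2 e3 e4 f1 f2 f3 f4 => [] [] [] [] [] [] [] [] [] [] //= _ _ _ /(_ isT isT).
Qed.

Lemma mut_bool' (A A' e1 e2 e3 e4 f1 f2 f3 f4 : bool) : ~~ (A && A') ->
  (e1 + e2 + e3 + e4 <= 1)%N -> (f1 + f2 + f3 + f4 <= 1)%N ->
  ([|| e1, e2, e3 | e4] -> [|| f1, f2, f3 | f4] -> A || A' = false) ->
  ([|| A, e4 && f1 | e2 && f3] + ((e1 || e3) : nat) * ((f2 || f4) : nat) -
   ([|| A', f4 && e1 | f2 && e3] + ((f1 || f3) : nat) * ((e2 || e4) : nat)))%N =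
  [|| A, e1 && f2 | e3 && f4].
Proof.
by case: A A' e1 e2 e3 e4 f1 f2 f3 f4 => [] [] [] [] [] [] [] [] [] [] //= _ _ _ /(_ isT isT).
Qed.

(** With indices counted from 0, y_i is the arc from the side (i,i+1) to the side
    (n+1,n+2), and z_i the arc from the side (i+1,i+2) to the side (0,n+2). *)
Definition lamP (v : nat) := if (v < n + n)%N then (v - n)%N else (v - (n + n)).+1.
Definition lamR (v : nat) := if (v < n + n)%N then n.+1 else n.+2.

Definition sees (Q : quiver (n + n + n)) D := [/\ triangulation D,
  forall i j, Q (xvertex i) (xvertex j) = arr (edge D) (D i) (D j) &
  forall i (v : 'I_(n + n + n)), (n <= v)%N ->
    shear D i (lamP v) (lamR v) (Q (xvertex i) v) (Q v (xvertex i))].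

Lemma xvertex_inj : injective (@xvertex n).
Proof. by move=> i j /lshift_inj/lshift_inj. Qed.

Lemma frozen_x i : frozen n (xvertex i : 'I_(n + n + n)) = false.
Proof. by rewrite /frozen /= leqNgt ltn_ord. Qed.

Lemma side_excl (e : nat * nat) a b c d : (a < b < c)%N -> (c < d)%N ->
  ((e == (a, b)) + (e == (b, c)) + (e == (c, d)) + (e == (a, d)) <= 1)%N.
Proof. by case: e => u v; rewrite !xpair_eqE /=; lia. Qed.

Lemma arr0_sides D r a b c d e f : triangulation D -> quad0 D r a b c d -> D r = (a, c) \/ D r = (b, d) ->
  [|| e == (a, b), e == (b, c), e == (c, d) | e == (a, d)] ->
  [|| f == (a, b), f == (b, c), f == (c, d) | f == (a, d)] ->
  arr (edge0 D r) e f || arr (edge0 D r) f e = false.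
Proof.
move=> tD q hr; have [h1 h2 _ _] := q; have [n1 n2] := edge0_ac tD q hr.
by move=> /or4P[] /eqP-> /or4P[] /eqP->; rewrite /arr /= ?n1 ?n2 ?andbF ?orbF; clear -h1 h2; lia.
Qed.

Section Mutation.
Variables (Q : quiver (n + n + n)) (D : 'I_n -> nat * nat) (r : 'I_n) (a b c d : nat) (e : nat * nat).
Hypotheses (sQ : sees Q D) (qD : quad0 D r a b c d)
  (he : (D r = (a, c) /\ e = (b, d)) \/ (D r = (b, d) /\ e = (a, c))).

Let tD : triangulation D. Proof. by case: sQ. Qed.
Let tD' : triangulation (flip D r e). Proof. exact: flip_tri qD he. Qed.
Let qD' : quad0 (flip D r e) r a b c d. Proof. exact: quad0_flip. Qed.

Lemma sees_flip_mutable i j :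
  quiver_mut n (xvertex r) Q (xvertex i) (xvertex j) = arr (edge (flip D r e)) (flip D r e i) (flip D r e j).
Proof.
have [_ hQ _] := sQ; rewrite /quiver_mut !(inj_eq xvertex_inj) !frozen_x /= !hQ.
have irr D1 l : triangulation D1 -> arr (edge D1) (D1 l) (D1 l) = false.
  by move=> t1; rewrite arr_irr //; have := edge_bounds t1 (chord_edge (D_chord D1 l)); lia.
have [->|ir] := eqVneq i r.
  rewrite /=; have [->|jr] := eqVneq j r; first by rewrite !irr.
  have e1 := D_edge0 D jr; have := D_edge0 (flip D r e) jr; rewrite flip_neq // => e2.
  have := arr_diag tD qD e1; have := arr_diag tD' qD' e2; rewrite flipE.
  by case: he => -[-> ->] [p1 p2] [p3 p4]; [have [_ ->] := p2 erefl; have [-> _] := p3 erefl |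
     have [_ ->] := p1 erefl; have [-> _] := p4 erefl].
have [->|jr] := eqVneq j r.
  rewrite /=.
  have e1 := D_edge0 D ir; have := D_edge0 (flip D r e) ir; rewrite flip_neq // => e2.
  have := arr_diag tD qD e1; have := arr_diag tD' qD' e2; rewrite flipE.
  by case: he => -[-> ->] [p1 p2] [p3 p4]; [have [-> _] := p2 erefl; have [_ ->] := p3 erefl |
     have [-> _] := p1 erefl; have [_ ->] := p4 erefl].
rewrite /= !flip_neq //.
have ei := D_edge0 D ir; have ej := D_edge0 D jr.
have [h1 /andP[h2 _] _ _] := qD.
have ei' : edge0 (flip D r e) r (D i) by rewrite edge0_flip.
have ej' : edge0 (flip D r e) r (D j) by rewrite edge0_flip.
have A0 u v : arr (edge0 (flip D r e) r) u v = arr (edge0 D r) u v by rewrite /arr !edge0_flip.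
have c2 : ~~ (arr (edge0 D r) (D i) (D j) && arr (edge0 D r) (D j) (D i)).
  by apply: arr_2cycle; [have := edge_bounds tD (edge0_edge ei) | have := edge_bounds tD (edge0_edge ej)]; lia.
have [di1 di2] := arr_diag tD qD ei; have [dj1 dj2] := arr_diag tD qD ej.
have xi := side_excl (D i) h1 h2; have xj := side_excl (D j) h1 h2.
case: he => -[er ee].
- rewrite (arr_ac tD qD er ei ej) (arr_ac tD qD er ej ei) (arr_bd tD' qD' _ ei' ej') ?flipE // A0.
  have [-> ->] := di1 er; have [-> ->] := dj1 er.
  apply: mut_bool => // si sj; apply: (arr0_sides tD qD) => //; by left.
- rewrite (arr_bd tD qD er ei ej) (arr_bd tD qD er ej ei) (arr_ac tD' qD' _ ei' ej') ?flipE // A0.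
  have [-> ->] := di2 er; have [-> ->] := dj2 er.
  apply: mut_bool' => // si sj; apply: (arr0_sides tD qD) => //; by right.
Qed.

(** Only the diagonal itself and the sides of its quadrilateral change their
    quadrilaterals.  For a side, the two quadrilaterals consist of its outer
    triangle and of one triangle of the flipped quadrilateral. *)
Lemma sees_flip_frozen i (v : 'I_(n + n + n)) : (n <= v)%N ->
  shear (flip D r e) i (lamP v) (lamR v) (quiver_mut n (xvertex r) Q (xvertex i) v)
    (quiver_mut n (xvertex r) Q v (xvertex i)).
Proof.
move=> hv; have [_ hQ hF] := sQ; have Fr := hF r v hv; have Fi := hF i v hv.
have vr : (v == xvertex r) = false by apply/eqP => ev; move: hv; rewrite ev /= leqNgt ltn_ord.
have [R1 R2] : (n.+1 <= lamR v)%N /\ (lamP v <= n)%N.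
  by rewrite /lamR /lamP; have := ltn_ord v; clear -hv; case: ifP; lia.
have qq := quad0_quad qD; have qq' := quad0_quad qD'.
rewrite /quiver_mut !(inj_eq xvertex_inj) vr !frozen_x andbF /= ?orbF.
move: (lamP v) (lamR v) R1 R2 Fr Fi => P R R1 R2 Fr Fi.
have [ir|ir] := eqVneq i r.
  subst i; exists a, b, c, d; split=> //=; rewrite flipE.
  case: he => -[er ee]; [right|left]; split=> //.
    by have [-> ->] := shear_ac tD qq er Fr.
  by have [-> ->] := shear_bd tD qq er Fr.
have hr : D r = (a, c) \/ D r = (b, d) by case: he => -[->]; [left|right].
rewrite /=.
have ei := D_edge0 D ir.
have [si|si] := boolP (D i \in [:: (a, b); (b, c); (c, d); (a, d)]); last first.
  have [di1 di2] := arr_diag tD qD ei.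
  have [z1 z2] : Q (xvertex i) (xvertex r) = 0%N /\ Q (xvertex r) (xvertex i) = 0%N.
    move: si; rewrite !hQ !inE !negb_or => /and4P[/negbTE s1 /negbTE s2 /negbTE s3 /negbTE s4].
    case: hr => er; [have [-> ->] := di1 er|have [-> ->] := di2 er]; by rewrite s1 s2 s3 s4.
  have {Fi}[a' [b' [c' [d' [q' h]]]]] := Fi.
  have hi : D i = (a', c') \/ D i = (b', d') by case: h => -[->]; [left|right].
  have nr : D r \notin [:: (a', b'); (b', c'); (c', d'); (a', d')].
    apply/negP => /(quad_arr q' hi (chord_edge (D_chord D i))).
    by move: z1 z2; rewrite !hQ; case: (arr _ _ _); case: (arr _ _ _).
  exists a', b', c', d'; split.
    have [k1 k2 [k3 k4] [k5 k6]] := q'; move: nr; rewrite !inE !negb_or => /and4P[n1 n2 n3 n4].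
    rewrite !(edge_edge0 D r) in k3 k4 k5 k6.
    rewrite /quad !(edge_edge0 (flip D r e) r) !edge0_flip.
    rewrite [(_, _) == _]eq_sym (negbTE n1) orbF in k3; rewrite [(_, _) == _]eq_sym (negbTE n2) orbF in k4.
    rewrite [(_, _) == _]eq_sym (negbTE n3) orbF in k5; rewrite [(_, _) == _]eq_sym (negbTE n4) orbF in k6.
    by rewrite k3 k4 k5 k6.
  rewrite flip_neq // z1 z2 !mul0n !muln0 !addn0.
  have [k1 k2 _ _] := q'.
  by case: h => -[ei' [-> ->]]; [left|right]; split=> //; split; rewrite /outb /inb; clear -k1 k2; lia.
have [h1 h2 [g1 g2] [g3 g4]] := qD.
(* one of Da and Db is D; the first contains (a,c) and the second (b,d) *)
pose Da := if D r == (a, c) then D else flip D r e.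
pose Db := if D r == (a, c) then flip D r e else D.
have ne : (b, d) <> (a, c) by case=> e1 _; clear -h1 e1; lia.
have [ta tb] : triangulation Da /\ triangulation Db by rewrite /Da /Db; case: eqP.
have Ea u w : edge Da (u, w) = edge0 D r (u, w) || ((u, w) == (a, c)).
  rewrite /Da (edge_edge0 _ r); case: he => -[er ee]; rewrite er ?eqxx ?er // (introF eqP ne).
  by rewrite edge0_flip flipE ee.
have Eb u w : edge Db (u, w) = edge0 D r (u, w) || ((u, w) == (b, d)).
  rewrite /Db (edge_edge0 _ r); case: he => -[er ee]; rewrite er ?eqxx ?(introF eqP ne) ?er //.
  by rewrite edge0_flip flipE ee.
have [Dai Dbi] : Da i = D i /\ Db i = D i by rewrite /Da /Db; case: eqP; rewrite flip_neq.
have qA u1 u2 u3 u4 : (u1 < u2 < u3)%N -> (u3 < u4 <= n.+2)%N ->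
  edge0 D r (u1, u2) || ((u1, u2) == (a, c)) -> edge0 D r (u2, u3) || ((u2, u3) == (a, c)) ->
  edge0 D r (u3, u4) || ((u3, u4) == (a, c)) -> edge0 D r (u1, u4) || ((u1, u4) == (a, c)) -> quad Da u1 u2 u3 u4.
  by move=> *; split; rewrite ?Ea.
have qB u1 u2 u3 u4 : (u1 < u2 < u3)%N -> (u3 < u4 <= n.+2)%N ->
  edge0 D r (u1, u2) || ((u1, u2) == (b, d)) -> edge0 D r (u2, u3) || ((u2, u3) == (b, d)) ->
  edge0 D r (u3, u4) || ((u3, u4) == (b, d)) -> edge0 D r (u1, u4) || ((u1, u4) == (b, d)) -> quad Db u1 u2 u3 u4.
  by move=> *; split; rewrite ?Eb.
(* it suffices to compare the quadrilaterals of a side in the two triangulations *)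
suff [sa sb] : (forall o w, shear Da i P R o w ->
   shear Db i P R ((o + ((D i == (b, c)) || (D i == (a, d)) : nat) * outb b c d P R) -
                   (w + inb a b c d P R * ((D i == (a, b)) || (D i == (c, d)) : nat)))
                  ((w + inb a b c d P R * ((D i == (a, b)) || (D i == (c, d)) : nat)) -
                   (o + ((D i == (b, c)) || (D i == (a, d)) : nat) * outb b c d P R))) /\
  (forall o w, shear Db i P R o w ->
   shear Da i P R ((o + ((D i == (a, b)) || (D i == (c, d)) : nat) * inb a b c d P R) -
                   (w + outb b c d P R * ((D i == (b, c)) || (D i == (a, d)) : nat)))
                  ((w + outb b c d P R * ((D i == (b, c)) || (D i == (a, d)) : nat)) -
                   (o + ((D i == (a, b)) || (D i == (c, d)) : nat) * inb a b c d P R))).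
  have [di1 di2] := arr_diag tD qD ei; rewrite !hQ.
  case: he => -[er ee].
    have [-> ->] := di1 er; have [-> ->] := shear_ac tD qq er Fr.
    by move: sa; rewrite /Da /Db er eqxx => /(_ _ _ Fi).
  have [-> ->] := di2 er; have [-> ->] := shear_bd tD qq er Fr.
  by move: sb; rewrite /Da /Db er (introF eqP ne) => /(_ _ _ Fi).
move: si; rewrite !inE => /or4P[] /eqP si.
- have [|x [hx E1 E2]] := inner_apex tD qD hr ir; first by rewrite si !inE eqxx ?orbT.
  rewrite si /= in hx E1 E2; have ha := hx.
  have [I1 I2 I3 I4] : [/\ (D i == (a, b)) = true, (D i == (b, c)) = false, (D i == (c, d)) = false & (D i == (a, d)) = false].
    by rewrite si !xpair_eqE; clear -h1 h2; split; lia.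
  have q1 : quad Da a x b c.
    by apply: qA; rewrite ?E1 ?E2 ?g1 ?g2 ?g3 ?g4 ?eqxx ?orbT //; clear -h1 h2 hx ha; lia.
  have q2 : quad Db a x b d.
    by apply: qB; rewrite ?E1 ?E2 ?g1 ?g2 ?g3 ?g4 ?eqxx ?orbT //; clear -h1 h2 hx ha; lia.
  split=> o w.
    move=> /(shear_ac ta q1 (etrans Dai si))[-> ->].
    exists a, x, b, d; split=> //; left; split; first by rewrite Dbi.
    by rewrite I1 I2 I3 I4 !(mul0n, mul1n, muln0, muln1, addn0) /outb /inb; split; clear -h1 h2 hx R1 R2; lia.
  move=> /(shear_ac tb q2 (etrans Dbi si))[-> ->].
  exists a, x, b, c; split=> //; left; split; first by rewrite Dai.
  by rewrite I1 I2 I3 I4 !(mul0n, mul1n, muln0, muln1, addn0) /outb /inb; split; clear -h1 h2 hx R1 R2; lia.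
- have [|x [hx E1 E2]] := inner_apex tD qD hr ir; first by rewrite si !inE eqxx ?orbT.
  rewrite si /= in hx E1 E2; have ha := hx.
  have [I1 I2 I3 I4] : [/\ (D i == (a, b)) = false, (D i == (b, c)) = true, (D i == (c, d)) = false & (D i == (a, d)) = false].
    by rewrite si !xpair_eqE; clear -h1 h2; split; lia.
  have q1 : quad Da a b x c.
    by apply: qA; rewrite ?E1 ?E2 ?g1 ?g2 ?g3 ?g4 ?eqxx ?orbT //; clear -h1 h2 hx ha; lia.
  have q2 : quad Db b x c d.
    by apply: qB; rewrite ?E1 ?E2 ?g1 ?g2 ?g3 ?g4 ?eqxx ?orbT //; clear -h1 h2 hx ha; lia.
  split=> o w.
    move=> /(shear_bd ta q1 (etrans Dai si))[-> ->].
    exists b, x, c, d; split=> //; left; split; first by rewrite Dbi.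
    by rewrite I1 I2 I3 I4 !(mul0n, mul1n, muln0, muln1, addn0) /outb /inb; split; clear -h1 h2 hx R1 R2; lia.
  move=> /(shear_ac tb q2 (etrans Dbi si))[-> ->].
  exists a, b, x, c; split=> //; right; split; first by rewrite Dai.
  by rewrite I1 I2 I3 I4 !(mul0n, mul1n, muln0, muln1, addn0) /outb /inb; split; clear -h1 h2 hx R1 R2; lia.
- have [|x [hx E1 E2]] := inner_apex tD qD hr ir; first by rewrite si !inE eqxx ?orbT.
  rewrite si /= in hx E1 E2; have ha := hx.
  have [I1 I2 I3 I4] : [/\ (D i == (a, b)) = false, (D i == (b, c)) = false, (D i == (c, d)) = true & (D i == (a, d)) = false].
    by rewrite si !xpair_eqE; clear -h1 h2; split; lia.
  have q1 : quad Da a c x d.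
    by apply: qA; rewrite ?E1 ?E2 ?g1 ?g2 ?g3 ?g4 ?eqxx ?orbT //; clear -h1 h2 hx ha; lia.
  have q2 : quad Db b c x d.
    by apply: qB; rewrite ?E1 ?E2 ?g1 ?g2 ?g3 ?g4 ?eqxx ?orbT //; clear -h1 h2 hx ha; lia.
  split=> o w.
    move=> /(shear_bd ta q1 (etrans Dai si))[-> ->].
    exists b, c, x, d; split=> //; right; split; first by rewrite Dbi.
    by rewrite I1 I2 I3 I4 !(mul0n, mul1n, muln0, muln1, addn0) /outb /inb; split; clear -h1 h2 hx R1 R2; lia.
  move=> /(shear_bd tb q2 (etrans Dbi si))[-> ->].
  exists a, c, x, d; split=> //; right; split; first by rewrite Dai.
  by rewrite I1 I2 I3 I4 !(mul0n, mul1n, muln0, muln1, addn0) /outb /inb; split; clear -h1 h2 hx R1 R2; lia.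
- have [x [[hx [E1 E2]]|[hx [E1 E2]]]] := outer_apex tD qD hr ir si.
  + have ha : (x <= n.+2)%N by have := edge_bounds tD (edge0_edge E1); rewrite /=; clear; lia.
    have [I1 I2 I3 I4] : [/\ (D i == (a, b)) = false, (D i == (b, c)) = false, (D i == (c, d)) = false & (D i == (a, d)) = true].
      by rewrite si !xpair_eqE; clear -h1 h2; split; lia.
    have q1 : quad Da a c d x.
      by apply: qA; rewrite ?E1 ?E2 ?g1 ?g2 ?g3 ?g4 ?eqxx ?orbT //; clear -h1 h2 hx ha; lia.
    have q2 : quad Db a b d x.
      by apply: qB; rewrite ?E1 ?E2 ?g1 ?g2 ?g3 ?g4 ?eqxx ?orbT //; clear -h1 h2 hx ha; lia.
    split=> o w.
      move=> /(shear_ac ta q1 (etrans Dai si))[-> ->].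
      exists a, b, d, x; split=> //; left; split; first by rewrite Dbi.
      by rewrite I1 I2 I3 I4 !(mul0n, mul1n, muln0, muln1, addn0) /outb /inb; split; clear -h1 h2 hx R1 R2; lia.
    move=> /(shear_ac tb q2 (etrans Dbi si))[-> ->].
    exists a, c, d, x; split=> //; left; split; first by rewrite Dai.
    by rewrite I1 I2 I3 I4 !(mul0n, mul1n, muln0, muln1, addn0) /outb /inb; split; clear -h1 h2 hx R1 R2; lia.
  + have ha := hx.
    have [I1 I2 I3 I4] : [/\ (D i == (a, b)) = false, (D i == (b, c)) = false, (D i == (c, d)) = false & (D i == (a, d)) = true].
      by rewrite si !xpair_eqE; clear -h1 h2; split; lia.
    have q1 : quad Da x a c d.
      by apply: qA; rewrite ?E1 ?E2 ?g1 ?g2 ?g3 ?g4 ?eqxx ?orbT //; clear -h1 h2 hx ha; lia.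
    have q2 : quad Db x a b d.
      by apply: qB; rewrite ?E1 ?E2 ?g1 ?g2 ?g3 ?g4 ?eqxx ?orbT //; clear -h1 h2 hx ha; lia.
    split=> o w.
      move=> /(shear_bd ta q1 (etrans Dai si))[-> ->].
      exists x, a, b, d; split=> //; right; split; first by rewrite Dbi.
      by rewrite I1 I2 I3 I4 !(mul0n, mul1n, muln0, muln1, addn0) /outb /inb; split; clear -h1 h2 hx R1 R2; lia.
    move=> /(shear_bd tb q2 (etrans Dbi si))[-> ->].
    exists x, a, c, d; split=> //; right; split; first by rewrite Dai.
    by rewrite I1 I2 I3 I4 !(mul0n, mul1n, muln0, muln1, addn0) /outb /inb; split; clear -h1 h2 hx R1 R2; lia.
Qed.

End Mutation.

End Lamination.

(** * Seeds and triangulations *)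

Section Realize.
Variable n : nat.
Local Notation K := (ratfun n).
Local Notation Xd := (@Xd n).
Implicit Types (D : 'I_n -> nat * nat) (S : seed (n + n + n) K).

Definition realize S D := [/\ sees (sq S) D, forall i, su S (xvertex i) = Xd (D i) &
  forall v : 'I_(n + n + n), (n <= v)%N -> su S v = indet v].

Lemma prod_expb (I : finType) (F : I -> K) (P : pred I) :
  \prod_i F i ^+ P i = \prod_(i | P i) F i.
Proof. by rewrite [RHS]big_mkcond; apply: eq_bigr => i _; case: (P i). Qed.

Lemma xvar_neq0 i : xvar i != 0 :> K.
Proof. by apply: (EV_neq0 (EV_x (fun=> 1) (fun=> 1) (fun=> 1) i)); rewrite oner_eq0. Qed.

Lemma yvar_neq0 i : yvar i != 0 :> K.
Proof. by apply: (EV_neq0 (EV_y (fun=> 1) (fun=> 1) (fun=> 1) i)); rewrite oner_eq0. Qed.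

Lemma zvar_neq0 i : zvar i != 0 :> K.
Proof. by apply: (EV_neq0 (EV_z (fun=> 1) (fun=> 1) (fun=> 1) i)); rewrite oner_eq0. Qed.

(** Boundary sides have lambda length 1. *)
Lemma Xd_edge D s : triangulation D -> edge D s -> \prod_i Xd (D i) ^+ (D i == s) = Xd s.
Proof.
move=> tD hs; have [inj hd _] := tD; rewrite prod_expb.
have nodiag : ~~ isdiag n s -> Xd s = 1 -> \prod_(i | D i == s) Xd (D i) = Xd s.
  by move=> ns ->; rewrite big_pred0 // => i; apply: contraNF ns => /eqP <-.
case: s hs nodiag => u v; rewrite /edge /chord => /or3P[|/eqP[-> ->] nodiag|/existsP[i /eqP <-] _].
- move=> /andP[/eqP ev hu] nodiag; rewrite /= in ev hu; subst v.
  rewrite nodiag //; first by rewrite /isdiag /= ltnn.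
  have [un|un] := leqP u n; first by apply: gX_side; [exact: xvar_neq0|exact: yvar_neq0|exact: zvar_neq0|].
  by have -> : u = n.+1 by [clear -hu un; lia]; apply: gX_siden.
- have X1 : Xd (0%N, n.+2) = 1 by apply: gX_side0.
  by rewrite nodiag // /isdiag /= !ltnn andbF.
- by rewrite (big_pred1 i) // => j; rewrite (inj_eq inj).
Qed.

Lemma prod_vertices (F : 'I_(n + n + n) -> K) : \prod_w F w =
  \prod_i F (xvertex i) * \prod_i F (yvertex i) * \prod_i F (zvertex i).
Proof. by rewrite !big_split_ord. Qed.

Lemma prod_exchange S D (g : 'I_(n + n + n) -> nat) (qy qz : 'I_n -> bool) s t : realize S D ->
  edge D s -> edge D t -> s != t -> (forall j, g (xvertex j) = (D j == s) || (D j == t)) ->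
  (forall j, g (yvertex j) = qy j) -> (forall j, g (zvertex j) = qz j) ->
  \prod_w su S w ^+ g w = Xd s * Xd t * \prod_(j | qy j) yvar j * \prod_(j | qz j) zvar j.
Proof.
move=> [[tD _ _] hx hf] hs ht st gx gy gz; rewrite prod_vertices; congr (_ * _ * _).
- rewrite -(Xd_edge tD hs) -(Xd_edge tD ht) -big_split /=.
  apply: eq_bigr => j _; rewrite hx gx -exprD; congr (_ ^+ _).
  by case: eqP => [->|] //; rewrite (negbTE st).
- by rewrite -[RHS]prod_expb; apply: eq_bigr => j _; rewrite gy hf //= leq_addr.
- by rewrite -[RHS]prod_expb; apply: eq_bigr => j _; rewrite gz hf //= -addnA leq_addr.
Qed.

(** The exchange relation is the Ptolemy relation of the quadrilateral. *)
Lemma realize_mut S D r : realize S D -> forall a b c d e, quad0 D r a b c d ->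
  (D r = (a, c) /\ e = (b, d)) \/ (D r = (b, d) /\ e = (a, c)) ->
  realize (seed_mut n (xvertex r) S) (flip D r e).
Proof.
move=> [sD hx hf] a b c d e qD he; have [tD hQ hF] := sD; have [_ hd _] := tD; have rS : realize S D by [].
have vr (v : 'I_(n + n + n)) : (n <= v)%N -> (v == xvertex r) = false.
  by move=> hv; apply/eqP => ev; move: hv; rewrite ev /= leqNgt ltn_ord.
split; last by move=> v hv /=; rewrite vr // hf.
  split; [exact: flip_tri qD he | exact: (sees_flip_mutable sD qD he) | exact: (sees_flip_frozen sD qD he)].
move=> i /=; rewrite (inj_eq (@xvertex_inj n)); have [->|ir] := eqVneq i r; last by rewrite hx flip_neq.
have qq := quad0_quad qD; have [h1 h2 [g1 g2] [g3 g4]] := qq.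
have yP (j : 'I_n) : (n <= yvertex j)%N by rewrite /= leq_addr.
have zP (j : 'I_n) : (n <= zvertex j)%N by rewrite /= -addnA leq_addr.
have lY (j : 'I_n) : lamP n (yvertex j) = j /\ lamR n (yvertex j) = n.+1.
  by rewrite /lamP /lamR /= ltn_add2l ltn_ord addKn.
have lZ (j : 'I_n) : lamP n (zvertex j) = j.+1 /\ lamR n (zvertex j) = n.+2.
  by rewrite /lamP /lamR /= ltnNge leq_addr /= addKn.
have nr s : s \in [:: (a, b); (b, c); (c, d); (a, d)] -> (D r == s) = false.
  move=> hs; apply/negbTE/negP => /eqP rs; subst s.
  by move: hs; rewrite !inE; clear -he h1 h2; case: he => -[-> _]; rewrite !xpair_eqE; lia.
have AC : D r = (a, c) -> forall j, (sq S (xvertex j) (xvertex r) = (D j == (b, c)) || (D j == (a, d))) /\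
    (sq S (xvertex r) (xvertex j) = (D j == (a, b)) || (D j == (c, d))).
  move=> er j; rewrite !hQ; have [->|jr] := eqVneq j r.
    rewrite !nr ?inE ?eqxx ?orbT // arr_irr //.
    by have := edge_bounds tD (chord_edge (D_chord D r)); lia.
  by have [h _] := arr_diag tD qD (D_edge0 D jr); have [-> ->] := h er.
have BD : D r = (b, d) -> forall j, (sq S (xvertex j) (xvertex r) = (D j == (a, b)) || (D j == (c, d))) /\
    (sq S (xvertex r) (xvertex j) = (D j == (b, c)) || (D j == (a, d))).
  move=> er j; rewrite !hQ; have [->|jr] := eqVneq j r.
    rewrite !nr ?inE ?eqxx ?orbT // arr_irr //.
    by have := edge_bounds tD (chord_edge (D_chord D r)); lia.
  by have [_ h] := arr_diag tD qD (D_edge0 D jr); have [-> ->] := h er.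
have ex := gX_exchange (@xvar n) (@zvar n) yvar_neq0.
have gIn : \prod_(j < n | inb a b c d j n.+1) yvar j * \prod_(j < n | inb a b c d j.+1 n.+2) zvar j =
    (if d == n.+2 then yprod (@yvar n) a b else 1) :> K.
  rewrite [X in _ * X]big_pred0 ?mulr1; last by move=> j; rewrite /inb; clear -h2; lia.
  case: eqP => ed; last by rewrite big_pred0 // => j; rewrite /inb; clear -h2 ed; lia.
  by apply: eq_bigl => j; rewrite /inb; clear -h2 ed; lia.
have gOut : \prod_(j < n | outb b c d j n.+1) yvar j * \prod_(j < n | outb b c d j.+1 n.+2) zvar j =
    (if d == n.+2 then 1 else yprod (@yvar n) b c) * zprod (@zvar n) b c :> K.
  congr (_ * _); last by apply: eq_bigl => j; rewrite /outb; clear -h2; lia.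
  case: eqP => ed; first by rewrite big_pred0 // => j; rewrite /outb; clear -h2 ed; lia.
  by apply: eq_bigl => j; rewrite /outb; clear -h2 ed; lia.
have ne1 : (b, c) != (a, d) by rewrite xpair_eqE; clear -h1; lia.
have ne2 : (a, b) != (c, d) by rewrite xpair_eqE; clear -h1; lia.
have bnd : [/\ a < b, b < c, c < d & d <= n.+2]%N by clear -h1 h2; split; lia.
have {bnd} ex : Xd (a, c) * Xd (b, d) = Xd (b, c) * Xd (a, d) * (\prod_(j < n | inb a b c d j n.+1) yvar j * \prod_(j < n | inb a b c d j.+1 n.+2) zvar j)
   + Xd (a, b) * Xd (c, d) * (\prod_(j < n | outb b c d j n.+1) yvar j * \prod_(j < n | outb b c d j.+1 n.+2) zvar j).
  by case: bnd => *; rewrite gIn gOut ex //; congr (_ + _); rewrite mulrC.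
rewrite hx flipE.
case: he => -[er ee].
- have FY j := shear_ac tD qq er (hF r _ (yP j)); have FZ j := shear_ac tD qq er (hF r _ (zP j)).
  rewrite (@prod_exchange S D _ (fun j => inb a b c d j n.+1) (fun j => inb a b c d j.+1 n.+2) (b, c) (a, d)) //;
    [|by move=> j; have [-> _] := AC er j|by move=> j; have [_ ->] := FY j; have [-> ->] := lY j
     |by move=> j; have [_ ->] := FZ j; have [-> ->] := lZ j].
  rewrite (@prod_exchange S D _ (fun j => outb b c d j n.+1) (fun j => outb b c d j.+1 n.+2) (a, b) (c, d)) //;
    [|by move=> j; have [_ ->] := AC er j|by move=> j; have [-> _] := FY j; have [-> ->] := lY j
     |by move=> j; have [-> _] := FZ j; have [-> ->] := lZ j].
  have := Xd_neq0 (hd r); rewrite ee er => X0; apply: (mulIf X0).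
  rewrite divfK //; transitivity (Xd (a, c) * Xd (b, d)); last exact: mulrC.
  by rewrite ex !mulrA.
- have FY j := shear_bd tD qq er (hF r _ (yP j)); have FZ j := shear_bd tD qq er (hF r _ (zP j)).
  rewrite (@prod_exchange S D _ (fun j => outb b c d j n.+1) (fun j => outb b c d j.+1 n.+2) (a, b) (c, d)) //;
    [|by move=> j; have [-> _] := BD er j|by move=> j; have [_ ->] := FY j; have [-> ->] := lY j
     |by move=> j; have [_ ->] := FZ j; have [-> ->] := lZ j].
  rewrite (@prod_exchange S D _ (fun j => inb a b c d j n.+1) (fun j => inb a b c d j.+1 n.+2) (b, c) (a, d)) //;
    [|by move=> j; have [_ ->] := BD er j|by move=> j; have [-> _] := FY j; have [-> ->] := lY j
     |by move=> j; have [-> _] := FZ j; have [-> ->] := lZ j].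
  have := Xd_neq0 (hd r); rewrite ee er => X0; apply: (mulIf X0).
  rewrite divfK //; transitivity (Xd (a, c) * Xd (b, d)); last by [].
  by rewrite ex addrC !mulrA.
Qed.

Definition same_image D D' := forall e, [exists i, D i == e] = [exists i, D' i == e].

Lemma same_image_edge D D' : same_image D D' -> edge D =1 edge D'.
Proof. by move=> h e; rewrite /edge /chord h. Qed.

Lemma same_image_quad D D' a b c d : same_image D D' -> quad D a b c d -> quad D' a b c d.
Proof. by move=> /same_image_edge h [h1 h2 h3 h4]; split; rewrite -?h. Qed.

(** The initial triangulation: all diagonals end at the last vertex *)
Definition fan (i : 'I_n) : nat * nat := (i.+1, n.+2).

Lemma fan_tri : triangulation fan.
Proof.
split=> [i j [] /val_inj //|i|i j]; last by rewrite /crossd /fan /= !ltnn !andbF.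
by rewrite /isdiag /fan /=; have := ltn_ord i; clear; lia.
Qed.

Lemma fan_edge j : (0 < j < n.+1)%N -> edge fan (j, n.+2).
Proof.
move=> hj; have hj' : (j.-1 < n)%N by lia.
apply/chord_edge/orP; right; apply/existsP; exists (Ordinal hj').
by apply/eqP; rewrite /fan /=; congr (_, _); lia.
Qed.

Lemma fan_quad (i : 'I_n) : quad fan i i.+1 i.+2 n.+2.
Proof.
have hi := ltn_ord i; split; [lia|lia|by split; rewrite /edge /= eqxx; lia|].
split; last by have [->|i0] := posnP i; [rewrite /edge /chord eqxx orbT | apply: fan_edge; lia].
by have [e|ne] := eqVneq i.+1 n; [rewrite /edge /= e eqxx ltnSn | apply: fan_edge; lia].
Qed.

Lemma biframed_xx (i j : 'I_n) : biframedA (xvertex i) (xvertex j) = arrowA i j.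
Proof.
rewrite /biframedA; congr nat_of_bool.
have xz (u v : 'I_n) : (xvertex u == zvertex v) = false.
  by apply/negbTE/eqP => /(congr1 val) /=; have := ltn_ord u; lia.
have xy (u v : 'I_n) : (xvertex u == yvertex v) = false.
  by apply/negbTE/eqP => /(congr1 val) /=; have := ltn_ord u; lia.
apply/idP/idP => [/or3P[/existsP[u /existsP[v]]|/existsP[u]|/existsP[u]]|h].
- by rewrite !(inj_eq (@xvertex_inj n)) => /and3P[/eqP-> /eqP->].
- by rewrite xz.
- by rewrite xy andbF.
- by apply/or3P; apply: Or31; apply/existsP; exists i; apply/existsP; exists j; rewrite !eqxx.
Qed.

Lemma initial_realize : realize (initial_seed n) fan.
Proof.
have xX (u : 'I_n) (v : 'I_(n + n + n)) : (n <= v)%N -> (v == xvertex u) = false.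
  by move=> hv; apply/negbTE/eqP => /(congr1 val) /= e; have := ltn_ord u; lia.
split=> [|i|v _] //; last by rewrite /= /Xd /gX /fan /= eqxx xx_ord.
split; first exact: fan_tri.
  move=> i j; rewrite /= biframed_xx; congr nat_of_bool.
  rewrite /arrowA /arr /fan /= !ltnn eqxx !andbF /=.
  have -> : edge fan (j.+1, i.+1) = (i.+1 == j.+2).
    rewrite /edge /chord [_ == (0%N, _)](introF eqP) //.
    rewrite (_ : [exists l, _] = false) ?orbF /=; last first.
      by apply/negbTE/existsP => -[l /eqP[_ e]]; have := ltn_ord i; lia.
    by have := ltn_ord i; case: eqP => //=; lia.
  rewrite /edge /chord /=.
  have := ltn_ord i; have := ltn_ord j; clear; lia.
move=> i v hv; exists i, i.+1, i.+2, n.+2; split; first exact: fan_quad.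
right; split=> //; rewrite /inb /outb /= /biframedA.
have -> : [exists i0, [exists j, [&& xvertex i == xvertex i0, v == xvertex j & arrowA i0 j]]] = false.
  by apply/negbTE/existsP => -[u /existsP[w]]; rewrite (xX _ v) // andbF.
have -> : [exists i0, [exists j, [&& v == xvertex i0, xvertex i == xvertex j & arrowA i0 j]]] = false.
  by apply/negbTE/existsP => -[u /existsP[w]]; rewrite xX.
have -> : [exists i0, (xvertex i == zvertex i0) && (v == xvertex i0)] = false.
  by apply/negbTE/existsP => -[u]; rewrite (xX _ v) // andbF.
have -> : [exists i0, (v == xvertex i0) && (xvertex i == yvertex i0)] = false.
  by apply/negbTE/existsP => -[u]; rewrite xX.
have -> : [exists i0, (xvertex i == xvertex i0) && (v == yvertex i0)] = (v == yvertex i).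
  apply/existsP/idP => [[u]|]; first by rewrite (inj_eq (@xvertex_inj n)) => /andP[/eqP->].
  by exists i; rewrite eqxx.
have -> : [exists i0, (v == zvertex i0) && (xvertex i == xvertex i0)] = (v == zvertex i).
  apply/existsP/idP => [[u]|]; first by rewrite (inj_eq (@xvertex_inj n)) => /andP[h /eqP->].
  by exists i; rewrite eqxx andbT.
have -> : (v == yvertex i) = (v == n + i :> nat)%N by [].
have -> : (v == zvertex i) = (v == n + n + i :> nat)%N by [].
rewrite orbF /lamP /lamR; have := ltn_ord i; have := ltn_ord v; clear -hv.
by case: ifP => h1 h2 h3; split; congr nat_of_bool; lia.
Qed.

Lemma mutable_xvertex (r : 'I_(n + n + n)) : ~~ frozen n r -> exists i, r = xvertex i.
Proof.
rewrite /frozen -ltnNge => h; exists (Ordinal h); exact: val_inj.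
Qed.

Lemma mutation_realize S : mutation_equivalent n (initial_seed n) S -> exists D, realize S D.
Proof.
elim=> [|{}S r _ [D hD] /mutable_xvertex[i ->]]; first by exists fan; apply: initial_realize.
have [[tD _ _] _ _] := hD; have [a [b [c [d [q h]]]]] := quad_ex tD i.
have q0 := quad_quad0 q h.
by case: h => h; eexists; apply: (realize_mut hD q0); [left|right].
Qed.

(** Conversely every triangulation is reached: the longest diagonal which does
    not end at the last vertex can be flipped to one which does. *)
Lemma realize_reach D : triangulation D -> exists S D',
  [/\ mutation_equivalent n (initial_seed n) S, realize S D' & same_image D D'].
Proof.
have [m] := ubnP #|[pred i | (D i).2 != n.+2]|; elim: m D => // m IHm D hm tD.
have [inj hd nc] := tD.
have [[i0 hi0]|no] := classic (exists i, (D i).2 != n.+2); last first.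
  exists (initial_seed n), fan; split; [exact: mut_refl | exact: initial_realize |].
  have hD i : (D i).2 = n.+2 /\ (0 < (D i).1 < n.+1)%N.
    have e : (D i).2 = n.+2 by apply/eqP; apply: contraT => h; case: no; exists i.
    by have := hd i; rewrite /isdiag e; split=> //; lia.
  have hu i : ((D i).1.-1 < n)%N by have [_] := hD i; lia.
  pose u i := Ordinal (hu i).
  have Du i : D i = fan (u i).
    by have [] := hD i; rewrite /fan /u /=; case: (D i) => d1 d2 /= -> /andP[d0 _]; rewrite prednK.
  have uinj : injective u by move=> i j e; apply: inj; rewrite !Du e.
  have [v uv vu] := injF_bij uinj.
  move=> e; apply/existsP/existsP => -[i /eqP <-]; first by exists (u i); rewrite Du.
  by exists (v i); rewrite Du vu.
pose len i := ((D i).2 - (D i).1)%N.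
have [i hi maxi] := arg_maxnP (P := fun i => (D i).2 != n.+2) len hi0.
have [a [b [c [d [q h]]]]] := quad_ex tD i.
have q0 := quad_quad0 q h; have [h1 h2 [g1 g2] [g3 g4]] := q.
have long u v : edge D (u, v) -> (u.+1 < v < n.+2)%N -> (v - u <= len i)%N.
  move=> /or3P[|/eqP[]|/existsP[j /eqP ej]]; [rewrite /=; lia|lia|move=> huv].
  by have := maxi j; rewrite /len ej /=; apply; lia.
have [ei dn] : D i = (a, c) /\ d = n.+2.
  move: (long a d g4) hi; rewrite /len; case: h => -> /=; first by split=> //; lia.
  by lia.
have {}h : (D i = (a, c) /\ (b, d) = (b, d)) \/ (D i = (b, d) /\ (b, d) = (a, c)) by left.
have tf := flip_tri tD q0 h.
have [|S [D1 [mS rS sD]]] := IHm (flip D i (b, d)) _ tf.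
  rewrite ltnS in hm; apply: leq_trans hm; apply: proper_card; apply/properP; split.
    apply/subsetP => j; rewrite !inE /flip; have [_|//] := eqVneq j i; by rewrite /= dn eqxx.
  by exists i; rewrite !inE ?hi // flipE /= dn eqxx.
have /existsP[j /eqP ej] : [exists j, D1 j == (b, d)] by rewrite -sD; apply/existsP; exists i; rewrite flipE.
have q1 : quad D1 a b c d by apply: same_image_quad sD _; apply: (@quad0_quad _ _ i); apply: quad0_flip.
have [[[inj1 hd1 nc1] _ _] _ _] := rS.
exists (seed_mut n (xvertex j) S), (flip D1 j (a, c)); split.
- by apply: mut_step => //; rewrite frozen_x.
- by apply: (realize_mut rS (quad_quad0 q1 (or_intror ej))); right.
move=> e; apply/existsP/existsP => -[l /eqP <-] {e}.
- have [->|li] := eqVneq l i; first by exists j; rewrite flipE ei.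
  have /existsP[t /eqP et] : [exists t, D1 t == D l] by rewrite -sD; apply/existsP; exists l; rewrite flip_neq.
  exists t; rewrite flip_neq ?et //; apply/eqP => tj; subst t; move: et; rewrite ej => et.
  have [inj' _ _] := tf; suff /inj' : flip D i (b, d) l = flip D i (b, d) i by apply/eqP.
  by rewrite flipE flip_neq.
- have [->|lj] := eqVneq l j; first by exists i; rewrite flipE ei.
  have /existsP[t /eqP et] : [exists t, flip D i (b, d) t == D1 l] by rewrite sD; apply/existsP; exists l.
  rewrite flip_neq //; exists t; rewrite -et flip_neq //; apply/eqP => ti; subst t.
  by move: et lj; rewrite flipE -ej => /inj1->; rewrite eqxx.
Qed.

End Realize.

(** * A triangulation is determined by its labelled quiver *)

Section Rigidity.
Variable n : nat.
Implicit Types (Q : quiver (n + n + n)) (D : 'I_n -> nat * nat).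

Lemma sees_z Q D D' i P : sees Q D -> sees Q D' -> (0 < P <= n)%N ->
  exists o w, shear D i P n.+2 o w /\ shear D' i P n.+2 o w.
Proof.
move=> [_ _ h] [_ _ h'] hP; have hp : (P.-1 < n)%N by lia.
have hv : (n <= zvertex (Ordinal hp))%N by rewrite /= -addnA leq_addr.
have := h i _ hv; have := h' i _ hv; rewrite /lamP /lamR /= ltnNge leq_addr /= addKn prednK; last by lia.
by move=> s' s; eexists _, _; split; [apply: s|apply: s'].
Qed.

Lemma sees_y Q D D' i P : sees Q D -> sees Q D' -> (P < n)%N ->
  exists o w, shear D i P n.+1 o w /\ shear D' i P n.+1 o w.
Proof.
move=> [_ _ h] [_ _ h'] hP.
have hv : (n <= yvertex (Ordinal hP))%N by rewrite /= leq_addr.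
have := h i _ hv; have := h' i _ hv; rewrite /lamP /lamR /= ltn_add2l hP addKn.
by move=> s' s; eexists _, _; split; [apply: s|apply: s'].
Qed.

(** The frozen arrows determine the type of the quadrilateral of a diagonal, its
    two middle vertices and, if it contains the last vertex, its first vertex. *)
Lemma shear_data Q D D' i : sees Q D -> sees Q D' -> exists a b c d a' d',
  [/\ quad D a b c d, quad D' a' b c d',
    (D i = (a, c) /\ D' i = (a', c)) \/ (D i = (b, d) /\ D' i = (b, d')),
    (d == n.+2) = (d' == n.+2) & d = n.+2 -> a = a'].
Proof.
move=> sD sD'; have [tD _ _] := sD; have [tD' _ _] := sD'.
have [a [b [c [d [q h]]]]] := quad_ex tD i; have [a' [b' [c' [d' [q' h']]]]] := quad_ex tD' i.
have HZ P := @sees_z Q D D' i P sD sD'; have HY P := @sees_y Q D D' i P sD sD'.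
have [k1 k2 _ _] := q; have [k1' k2' _ _] := q'.
case: h => ei; case: h' => ei'.
- have Z P : (0 < P <= n)%N -> (b <= P < c)%N = (b' <= P < c')%N.
    move=> /HZ[o [w [/(shear_ac tD q ei)[-> _] /(shear_ac tD' q' ei')[e _]]]].
    by move: e; rewrite /outb; clear -k2 k2'; lia.
  have [eb ec] : b = b' /\ c = c'.
    by have := Z b; have := Z b'; have := Z c.-1; have := Z c'.-1; clear -k1 k2 k1' k2'; lia.
  subst b' c'; exists a, b, c, d, a', d'.
  have Y P : (P < n)%N -> ((b <= P < c)%N && (d <= n.+1)%N = (b <= P < c)%N && (d' <= n.+1)%N) /\
      ((a <= P < b)%N && (c <= n.+1 < d)%N = (a' <= P < b)%N && (c <= n.+1 < d')%N).
    move=> /HY[o [w [/(shear_ac tD q ei)[-> ->] /(shear_ac tD' q' ei')[e1 e2]]]].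
    by move: e1 e2; rewrite /inb /outb; clear; lia.
  have ed : (d == n.+2) = (d' == n.+2) by have := Y b.-1; clear -k1 k2 k1' k2'; lia.
  by split; [..|left|exact: ed|have := Y a; have := Y a'; clear -k1 k2 k1' k2'; lia].
- exfalso; have := HZ b; case; first by clear -k1 k2; lia.
  move=> o [w [/(shear_ac tD q ei)[-> _] /(shear_bd tD' q' ei')[e _]]].
  by move: e; rewrite /outb /inb; clear -k1 k2 k1' k2'; lia.
- exfalso; have := HZ b'; case; first by clear -k1' k2'; lia.
  move=> o [w [/(shear_bd tD q ei)[-> _] /(shear_ac tD' q' ei')[e _]]].
  by move: e; rewrite /outb /inb; clear -k1 k2 k1' k2'; lia.
- have Z P : (0 < P <= n)%N -> (b <= P < c)%N = (b' <= P < c')%N.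
    move=> /HZ[o [w [/(shear_bd tD q ei)[_ ->] /(shear_bd tD' q' ei')[_ e]]]].
    by move: e; rewrite /outb; clear -k2 k2'; lia.
  have [eb ec] : b = b' /\ c = c'.
    by have := Z b; have := Z b'; have := Z c.-1; have := Z c'.-1; clear -k1 k2 k1' k2'; lia.
  subst b' c'; exists a, b, c, d, a', d'.
  have Y P : (P < n)%N -> ((b <= P < c)%N && (d <= n.+1)%N = (b <= P < c)%N && (d' <= n.+1)%N) /\
      ((a <= P < b)%N && (c <= n.+1 < d)%N = (a' <= P < b)%N && (c <= n.+1 < d')%N).
    move=> /HY[o [w [/(shear_bd tD q ei)[-> ->] /(shear_bd tD' q' ei')[e1 e2]]]].
    by move: e1 e2; rewrite /inb /outb; clear; lia.
  have ed : (d == n.+2) = (d' == n.+2) by have := Y b.-1; clear -k1 k2 k1' k2'; lia.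
  by split; [..|right|exact: ed|have := Y a; have := Y a'; clear -k1 k2 k1' k2'; lia].
Qed.

(** The remaining vertex is found through the triangle behind the diagonal, whose
    long side is a longer diagonal. *)
Lemma sees_inj Q D D' : sees Q D -> sees Q D' -> D =1 D'.
Proof.
move=> sD sD' i; have [tD hQ _] := sD; have [tD' hQ' _] := sD'.
pose len j := ((D j).2 - (D j).1)%N.
have [m] := ubnP (n.+2 - len i)%N; elim: m i => // m IHm i hm.
have [a [b [c [d [a' [d' [q q' h hd ha]]]]]]] := shear_data i sD sD'.
have [k1 k2 [g1 g2] [g3 g4]] := q; have [k1' k2' _ _] := q'.
have [ed|nd] := eqVneq d n.+2.
  have ea := ha ed; have /eqP ed' : d' == n.+2 by rewrite -hd ed.
  by case: h => -[-> ->]; rewrite ?ea // ed ed'.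
have [j ej] : exists j, D j = (a, d).
  move: g4 => /or3P[|/eqP[]|/existsP[j /eqP]]; [rewrite /=; lia|by move=> _ e; rewrite e eqxx in nd|by exists j].
have lj : (len i < len j)%N by rewrite /len ej; case: h => -[-> _] /=; clear -k1 k2; lia.
have ej' : D' j = (a, d).
  by rewrite -ej; symmetry; apply: IHm; move: lj hm; rewrite /len ej /=; clear -k1 k2; lia.
have [a0 [b0 [c0 [d0 [a0' [d0' [q0 q0' h0 _ _]]]]]]] := shear_data j sD sD'.
have [l1 l2 _ _] := q0; have [l1' l2' _ _] := q0'.
have ij : i != j by apply: contraTneq lj => ->; rewrite ltnn.
have hr : D j = (a0, c0) \/ D j = (b0, d0) by case: h0 => -[-> _]; [left|right].
have hr' : D' j = (a0', c0) \/ D' j = (b0, d0') by case: h0 => -[_ ->]; [left|right].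
have [A1 A2] := arr_diag tD (quad_quad0 q0 hr) (D_edge0 D ij).
have [B1 B2] := arr_diag tD' (quad_quad0 q0' hr') (D_edge0 D' ij).
case: h => -[ei ei'].
- have : arr (edge D) (D j) (D i) by rewrite /arr ei ej /= eqxx g3; clear -k2; lia.
  move=> ar; have ar' : arr (edge D') (D' j) (D' i) by move: (hQ j i) (hQ' j i) => ->; rewrite ar; case: arr.
  case: h0 => -[ej0 ej0'].
  + have [_ E] := A1 ej0; have [_ E'] := B1 ej0'; rewrite {}E ei ej in ej0 ar ; rewrite {}E' ei' in ar'.
    move: ej0' ej0 ar ar'; rewrite ej' ei ei' !xpair_eqE => -[u1 u2] [v1 v2].
    by clear -k1 k2 k1' k2' l1 l2 l1' l2' u1 u2 v1 v2 => *; congr (_, _); lia.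
  + have [_ E] := A2 ej0; have [_ E'] := B2 ej0'; rewrite {}E ei ej in ej0 ar ; rewrite {}E' ei' in ar'.
    move: ej0' ej0 ar ar'; rewrite ej' ei ei' !xpair_eqE => -[u1 u2] [v1 v2].
    by clear -k1 k2 k1' k2' l1 l2 l1' l2' u1 u2 v1 v2 => *; congr (_, _); lia.
- have : arr (edge D) (D i) (D j) by rewrite /arr ei ej /= eqxx g1; clear -k1; lia.
  move=> ar; have ar' : arr (edge D') (D' i) (D' j) by move: (hQ i j) (hQ' i j) => ->; rewrite ar; case: arr.
  case: h0 => -[ej0 ej0'].
  + have [E _] := A1 ej0; have [E' _] := B1 ej0'; rewrite {}E ei ej in ej0 ar ; rewrite {}E' ei' in ar'.
    move: ej0' ej0 ar ar'; rewrite ej' ei ei' !xpair_eqE => -[u1 u2] [v1 v2].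
    by clear -k1 k2 k1' k2' l1 l2 l1' l2' u1 u2 v1 v2 => *; congr (_, _); lia.
  + have [E _] := A2 ej0; have [E' _] := B2 ej0'; rewrite {}E ei ej in ej0 ar ; rewrite {}E' ei' in ar'.
    move: ej0' ej0 ar ar'; rewrite ej' ei ei' !xpair_eqE => -[u1 u2] [v1 v2].
    by clear -k1 k2 k1' k2' l1 l2 l1' l2' u1 u2 v1 v2 => *; congr (_, _); lia.
Qed.

(** The isomorphism relabels the second triangulation; as it fixes the frozen
    vertices, both have the same labelled quiver. *)
Theorem seed_determined (S S' : seed (n + n + n) (ratfun n)) D D' (phi : {perm 'I_(n + n + n)}) :
  realize S D -> realize S' D' -> ice_quiver_iso n (sq S) (sq S') phi -> forall v, su S' (phi v) = su S v.
Proof.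
move=> [sD xD fD] [sD' xD' fD'] [fphi ephi].
have hp i : exists j, phi (xvertex i) = xvertex j.
  apply: mutable_xvertex; apply/negP => hf; have := fphi _ hf => /perm_inj e.
  by move: hf; rewrite e frozen_x.
have [p hp'] := fin_all_exists hp.
have pinj : injective p by move=> i j e; apply: (@xvertex_inj n); apply: (@perm_inj _ phi); rewrite !hp' e.
pose D2 i := D' (p i).
have [g pg gp] := injF_bij pinj.
have im : same_image D' D2.
  move=> e; apply/existsP/existsP => -[i ei]; last by exists (p i).
  by exists (g i); rewrite /D2 gp.
have [[inj hd nc] hQ hF] := sD'.
have s2 : sees (sq S) D2.
  split; first by split=> [i j /inj/pinj|i|i j] //; [apply: hd|apply: nc].
    move=> i j; rewrite -ephi ?frozen_x // !hp' hQ /arr.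
    by rewrite !(same_image_edge im).
  move=> i v hv; have := hF (p i) v hv.
  have -> : sq S' (xvertex (p i)) v = sq S (xvertex i) v by rewrite -ephi ?frozen_x // hp' fphi.
  have -> : sq S' v (xvertex (p i)) = sq S v (xvertex i) by rewrite -ephi ?frozen_x ?andbF // hp' fphi.
  move=> [a [b [c [d [q h]]]]]; exists a, b, c, d; split=> //.
  exact: same_image_quad im q.
have e := sees_inj sD s2.
move=> v; have [hv|/mutable_xvertex[i ->]] := boolP (frozen n v).
  by rewrite fphi // fD // fD'.
by rewrite hp' xD xD' e.
Qed.

End Rigidity.

(** * The cluster character of an interval module *)

Section Euler.
Variable n : nat.

Lemma euler_simple_r (f : 'I_n -> int) r :
  euler_form f (dim_simple r) = f r - \sum_(i | arrowA i r) f i.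
Proof.
rewrite /euler_form /dim_simple; congr (_ - _).
  rewrite (bigD1 r) //= eqxx mulr1 big1 ?addr0 // => i /negbTE->; exact: mulr0.
rewrite [RHS]big_mkcond; apply: eq_bigr => i _; rewrite big_mkcond (bigD1 r) //= eqxx mulr1.
by rewrite big1 ?addr0 // => j /negbTE->; rewrite mulr0; case: ifP.
Qed.

Lemma euler_simple_l (f : 'I_n -> int) r :
  euler_form (dim_simple r) f = f r - \sum_(j | arrowA r j) f j.
Proof.
rewrite /euler_form /dim_simple; congr (_ - _).
  rewrite (bigD1 r) //= eqxx mul1r big1 ?addr0 // => i /negbTE->; exact: mul0r.
rewrite (bigD1 r) //= [X in _ + X]big1 ?addr0; last first.
  by move=> i /negbTE->; rewrite big1 // => j _; rewrite mul0r.
by apply: eq_bigr => j _; rewrite eqxx mul1r.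
Qed.

Lemma sum_arrow_r (F : nat -> bool) (r : 'I_n) : (forall t, F t -> (t < n)%N) ->
  \sum_(i | arrowA i r) ((F i : nat)%:Z) = (F r.+1 : nat)%:Z.
Proof.
move=> hF; have [rn|rn] := ltnP r.+1 n.
  by rewrite (big_pred1 (Ordinal rn)) // => i; apply/eqP/eqP => [h|->//]; apply: val_inj.
rewrite big_pred0; last by move=> i; rewrite /arrowA; have := ltn_ord i; lia.
by case h : (F r.+1) => //; have := hF _ h; lia.
Qed.

Lemma sum_arrow_l (F : nat -> bool) (r : 'I_n) :
  \sum_(j | arrowA r j) ((F j : nat)%:Z) = ((0 < r)%N && F r.-1 : nat)%:Z.
Proof.
have [r0|r0] := posnP r.
  by rewrite big_pred0 // => i; rewrite /arrowA r0.
have rn : (r.-1 < n)%N by have := ltn_ord r; lia.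
by rewrite (big_pred1 (Ordinal rn)) ?r0 // => i; apply/eqP/eqP => [h|->] /=; [apply: val_inj => /=|]; lia.
Qed.

End Euler.

Section ChiPoints.
Variables (k : closedFieldType) (chi : nat -> (seq k -> Prop) -> int).
Hypothesis hchi : is_euler_characteristic chi.

Definition ones (N : nat) (s : seq k) := s = nseq N 1.

Lemma ones_formula N : exists f : GRing.formula k, forall s,
  GRing.holds s f <-> forall i, (i < N)%N -> s`_i = 1.
Proof.
elim: N => [|N [f hf]]; first by exists (GRing.Bool true) => s /=; split.
exists (GRing.And f (GRing.Equal (GRing.Var _ N) (GRing.Const 1))) => s /=; split.
  move=> [/hf h e] i; rewrite ltnS leq_eqVlt => /orP[/eqP->//|]; exact: h.
by move=> h; split; [apply/hf => i iN; apply: h; exact: ltnW | apply: h].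
Qed.

Lemma constructible_ones N : constructible N (ones N).
Proof.
have [f hf] := ones_formula N; exists f => s; split=> [->|[sN /hf h]].
  rewrite size_nseq; split=> //; apply/hf => i iN; by rewrite nth_nseq iN.
apply: (@eq_from_nth _ 0); rewrite ?size_nseq // sN => i iN.
by rewrite h // nth_nseq iN.
Qed.

Lemma chi_empty N : chi N (fun=> False) = 0.
Proof.
have c0 : constructible N (fun _ : seq k => False).
  by exists (GRing.Bool false) => s /=; split=> // -[].
have := chi_add hchi c0 c0; rewrite (@chi_ext _ _ hchi N _ (fun=> False)); last by move=> s; split=> // -[].
by move=> /(_ _)h; apply: (@addrI _ (chi N (fun=> False))); rewrite addr0 -h // => s [].
Qed.

(** A point of k^N is in bijection with that of k^0, and the product of the line
    with the latter is the line. *)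
Lemma chi_ones N : chi N (ones N) = 1.
Proof.
have p0 : chi 0%N (ones 0) = 1.
  have cl : constructible 1 (fun s : seq k => size s = 1%N).
    by exists (GRing.Bool true) => s /=; split=> [->|[]].
  have := chi_mul hchi cl (constructible_ones 0).
  rewrite (@chi_ext _ _ hchi _ _ (fun s => size s = 1%N)); last first.
    move=> s; split=> [[t [t' [st -> ->]]]|hs]; first by rewrite cats0.
    by exists s, [::]; rewrite cats0.
  by rewrite (chi_line hchi) mul1r => <-.
rewrite -p0; apply/esym; apply: (chi_bij hchi (G := fun _ _ => True)).
- exact: constructible_ones.
- exact: constructible_ones.
- have [f hf] := constructible_ones N; exists f => s; rewrite add0n -hf.
  split=> [[t [t' [-> -> _ ->]]] //|hs].
  by exists [::], s; split.
- move=> t _; exists (nseq N 1); split=> // t' [-> //].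
- move=> t _; exists [::]; split=> // t' [-> //].
Qed.

End ChiPoints.

Section Interval.
Variables (k : closedFieldType) (n : nat) (chi : nat -> (seq k -> Prop) -> int) (i j : nat).
Hypotheses (hchi : is_euler_characteristic chi) (hij : (i.+1 < j)%N) (hj : (j <= n.+1)%N).
Local Notation V := (intv k n i j).

Lemma flatten_ones (T : Type) (s : seq T) (f : T -> nat) :
  flatten [seq nseq (f v) (1 : k) | v <- s] = nseq (\sum_(v <- s) f v) 1.
Proof. by elim: s => [|v s IHs] /=; rewrite ?big_nil // IHs big_cons nseqD. Qed.

Lemma allpairs_ones (S T : Type) (s : seq S) (t : seq T) :
  [seq (1 : k) | _ <- s, _ <- t] = nseq (size s * size t) 1.
Proof.
elim: s => [|x s IHs] //=; rewrite IHs mulSn nseqD; congr (_ ++ _).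
by elim: t {IHs} => //= y t ->.
Qed.

Lemma rref_bool (a b : bool) (U : 'M[k]_(a : nat, b : nat)) : (a -> b) -> is_rref U <-> U = const_mx 1.
Proof.
case: a U => U h; last first.
  split=> [_|_]; first by apply/matrixP => -[].
  by exists (fun x : 'I_0 => match x with Ordinal m hm => False_rect _ (notF hm) end); split=> -[].
have {}h := h isT; case: b h U => // _; change (forall U : 'M[k]_1, is_rref U <-> U = const_mx 1) => U; split=> [[c [_ _ h]]|->].
  by apply/matrixP => x y; rewrite !ord1 mxE; have := h 0 0; rewrite !ord1 eqxx.
by exists id; split=> [x y|x y|x y]; rewrite !ord1 // mxE eqxx.
Qed.

(** The submodules of M(i,j) are supported on i+1, ..., c, as arrows decrease the
    vertex. *)
Definition low (c v : nat) := (i <= v < c)%N.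

Lemma quiver_Gr_low c s : (i <= c < j)%N ->
  quiver_Gr V (fun v => low c v : nat) s <-> ones (quiver_Gr_dim V (fun v => low c v : nat)) s.
Proof.
move=> hc; have ls (v : nat) : low c v -> insupp i j v by rewrite /low /insupp; lia.
have key : flatten [seq [seq (const_mx 1 : 'M[k]_(low c v : nat, insupp i j v : nat)) x y | x <- enum 'I_(low c v), y <- enum 'I_(insupp i j v)]
     | v : 'I_n <- enum 'I_n] = nseq (quiver_Gr_dim V (fun v => low c v : nat)) 1.
  rewrite /quiver_Gr_dim -big_enum -flatten_ones; congr flatten; apply: eq_map => v.
  rewrite -[in RHS](size_enum_ord (low c v)) -[in RHS](size_enum_ord (rdim V v)) -allpairs_ones.
  by apply: eq_allpairs => x y; rewrite mxE.
split=> [[U [hr hc' ->]]|->].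
  rewrite /ones -key; congr flatten; apply: eq_map => v; apply: eq_allpairs => x y.
  by have -> : U v = const_mx 1 by apply/(@rref_bool (low c v) (insupp i j v)); [exact: ls | exact: hr].
exists (fun v => const_mx 1); split=> [v|u v a|].
- by apply/(@rref_bool (low c v) (insupp i j v)); first exact: ls.
- have uv : u = v.+1 :> nat by apply/eqP.
  have -> : (const_mx 1 : 'M[k]_(low c u : nat, insupp i j u : nat)) *m ract V a =
     (const_mx 1 : 'M[k]_(low c u : nat, low c v : nat)) *m (const_mx 1 : 'M[k]_(low c v : nat, insupp i j v : nat)).
    have [/andP[lu sv]|h] := boolP (low c u && insupp i j v); last exact: cm_bound.
    have su := ls _ lu; have lv : low c v by move: lu sv; rewrite /low /insupp uv; lia.
    by rewrite /= !cmM.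
  exact: submxMl.
- by rewrite -key.
Qed.

Lemma quiver_Gr_ex (eb : nat -> bool) s : (forall v : nat, eb v -> insupp i j v) ->
  quiver_Gr V (fun v => eb v : nat) s -> exists2 c, (i <= c < j)%N & forall v, eb v = low c v.
Proof.
move=> es [U [hr hc _]].
have step t : insupp i j t -> eb t.+1 -> eb t.
  move=> st et; have := es _ et; rewrite /insupp => h.
  have tn : (t.+1 < n)%N by lia.
  have a : arrowA (Ordinal tn) (Ordinal (ltnW tn)) by rewrite /arrowA.
  have /submxP[W] := hc _ _ a.
  have -> : U (Ordinal tn) = const_mx 1.
    by apply/(@rref_bool (eb t.+1) (insupp i j t.+1)); [exact: es | exact: (hr (Ordinal tn))].
  have E := @cmM k (eb t.+1) (insupp i j t.+1) (insupp i j t) (es _ et).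
  apply: contraPT => nt; rewrite /= in E *; rewrite E => /matrixP e.
  have e1 : (0 < eb t.+1)%N by rewrite et.
  have e2 : (0 < insupp i j t)%N by rewrite st.
  have := e (Ordinal e1) (Ordinal e2); rewrite !mxE big1 ?oner_eq0 //; first by move/eqP; rewrite oner_eq0.
  by move=> [x hx]; exfalso; move: hx; rewrite /= (negbTE nt).
have exP : exists t, (i <= t)%N && ~~ eb t.
  exists j.-1; apply/andP; split; first by lia.
  by apply/negP => /es; rewrite /insupp; lia.
have [c /andP[ic nc] minc] := ex_minnP exP.
exists c.
  rewrite ic; have : (c <= j.-1)%N; last by lia.
  by apply: minc; apply/andP; split; [lia|apply/negP => /es; rewrite /insupp; lia].
have up d : ~~ eb (c + d)%N.
  elim: d => [|d IHd]; first by rewrite addn0.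
  apply: contra IHd; rewrite addnS => h; apply: step => //.
  by have := es _ h; rewrite /insupp; lia.
move=> v; rewrite /low; have [iv|vi] := leqP i v; last first.
  by apply/negbTE/negP => /es; rewrite /insupp; lia.
have [vc|cv] := ltnP v c; last by apply/negbTE; rewrite -(subnKC cv).
by apply: contraTT vc => nv; rewrite -leqNgt minc // iv.
Qed.

Local Notation K := (ratfun n).
Local Notation ind_e := {dffun forall v : 'I_n, 'I_(rdim V v).+1}.

Definition low_e (c : nat) : ind_e := finfun (fun v : 'I_n => inord (low c v) : 'I_(rdim V v).+1).

Lemma low_eE c v : (c < j)%N -> (low_e c v : nat) = low c v.
Proof.
move=> cj; rewrite /low_e ffunE inordK // /= /low /insupp.
have := ltn_ord v; lia.
Qed.

Definition mono (e : ind_e) : K := \prod_(r < n)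
  (xvar r ^ (- euler_form (fun v => (e v)%:Z) (dim_simple r)
             - euler_form (dim_simple r) (fun v => (rdim V v)%:Z - (e v)%:Z))
   * yvar r ^+ e r * zvar r ^+ (rdim V r - e r)).

Lemma prod_xx c : \prod_(r < n) xvar r ^ ((r.+1 == c : nat)%:Z) = xx (@xvar n) c :> K.
Proof. exact: (prod_expb (@xvar n) (fun r : 'I_n => r.+1 == c)). Qed.

Lemma prod_xxV c : \prod_(r < n) xvar r ^ (- (r.+1 == c : nat)%:Z) = (xx (@xvar n) c)^-1 :> K.
Proof. by rewrite -prod_xx -prodfV; apply: eq_bigr => r _; rewrite invr_expz. Qed.

Lemma prod_exprz (f : 'I_n -> K) (a b : 'I_n -> int) : (forall r, f r != 0) ->
  \prod_r f r ^ (a r + b r) = \prod_r f r ^ a r * \prod_r f r ^ b r.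
Proof. by move=> h; rewrite -big_split; apply: eq_bigr => r _; rewrite expfzDr. Qed.

Lemma mono_field (F : fieldType) (xi xj xc xd Yi Yc Zj Zc : F) : xc != 0 -> xd != 0 -> Yi != 0 -> Zc != 0 ->
  xi * xj * (xc^-1 * xd^-1) * (Yc / Yi) * (Zj / Zc) = xi * xj * Zj / Yi * (Yc / (Zc * xc * xd)).
Proof. by move=> h1 h2 h3 h4; field; rewrite h1 h2 h3 h4. Qed.

(** The exponent of x telescopes: apart from x_i and x_j, only the boundary of the
    submodule contributes, with the factors x_c and x_(c+1) in the denominator. *)
Lemma mono_low c : (i <= c < j)%N -> mono (low_e c) =
  xx (@xvar n) i * xx (@xvar n) j * Zp (@zvar n) j.-1 / Yp (@yvar n) i * wt (@xvar n) (@yvar n) (@zvar n) c.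
Proof.
move=> hc; have cj : (c < j)%N by lia.
have lown t : low c t -> (t < n)%N by rewrite /low; lia.
have dn t : insupp i j t && ~~ low c t -> (t < n)%N by rewrite /insupp; lia.
have E1 (r : 'I_n) : \sum_(v | arrowA v r) (low_e c v : nat)%:Z = (low c r.+1 : nat)%:Z.
  by rewrite -(@sum_arrow_r n (low c) r) //; apply: eq_bigr => v _; rewrite low_eE.
have E2 (r : 'I_n) : \sum_(v | arrowA r v) ((rdim V v)%:Z - (low_e c v : nat)%:Z) =
    ((0 < r)%N && (insupp i j r.-1 && ~~ low c r.-1) : nat)%:Z.
  rewrite -(@sum_arrow_l n (fun v => insupp i j v && ~~ low c v)); apply: eq_bigr => v _.
  by rewrite low_eE //= /insupp /low; lia.
rewrite /mono; under eq_bigr => r _.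
  rewrite euler_simple_r euler_simple_l E1 E2 !low_eE //=.
  rewrite (_ : - _ - _ = (r.+1 == i : nat)%:Z + (r.+1 == j : nat)%:Z + (- (r.+1 == c : nat)%:Z + - (r.+1 == c.+1 : nat)%:Z)); last first.
    by rewrite /insupp /low; have := ltn_ord r; move: (r : nat) => {}r; clear -hc hij hj; lia.
  over.
have z0 c' := Zp_neq0 (@zvar_neq0 n) c'; have y0 c' := Yp_neq0 (@yvar_neq0 n) c'.
have x0 c' := xx_neq0 (@xvar_neq0 n) c'; have xn r := @xvar_neq0 n r.
rewrite !big_split /= prod_exprz // prod_exprz // prod_exprz // !prod_xx.
rewrite !prod_xxV prod_expb.
have -> : \prod_(r < n | low c r) yvar r = Yp (@yvar n) c / Yp (@yvar n) i :> K.
  rewrite (@Yp_split _ _ _ i c); last by lia.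
  by rewrite [Yp _ i * _]mulrC mulfK.
have -> : \prod_(r < n) zvar r ^+ (insupp i j r - low c r) = Zp (@zvar n) j.-1 / Zp (@zvar n) c :> K.
  rewrite (@Zp_split _ _ _ c.+1 j); last by lia.
  rewrite [Zp _ _ * _]mulrC mulfK // /zprod -[RHS]prod_expb; apply: eq_bigr => r _; congr (_ ^+ _).
  by rewrite /insupp /low; clear -hc; lia.
by apply: mono_field.
Qed.

Theorem CC_intv : CC_formula chi V = gX (@xvar n) (@yvar n) (@zvar n) (i, j).
Proof.
rewrite /CC_formula /gX /= (_ : (j == n.+2) = false); last by apply/eqP; lia.
rewrite mulr_sumr; transitivity (\sum_(i <= c < j) mono (low_e c)); last first.
  by apply: eq_big_seq => c; rewrite mem_index_iota => /mono_low.
have us : uniq [seq low_e c | c <- index_iota i j].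
  rewrite map_inj_in_uniq ?iota_uniq // => c c'; rewrite !mem_index_iota => hc hc' e.
  have E (v : 'I_n) : low c v = low c' v :> nat by rewrite -!low_eE ?e //; lia.
  have [lt|lt|//] := ltngtP c c'.
    have cn : (c < n)%N by lia.
    by have := E (Ordinal cn); rewrite /low /=; lia.
  have cn : (c' < n)%N by lia.
  by have := E (Ordinal cn); rewrite /low /=; lia.
rewrite -(big_map low_e xpredT mono) (big_uniq _ us) /= [RHS]big_mkcond; apply: eq_bigr => e _.
have [/mapP[c]|ne] := ifP.
  rewrite mem_index_iota => hc ->.
  have -> : (fun v => low_e c v : nat) = (fun v : 'I_n => low c v : nat).
    by apply: functional_extensionality => v; rewrite low_eE //; lia.
  rewrite (chi_ext hchi _ (fun s => quiver_Gr_low s hc)) chi_ones // mul1r.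
  by [].
rewrite (@chi_ext _ _ hchi _ _ (fun=> False)) ?chi_empty ?mul0r // => s; split=> // hG.
pose eb t := [exists v : 'I_n, (v == t :> nat) && (e v == 1 :> nat)].
have ebE (v : 'I_n) : eb v = (e v == 1 :> nat).
  apply/existsP/idP => [[w /andP[/eqP/val_inj-> ]]//|h]; by exists v; rewrite eqxx.
have eE : (fun v => e v : nat) = (fun v : 'I_n => eb v : nat).
  apply: functional_extensionality => v; rewrite ebE.
  by case: (e v) => -[|[|m]] //= hm; move: hm; case: (insupp i j v).
have es (v : nat) : eb v -> insupp i j v.
  case/existsP => w /andP[/eqP <- /eqP]; case: (e w) => m /= hm m1; move: hm; rewrite m1.
  by case: (insupp i j w).
move: hG; rewrite eE => /quiver_Gr_ex[//|c hc ec].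
move/negP: ne; apply; apply/mapP; exists c; rewrite ?mem_index_iota //.
apply/ffunP => v; apply: val_inj; change ((e v : nat) = low_e c v); rewrite low_eE -?ec; last by lia.
exact: (congr1 (fun f : 'I_n -> nat => f v) eE).
Qed.

Lemma rep_iso_dim (U W : rep k n) v : rep_iso U W -> rdim U v = rdim W v.
Proof.
move=> [f [g [fg gf]]]; apply/eqP; rewrite eqn_leq.
by rewrite (mulmx1_min (fg v)) (mulmx1_min (gf v)).
Qed.

Lemma zero_dim_mx (p q : nat) (A B : 'M[k]_(p, q)) : p = 0%N \/ q = 0%N -> A = B.
Proof. by case=> e; subst; apply/matrixP => [[]] // ? ? []. Qed.

(** In a decomposition the vertices of the support which belong to one summand
    are closed under neighbours, since the arrows act by isomorphisms. *)
Lemma intv_indecomposable : rep_indecomposable V.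
Proof.
have iN : (i < n)%N by lia.
split.
  by move/(_ (Ordinal iN)); rewrite /= /insupp leqnn hij.
move=> A B iso; have dm v := rep_iso_dim v iso; rewrite /= in dm.
have step (v u : 'I_n) : u = v.+1 :> nat -> insupp i j v -> insupp i j u -> rdim A u = rdim A v.
  move=> uv sv su; have a : arrowA u v by rewrite /arrowA uv.
  have := dm v; have := dm u; rewrite sv su => du dv.
  have [//|ne] := eqVneq (rdim A u) (rdim A v).
  have [f [g [fg gf]]] := iso; exfalso.
  have z : ract (rsum A B) a = 0.
    rewrite /= (@zero_dim_mx _ _ (ract A a) 0); last by lia.
    by rewrite (@zero_dim_mx _ _ (ract B a) 0) ?block_mx0 //; lia.
  have : ract V a = 0 by rewrite -[LHS]mulmx1 -(fg v) mulmxA (rmapP f) z mulmx0 mul0mx.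
  move=> /matrixP e.
  have e1 : (0 < insupp i j u)%N by rewrite su.
  have e2 : (0 < insupp i j v)%N by rewrite sv.
  by have := e (Ordinal e1) (Ordinal e2); rewrite !mxE => /eqP; rewrite oner_eq0.
have const (v : 'I_n) : insupp i j v -> rdim A v = rdim A (Ordinal iN).
  case: v => v; elim: v => [|v IHv] hv sv.
    by congr rdim; apply: val_inj => /=; move: sv; rewrite /insupp /=; lia.
  have [e|ne] := eqVneq i v.+1; first by congr rdim; apply: val_inj.
  have sv' : insupp i j v by move: sv; rewrite /insupp /=; lia.
  by rewrite -(IHv (ltnW hv) sv'); apply: step.
have [A0|A1] := eqVneq (rdim A (Ordinal iN)) 0%N; [left|right] => v.
  have [sv|nv] := boolP (insupp i j v); first by rewrite const.
  by have := dm v; rewrite (negbTE nv) /=; lia.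
have [sv|nv] := boolP (insupp i j v); last by have := dm v; rewrite (negbTE nv) /=; lia.
by have := dm v; have := const v sv; rewrite sv /=; lia.
Qed.

End Interval.

(** * Diagonals and indecomposable objects of the cluster category *)

Section Fundamental.
Variable n : nat.
Implicit Types (L V : label n) (d : nat * nat).

Lemma fund_ok d : isdiag n d ->
  ((if d.2 == n.+2 then 0 else d.1).+1 < (if d.2 == n.+2 then d.1.+1 else d.2))%N &&
  ((if d.2 == n.+2 then d.1.+1 else d.2) <= n.+1)%N.
Proof. by rewrite /isdiag; case: eqP; lia. Qed.

(** The diagonal (i,j) with j <= n+1 stands for the module M(i,j), and (b,n+2)
    for the shifted projective module with top at the b-th vertex. *)
Definition fund d (hd : isdiag n d) : label n :=
  @Label n (if d.2 == n.+2 then -3%:Z else -2%:Z) _ _ (fund_ok hd).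

Lemma lF_lsh L : lF (lsh L) = lsh (lF L).
Proof.
apply: label_eq; rewrite /= /ltau_q /ltau_i /ltau_j //=.
by case: ifP => _; lia.
Qed.

Lemma iterlF_lsh m L : iter m (@lF n) (lsh L) = lsh (iter m (@lF n) L).
Proof. by elim: m => //= m ->; apply: lF_lsh. Qed.

Lemma homl_iterlF m L V : homl (iter m (@lF n) L) (iter m (@lF n) V) = homl L V.
Proof. by elim: m => //= m; rewrite homl_lF. Qed.

Lemma lq_lF L : lq (lF L) = lq L - 1 \/ lq (lF L) = lq L - 2.
Proof. rewrite /= /ltau_q; case: ifP => _; lia. Qed.

Lemma lq_iterlF m L : lq (iter m (@lF n) L) <= lq L - m%:Z.
Proof. elim: m => [|m IHm] /=; first by lia. by rewrite /ltau_q; case: ifP => _; lia. Qed.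

(** The functor F lowers the degree by one or two, so that its powers and their
    inverses move every label to the fundamental domain. *)
Lemma fund_ex L : exists d (hd : isdiag n d) x y, iter x (@lF n) L = iter y (@lF n) (fund hd).
Proof.
have mod V : lq V = -2%:Z -> exists d (hd : isdiag n d), V = fund hd.
  move=> e; have := lok V => ok.
  have hd : isdiag n (li V, lj V) by rewrite /isdiag /=; lia.
  exists _, hd; apply: label_eq; rewrite /= ?e; case: eqP => //; lia.
have pro V : lq V = -3%:Z -> li V = 0%N -> exists d (hd : isdiag n d), V = fund hd.
  move=> e e0; have := lok V => ok.
  have hd : isdiag n ((lj V).-1, n.+2) by rewrite /isdiag /=; lia.
  exists _, hd; apply: label_eq; rewrite /= ?eqxx ?e ?e0 //; lia.
have base V : (exists d (hd : isdiag n d), V = fund hd) ->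
    exists d (hd : isdiag n d) x y, iter x (@lF n) V = iter y (@lF n) (fund hd).
  by move=> [d [hd ->]]; exists d, hd, 0%N, 0%N.
have [m] := ubnP (absz (lq L + 2%:Z)%R); elim: m L => // m IHm L hm.
have [e|ne] := eqVneq (lq L) (-2%:Z); first by apply/base/mod.
have ok := lok L.
have [lt|ge] := boolP (lq L < -2%:Z)%R.
  have [/andP[/eqP e /eqP e0]|nf] := boolP ((lq L == -3%:Z) && (li L == 0%N)); first by apply/base/pro.
  have [V eV qV] : exists2 V, L = lF V & lq V = lq L + 1 \/ lq V = lq L + 2%:Z /\ li L = 0%N.
    have [i0|i0] := posnP (li L).
      have ok' : ((lj L).-2.+1 < n.+1)%N && (n.+1 <= n.+1)%N by lia.
      exists (@Label n (lq L + 2%:Z) _ _ ok'); last by right.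
      by apply: label_eq; rewrite /= /ltau_q /ltau_i /ltau_j /= ltnn; lia.
    have ok' : ((li L).-1.+1 < (lj L).-1)%N && ((lj L).-1 <= n.+1)%N by lia.
    exists (@Label n (lq L + 1) _ _ ok'); last by left.
    have h : ((lj L).-1 <= n)%N by lia.
    by apply: label_eq; rewrite /= /ltau_q /ltau_i /ltau_j /= h; lia.
  have [|d [hd [x [y e]]]] := IHm V.
    by case: qV => [|[]] qV; lia.
  by exists d, hd, x, y.+1; rewrite /= -e eV -iterSr.
have red V : lF L = V -> (exists d (hd : isdiag n d) x y, iter x (@lF n) V = iter y (@lF n) (fund hd)) ->
   exists d (hd : isdiag n d) x y, iter x (@lF n) L = iter y (@lF n) (fund hd).
  by move=> <- [d [hd [x [y e]]]]; exists d, hd, x.+1, y; rewrite iterSr.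
apply: (red _ erefl).
have [e|ne'] := eqVneq (lq L) (-1%:Z); last by apply: IHm; have := lq_lF L; lia.
apply: base; have [h|h] := leqP (lj L) n.
  by apply: mod; rewrite /= /ltau_q h e.
have {}h : (lj L <= n)%N = false by lia.
by apply: pro; rewrite /= /ltau_q /ltau_i h ?e.
Qed.

(** The vanishing of Ext^1 in the orbit category, for labels *)
Definition compat L V := forall a b, ~~ homl (iter a (@lF n) L) (iter b (@lF n) (lsh V)).

Lemma compat_orbitl x y L L' V : iter x (@lF n) L = iter y (@lF n) L' -> compat L' V -> compat L V.
Proof.
move=> e h a b; rewrite -(homl_iterlF x) -!iterD addnC iterD e -iterD.
exact: h.
Qed.

Lemma compat_orbitr x y L V V' : iter x (@lF n) V = iter y (@lF n) V' -> compat L V' -> compat L V.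
Proof.
move=> e h a b; rewrite -(homl_iterlF x) -!iterD [(x + b)%N]addnC [iter (b + x) _ _]iterD.
by rewrite [iter x _ (lsh V)]iterlF_lsh e -iterlF_lsh -iterD; apply: h.
Qed.

(** Only four degrees can contribute to extensions between objects of the
    fundamental domain. *)
Lemma compat_fund d d' (hd : isdiag n d) (hd' : isdiag n d') : compat (fund hd) (fund hd') <-> ~~ crossd d d'.
Proof.
set L := fund hd; set V := fund hd'.
(* fundamental labels have degrees -2 and -3, and their shifts -3 and -4 *)
have E : compat L V <-> [/\ ~~ homl L (lsh V), ~~ homl L (lF (lsh V)), ~~ homl (lF L) (lsh V) & ~~ homl (lF (lF L)) (lsh V)].
  split=> [h|[h1 h2 h3 h4] a b].
    by split; [apply: (h 0%N 0%N)|apply: (h 0%N 1%N)|apply: (h 1%N 0%N)|apply: (h 2%N 0%N)].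
  have [ab|ba] := leqP a b.
    rewrite -(subnKC ab) iterD homl_iterlF; move: (b - a)%N => m.
    case: m => [|[|m]] //; apply/negP; have := lq_iterlF m.+2 (lsh V).
    by rewrite /homl; move: (iter _ _ _) => W; rewrite /=; do 2!case: ifP => _; lia.
  rewrite -(subnKC (ltnW ba)) iterD homl_iterlF; have : (0 < a - b)%N by rewrite subn_gt0.
  move: (a - b)%N => m; case: m => [|[|[|m]]] // _; apply/negP; have := lq_iterlF m.+3 L.
  by rewrite /homl; move: (iter _ _ _) => W; rewrite /=; do 2!case: ifP => _; lia.
rewrite E {E}; move: hd hd' @L @V; rewrite /crossd; case: d d' => i j [i' j'] hd hd' /=.
move: (hd) (hd'); rewrite /isdiag /=.
rewrite /homl /= /ltau_q /ltau_i /ltau_j /= /ltau_q /ltau_i /ltau_j /=.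
have [ej|/negbTE nj] := eqVneq j n.+2; have [ej'|/negbTE nj'] := eqVneq j' n.+2; rewrite /= ?ej ?ej' /=;
  do ?[case: (leqP _ n) => ?] => /= k1 k2.
all: clear hd hd'; split=> [[c1 c2 c3 c4]|c]; [lia | split; lia].
Qed.

End Fundamental.

(** * Functors and direct sums *)

Section Biproducts.
Variables (k : fieldType) (n : nat).
Implicit Types (F : dfunctor k n) (I : eqType).

Lemma has_bip_functor F I (s : seq I) (T : I -> cplx k n) O :
  has_bip s T O -> has_bip s (fun i => F (T i)) (F O).
Proof.
move=> [io [pi [h1 h2 h3]]]; exists (fun i => dfmor F (io i)), (fun i => dfmor F (pi i)); split.
- by move=> i si; rewrite -dfmor_comp -dfmor_id; apply/dfmor_eq/h1.
- move=> i j si sj ij; rewrite -dfmor_comp -(dfmor0 F).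
  by apply/dfmor_eq/h2.
- rewrite -dfmor_id -(dfmor_eq F h3) dfmor_dsumm; apply: dsumm_eq => i si.
  by rewrite dfmor_comp.
Qed.

Lemma has_bip_iter F I (s : seq I) (T : I -> cplx k n) O m :
  has_bip s T O -> has_bip s (fun i => iter m F (T i)) (iter m F O).
Proof. by move=> h; elim: m => //= m; apply: has_bip_functor. Qed.

Lemma dhom0_bip I (s : seq I) (T T' : I -> cplx k n) O O' : has_bip s T O -> has_bip s T' O' ->
  dhom0 O O' <-> {in s &, forall i j, dhom0 (T i) (T' j)}.
Proof.
move=> [io [pi b]] [io' [pi' b']]; have [h1 h2 h3] := b; have [h1' h2' h3'] := b'; split=> h.
  move=> i j si sj f.
  rewrite -[f]deq_1comp -[f]deq_comp1 -(h1 _ si) -(h1' _ sj) -deq_compA.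
  rewrite (deq_compA f (pi i) (io i)) (deq_compA (io' j) _ (io i)).
  by rewrite (h (dcomp (io' j) (dcomp f (pi i)))) comp0d compd0.
move=> f; apply: (bip_eq0l b) => i si; apply: (bip_eq0r b') => j sj; exact: h.
Qed.

(** The sum of the idempotents in either order is the identity on every summand. *)
Lemma has_bip_perm I (s s' : seq I) (T : I -> cplx k n) O : uniq s -> perm_eq s s' ->
  has_bip s T O -> has_bip s' T O.
Proof.
move=> us ss [io [pi b]]; have [h1 h2 h3] := b; exists io, pi.
have ms : s =i s' by apply: perm_mem.
have us' : uniq s' by rewrite -(perm_uniq ss).
split=> [i|i j|]; rewrite -?ms; [exact: h1|exact: h2|].
apply: dadd_eq0; apply: (bip_eq0l b) => i si.
rewrite deq_compDl dsumm_compl (@dsumm1 _ _ _ _ _ _ _ i) //; last 2 first.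
- by rewrite -ms.
- move=> j sj ji; rewrite -deq_compA.
  have -> : deq (dcomp (pi j) (io i)) (dzero _ _) by apply: h2; rewrite // ?ms // eq_sym.
  exact: compd0.
by rewrite -deq_compA (h1 _ si) deq_comp1 dscale_compl deq_1comp daddN.
Qed.

Lemma has_bip_map I I' (s : seq I) (p : I -> I') (T : I' -> cplx k n) O : injective p ->
  has_bip (map p s) T O -> has_bip s (fun i => T (p i)) O.
Proof.
move=> pinj [io [pi [h1 h2 h3]]]; exists (fun i => io (p i)), (fun i => pi (p i)); split.
- by move=> i si; apply: h1; apply: map_f.
- by move=> i j si sj ij; apply: h2; rewrite ?map_f // (inj_eq pinj).
- by move: h3; rewrite /dsumm foldr_map.
Qed.

Lemma has_bip_osum (T : 'I_n -> cplx k n) : has_bip (index_enum 'I_n) T (osum T).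
Proof. by rewrite osumE; apply: has_bip_csums; apply: index_enum_uniq. Qed.

Lemma has_bip_osum_perm (T : 'I_n -> cplx k n) (p : 'I_n -> 'I_n) : injective p ->
  has_bip (index_enum 'I_n) (fun i => T (p i)) (osum T).
Proof.
move=> pinj; apply: has_bip_map => //; apply: has_bip_perm (has_bip_osum T); first exact: index_enum_uniq.
apply: uniq_perm; rewrite ?map_inj_uniq ?index_enum_uniq // => i.
have [q qp pq] := injF_bij pinj; rewrite mem_index_enum; symmetry.
by rewrite -(pq i) map_f // mem_index_enum.
Qed.

Lemma csum0_diso (M : cplx k n) : diso (csum M (cplx0 k n)) M.
Proof.
apply: (chain_diso (f := chain_prl M (cplx0 k n)) (g := chain_inl M (cplx0 k n))) => p v /=.
  rewrite mul_col_row mulmx1 mulmx0 !mul0mx [RHS]scalar_mx_block; congr block_mx.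
  by apply/matrixP => -[].
by rewrite mul_row_col mulmx1 mul0mx addr0.
Qed.

End Biproducts.

(** * Cluster characters of rigid objects *)

Section Character.
Variables (k : closedFieldType) (n : nat) (hn : (0 < n)%N).
Variables (chi : nat -> (seq k -> Prop) -> int) (T : dfunctor k n) (X : cplx k n -> ratfun n).
Hypotheses (hchi : is_euler_characteristic chi) (hT : is_AR_inverse T)
  (hX : is_cluster_character chi (tau_inv_shift T) X).
Local Notation F := (tau_inv_shift T).
Local Notation Xd := (@Xd n).
Implicit Types (A B : cplx k n) (L : label n) (d : nat * nat).

Lemma X_orbit A B : orbit_iso F A B -> X A = X B.
Proof. by case: hX => h _ _ _; apply: h. Qed.

Lemma diso_orbit A B : diso A B -> orbit_iso F A B.
Proof. by move=> h; apply: (@diso_orbit_iso k n F 0 0). Qed.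

Lemma X_diso A B : diso A B -> X A = X B.
Proof. by move/diso_orbit/X_orbit. Qed.

Lemma X_csum A B : X (csum A B) = X A * X B.
Proof. by case: hX. Qed.

Lemma X_cplx0 : X (cplx0 k n) = 1.
Proof.
have [_ _ hP _] := hX; pose i0 := Ordinal hn.
have := X_diso (csum0_diso (cshift (stalk (proj k i0)))); rewrite X_csum hP => h.
by apply: (mulfI (xvar_neq0 i0)); rewrite h mulr1.
Qed.

Lemma stalk_ind (V : rep k n) (q : int) : q = 0 -> diso (stalk V) (stk V q).
Proof.
move=> ->; unshelve apply: chain_diso.
- unshelve refine (@Chain k n (stalk V) (stk V 0) (fun t =>
    match t return rhom (stalk_ob V t) (dlt (t == 0) V) with
    | Posz 0 => rid V | Posz m.+1 => rzero _ _ | Negz m => rzero _ _ end) _).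
  by move=> p v; rewrite /= mulmx0 mul0mx.
- unshelve refine (@Chain k n (stk V 0) (stalk V) (fun t =>
    match t return rhom (dlt (t == 0) V) (stalk_ob V t) with
    | Posz 0 => rid V | Posz m.+1 => rzero _ _ | Negz m => rzero _ _ end) _).
  by move=> p v; rewrite /= mulmx0 mul0mx.
- by move=> [[|m]|m] v /=; rewrite ?mulmx1 //; apply/matrixP => -[].
- by move=> [[|m]|m] v /=; rewrite ?mulmx1 //; apply/matrixP => -[].
Qed.

Lemma X_fund d (hd : isdiag n d) : X (ind k (fund hd)) = Xd d.
Proof.
have [_ _ hP hV] := hX; case: d hd => i j hd; have h := hd; rewrite /isdiag /= in h.
have [ej|nj] := eqVneq j n.+2; last first.
  transitivity (X (stk (intv k n i j) 0)); first by congr X; rewrite /ind /= (negbTE nj).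
  rewrite -(X_diso (@stalk_ind _ 0 erefl)) hV; last by apply: intv_indecomposable; lia.
  by apply: CC_intv => //; lia.
have iN : (i.-1 < n)%N by lia.
have ok : (0.+1 < i.+1)%N && (i.+1 <= n.+1)%N by lia.
have e : fund hd = lsh (@Label n (-2%:Z) _ _ ok) by apply: label_eq; rewrite /= ej eqxx.
rewrite e -(X_diso (ind_lsh k _)) /ind /=.
have -> : intv k n 0 i.+1 = proj k (Ordinal iN).
  have -> : i.+1 = (i.-1).+2 by lia.
  by [].
rewrite -(X_diso (dfmor_diso (dshift k n) (@stalk_ind _ _ erefl))) hP.
rewrite -(xx_ord (@xvar n)); transitivity (gX (@xvar n) (@yvar n) (@zvar n) (i, j)); last by [].
by rewrite /gX /= ej eqxx; congr xx; lia.
Qed.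

(** A diagonal represents the object of a label if they lie in the same orbit. *)
Definition rep_by d L := exists (hd : isdiag n d) x y, iter x (@lF n) L = iter y (@lF n) (fund hd).

Lemma rep_by_diag d L : rep_by d L -> isdiag n d. Proof. by case. Qed.

Lemma rep_by_shift d L L' A B : rep_by d L -> rep_by d L' -> diso A (ind k L) -> diso B (ind k L') ->
  exists x y, diso (iter x F A) (iter y F B).
Proof.
move=> [hd [x [y e]]] [hd' [x' [y' e']]] hA hB; exists (y' + x)%N, (y + x')%N.
apply: diso_trans (iterF_diso T _ hA) _; apply: diso_trans (iterF_ind hT _ _) _.
apply: diso_sym; apply: diso_trans (iterF_diso T _ hB) _; apply: diso_trans (iterF_ind hT _ _) _.
have ed : fund hd = fund hd' by apply: label_eq.
by rewrite [iter (y' + x) _ _]iterD e [iter (y + x') _ _]iterD e' -!iterD ed addnC; apply: diso_refl.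
Qed.

Lemma rep_by_iso d L L' A B : rep_by d L -> rep_by d L' -> diso A (ind k L) -> diso B (ind k L') ->
  orbit_iso F A B.
Proof.
move=> h h' hA hB; have [x [y]] := rep_by_shift h h' hA hB; exact: diso_orbit_iso.
Qed.

Lemma X_ind d L : rep_by d L -> X (ind k L) = Xd d.
Proof.
move=> h; have [hd _] := h; rewrite -(X_fund hd); apply: X_orbit.
by apply: (rep_by_iso h _ (diso_refl _) (diso_refl _)); exists hd, 0%N, 0%N.
Qed.

(** The character turns a decomposition into a monomial in lambda lengths; the
    last clause keeps track of the label when there is only one summand. *)
Lemma X_decompose A : exists ls ds, [/\ diso A (csums ls (@ind k n)), all (isdiag n) ds,
  size ds = size ls, X A = \prod_(d <- ds) Xd d & forall l, [:: l] = ls -> exists2 d, rep_by d l & [:: d] = ds].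
Proof.
have [ls h] := decompose A; rewrite (X_diso h); exists ls.
suff [ds [h1 h2 h3 h4]] : exists ds, [/\ all (isdiag n) ds, size ds = size ls,
    X (csums ls (@ind k n)) = \prod_(d <- ds) Xd d & forall l, [:: l] = ls -> exists2 d, rep_by d l & [:: d] = ds].
  by exists ds; split.
elim: ls {h} => [|l ls [ds [h1 h2 h3 _]]].
  by exists [::]; rewrite big_nil X_cplx0.
have [d [hd [x [y e]]]] := fund_ex l; have hl : rep_by d l by exists hd, x, y.
exists (d :: ds); rewrite /= hd h2 X_csum h3 big_cons (X_ind hl); split=> //.
by move=> l' [-> e']; exists d => //; case: ds h2 {h1 h3} => //; rewrite -e'.
Qed.

Lemma diso_csums1 A L : diso A (csums [:: L] (@ind k n)) -> diso A (ind k L).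
Proof. by move=> h; apply: diso_trans h _; apply: csum0_diso. Qed.

(** A second summand would have a character different from 1, hence be nonzero. *)
Lemma indecomposable_rep A : orbit_indecomposable F A -> exists d L, diso A (ind k L) /\ rep_by d L.
Proof.
move=> [nA iA]; have [[|l ls] [ds [h1 h2 h3 h4 h5]]] := X_decompose A.
  by case: nA; apply: diso_orbit.
case: ls => [|l' ls] in h1 h3 h5 *; first by have [d hd _] := h5 l erefl; exists d, l; split=> //; apply: diso_csums1.
exfalso; have [d [hd [x [y e]]]] := fund_ex l; have hl : rep_by d l by exists hd, x, y.
have [] := iA _ _ (diso_orbit h1).
  move/X_orbit; rewrite (X_ind hl) X_cplx0 => X1.
  by have := @Xd_prod1 n [:: d]; rewrite /= hd big_seq1 => /(_ isT X1).
move/X_orbit; have [d' [hd' [x' [y' e']]]] := fund_ex l'; have hl' : rep_by d' l' by exists hd', x', y'.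
have [ls' [ds' [g1 g2 g3 g4 g5]]] := X_decompose (csums ls (@ind k n)).
rewrite /= X_csum (X_ind hl') g4 X_cplx0 => X1.
by have := @Xd_prod1 n (d' :: ds'); rewrite /= hd' g2 big_cons => /(_ isT X1).
Qed.

(** In a decomposition, the lambda length of d would be a product; so one factor is
    empty. *)
Lemma rep_indecomposable_orbit d L : rep_by d L -> orbit_indecomposable F (ind k L).
Proof.
move=> h; have hd := rep_by_diag h; split.
  move/X_orbit; rewrite (X_ind h) X_cplx0 => X1.
  by have := @Xd_prod1 n [:: d]; rewrite /= hd big_seq1 => /(_ isT X1).
move=> A B /X_orbit; rewrite (X_ind h) X_csum.
have [la [da [a1 a2 a3 a4 _]]] := X_decompose A; have [lb [db [b1 b2 b3 b4 _]]] := X_decompose B.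
rewrite a4 b4 -big_cat => e.
have := @Xd_indecomposable n d (da ++ db) hd; rewrite all_cat a2 b2 size_cat a3 b3 => /(_ isT e).
case: la a1 {a3} => [|? la] a1; first by left; apply: diso_orbit.
case: lb b1 {b3} => [|? lb] b1; first by right; apply: diso_orbit.
by rewrite /= addnS.
Qed.

Lemma ext_compat L L' : (forall a b, dhom0 (iter a F (ind k L)) (iter b F (cshift (ind k L')))) <-> compat L L'.
Proof.
have E a b : diso (iter a F (ind k L)) (ind k (iter a (@lF n) L)) /\
    diso (iter b F (cshift (ind k L'))) (ind k (iter b (@lF n) (lsh L'))).
  split; first exact: iterF_ind.
  exact: diso_trans (iterF_diso T b (ind_lsh k L')) (iterF_ind hT _ _).
split=> h a b; have [e1 e2] := E a b.
  apply/negP => /(@hom_ind1 k)[g [g0 _]]; apply: g0; exact: (dhom0_iso e1 e2 (h a b)).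
exact: (dhom0_iso (diso_sym e1) (diso_sym e2) (hom_ind0 (h a b))).
Qed.

Lemma compat_rep d d' L L' : rep_by d L -> rep_by d' L' -> compat L L' <-> ~~ crossd d d'.
Proof.
move=> [hd [x [y e]]] [hd' [x' [y' e']]]; rewrite -(compat_fund hd hd'); split=> h.
  by apply: (compat_orbitl (esym e)); apply: (compat_orbitr (esym e')).
by apply: (compat_orbitl e); apply: (compat_orbitr e').
Qed.

Lemma osum_rigid (O : 'I_n -> cplx k n) (L : 'I_n -> label n) D : (forall i, diso (O i) (ind k (L i))) ->
  (forall i, rep_by (D i) (L i)) -> orbit_Ext1_eq0 F (osum O) (osum O) <-> (forall i j, ~~ crossd (D i) (D j)).
Proof.
move=> hO hL; rewrite ext1_eq0; last exact: F_faithful.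
have b a : has_bip (index_enum 'I_n) (fun i => iter a F (O i)) (iter a F (osum O)).
  exact: has_bip_iter (has_bip_osum O).
have b' a : has_bip (index_enum 'I_n) (fun i => iter a F (cshift (O i))) (iter a F (cshift (osum O))).
  exact: has_bip_iter (has_bip_functor (dshift k n) (has_bip_osum O)).
have S i := dfmor_diso (dshift k n) (hO i).
split=> h.
  move=> i j; rewrite -(compat_rep (hL i) (hL j)) -ext_compat => a c.
  have /(dhom0_bip (b a) (b' c))/(_ i j (mem_index_enum i) (mem_index_enum j)) := h a c.
  by apply: dhom0_iso; apply: iterF_diso => //; exact: S.
move=> a c; apply/(dhom0_bip (b a) (b' c)) => i j _ _.
have /(compat_rep (hL i) (hL j))/ext_compat/(_ a c) := h i j.
by apply: dhom0_iso; apply: iterF_diso; [exact: diso_sym | exact: (diso_sym (S j))].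
Qed.

End Character.

(** * Cluster tilting objects and clusters *)

Section Tilting.
Variables (k : closedFieldType) (n : nat) (hn : (0 < n)%N).
Variables (chi : nat -> (seq k -> Prop) -> int) (T : dfunctor k n) (X : cplx k n -> ratfun n).
Hypotheses (hchi : is_euler_characteristic chi) (hT : is_AR_inverse T)
  (hX : is_cluster_character chi (tau_inv_shift T) X).
Local Notation F := (tau_inv_shift T).
Local Notation Xd := (@Xd n).
Implicit Types (O : 'I_n -> cplx k n) (D : 'I_n -> nat * nat).

Definition tilts O D := triangulation D /\
  exists L : 'I_n -> label n, forall i, diso (O i) (ind k (L i)) /\ rep_by (D i) (L i).

Lemma tilts_X O D i : tilts O D -> X (O i) = Xd (D i).
Proof.
by move=> [_ [L h]]; have [h1 h2] := h i; rewrite (X_diso hX h1) (X_ind hn hchi hT hX h2).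
Qed.

Lemma cluster_tilting_tilts O : cluster_tilting F O -> exists D, tilts O D.
Proof.
move=> [iO nO rO].
have [D hD] := fin_all_exists (fun i => indecomposable_rep hn hchi hT hX (iO i)).
have [L hL] := fin_all_exists hD; exists D; split; last by exists L.
have h1 i := proj1 (hL i); have h2 i := proj2 (hL i).
split=> [i j e|i|i j]; last first.
- exact: (proj1 (osum_rigid hT h1 h2) rO).
- exact: rep_by_diag (h2 i).
apply/eqP; apply: contraT => ij; case: (nO i j ij).
by have h2j := h2 j; rewrite -e in h2j; apply: (rep_by_iso hT (h2 i) h2j).
Qed.

Lemma triangulation_tilting D : triangulation D -> exists2 O, cluster_tilting F O & tilts O D.
Proof.
move=> tD; have [inj hd nc] := tD; pose L i := fund (hd i).
have hL i : rep_by (D i) (L i) by exists (hd i), 0%N, 0%N.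
have hO i : diso (ind k (L i)) (ind k (L i)) by apply: diso_refl.
have tO : tilts (fun i => ind k (L i)) D by split=> //; exists L.
exists (fun i => ind k (L i)) => //; split=> [i|i j ij h|].
- exact: (rep_indecomposable_orbit hn hchi hT hX (hL i)).
- have := X_orbit hX h; rewrite (tilts_X i tO) (tilts_X j tO) => /(Xd_inj (hd i) (hd j))/inj e.
  by rewrite e eqxx in ij.
- by apply/(osum_rigid hT hO hL).
Qed.

(** The cluster depends on the set of diagonals, not on their labelling *)
Lemma realize_cluster S O D D' : realize S D' -> tilts O D -> same_image D D' ->
  cluster_of S = tilting_cluster X O.
Proof.
move=> [_ hx hf] tO sD; apply/fsetP => u; rewrite !in_fsetU; apply/imfsetP/idP => /=.
- move=> [v _ ->]; have [|/mutable_xvertex[i ->]] := boolP (frozen n v).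
    move=> fv; rewrite hf //; have [w|w] := boolP (v < n + n)%N.
      have wn : (v - n < n)%N by move: fv w; rewrite /frozen; lia.
      apply/orP; right; apply/orP; left; apply/imfsetP; exists (Ordinal wn) => //=.
      by congr indet; apply: val_inj; rewrite /= subnKC.
    have wn : (v - (n + n) < n)%N by have := ltn_ord v; lia.
    apply/orP; right; apply/orP; right; apply/imfsetP; exists (Ordinal wn) => //=.
    by congr indet; apply: val_inj; rewrite /= subnKC //; lia.
  apply/orP; left; rewrite hx; have /existsP[j /eqP e] : [exists j, D j == D' i].
    by rewrite sD; apply/existsP; exists i.
  by apply/imfsetP; exists j => //=; rewrite (tilts_X j tO) e.
- case/orP => [/imfsetP[/= i _ ->]|/orP[/imfsetP[/= i _ ->]|/imfsetP[/= i _ ->]]].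
  + have /existsP[j /eqP e] : [exists j, D' j == D i] by rewrite -sD; apply/existsP; exists i.
    by exists (xvertex j) => //; rewrite hx e (tilts_X i tO).
  + by exists (yvertex i) => //; rewrite hf //= leq_addr.
  + by exists (zvertex i) => //; rewrite hf //= -addnA leq_addr.
Qed.

Lemma tilting_is_cluster O : cluster_tilting F O -> is_cluster n (initial_seed n) (tilting_cluster X O).
Proof.
move=> /cluster_tilting_tilts[D tO]; have [tD _] := tO.
have [S [D' [mS rS sD]]] := realize_reach tD.
by exists S => //; rewrite (realize_cluster rS tO sD).
Qed.

Lemma cluster_is_tilting c : is_cluster n (initial_seed n) c ->
  exists2 O, cluster_tilting F O & c = tilting_cluster X O.
Proof.
move=> [S mS ->]; have [D rS] := mutation_realize mS.
have [[tD _ _] _ _] := rS; have [O cO tO] := triangulation_tilting tD.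
by exists O => //; apply: realize_cluster rS tO _.
Qed.

Lemma X_osum O : X (osum O) = \prod_i X (O i).
Proof.
rewrite osumE -[RHS]/(\prod_(i <- index_enum 'I_n) X (O i)).
elim: (index_enum _) => [|i s IHs] /=; first by rewrite big_nil (X_cplx0 hn hX).
by rewrite (X_csum hX) IHs big_cons.
Qed.

Lemma tilting_cluster_sub O O' D D' i : tilts O D -> tilts O' D' ->
  tilting_cluster X O = tilting_cluster X O' -> exists j, D i = D' j.
Proof.
move=> tO tO' e; have [[_ hd _] _] := tO; have [[_ hd' _] _] := tO'.
have : X (O i) \in tilting_cluster X O' by rewrite -e; apply/fsetUP; left; apply/imfsetP; exists i.
rewrite (tilts_X i tO) => /fsetUP[/imfsetP[/= j _]|/fsetUP[/imfsetP[/= j _]|/imfsetP[/= j _]]].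
- by rewrite (tilts_X j tO') => /(Xd_inj (hd i) (hd' j)) ->; exists j.
- by move/(Xd_frozen (hd i)); case; rewrite /= leq_addr.
- by move/(Xd_frozen (hd i)); case; rewrite /= -addnA leq_addr.
Qed.

(** The character of the sum is the product of the lambda lengths, which determines
    the diagonals; conversely equal clusters have equal diagonals, hence summands in
    the same orbits. *)
Lemma tilting_iso O O' : cluster_tilting F O -> cluster_tilting F O' ->
  orbit_iso F (osum O) (osum O') <-> tilting_cluster X O = tilting_cluster X O'.
Proof.
move=> /cluster_tilting_tilts[D tO] /cluster_tilting_tilts[D' tO'].
have [[inj hd _] [L hL]] := tO; have [[inj' hd' _] [L' hL']] := tO'.
split=> [/(X_orbit hX)|e].
  rewrite !X_osum; under eq_bigr do rewrite (tilts_X _ tO); under [RHS]eq_bigr do rewrite (tilts_X _ tO').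
  move=> e; have E : [seq D i | i <- index_enum 'I_n] =i [seq D' i | i <- index_enum 'I_n].
    apply: (@prod_Xd_inj n); rewrite ?map_inj_uniq ?index_enum_uniq ?big_map //.
    - by apply/allP => d /mapP[i _ ->].
    - by apply/allP => d /mapP[i _ ->].
  rewrite /tilting_cluster; congr (_ `|` _)%fset; apply/fsetP => u.
  apply/imfsetP/imfsetP => -[/= i _ ->].
    have : D i \in [seq D' i | i <- index_enum 'I_n] by rewrite -E map_f ?mem_index_enum.
    by case/mapP => j _ e'; exists j => //; rewrite (tilts_X i tO) (tilts_X j tO') e'.
  have : D' i \in [seq D i | i <- index_enum 'I_n] by rewrite E map_f ?mem_index_enum.
  by case/mapP => j _ e'; exists j => //; rewrite (tilts_X i tO') (tilts_X j tO) e'.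
have [p hp] := fin_all_exists (fun i => tilting_cluster_sub i tO tO' e).
have pinj : injective p by move=> i j eij; apply: inj; rewrite !hp eij.
have H i : exists x y, diso (iter x F (O i)) (iter y F (O' (p i))).
  have [h1 r1] := hL i; have [h2 r2] := hL' (p i); rewrite -hp in r2.
  exact: (rep_by_shift hT r1 r2 h1 h2).
have [x hx] := fin_all_exists H; have [y hy] := fin_all_exists hx.
exact: (bip_orbit_iso (index_enum_uniq _) (has_bip_osum O) (has_bip_osum_perm O' pinj) hy).
Qed.

End Tilting.

Theorem corollary3p12 (k : closedFieldType) (n : nat) (hn : (0 < n)%N) :
  (forall S S' : seed (n + n + n) (ratfun n),
     mutation_equivalent n (initial_seed n) S ->
     mutation_equivalent n (initial_seed n) S' ->
     forall phi : {perm 'I_(n + n + n)},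
       ice_quiver_iso n (sq S) (sq S') phi ->
       forall v, su S' (phi v) = su S v)
  /\
  (forall (chi : nat -> (seq k -> Prop) -> int) (tau_inv : dfunctor k n)
          (X : cplx k n -> ratfun n),
     is_euler_characteristic chi ->
     is_AR_inverse tau_inv ->
     is_cluster_character chi (tau_inv_shift tau_inv) X ->
     [/\ forall T, cluster_tilting (tau_inv_shift tau_inv) T ->
           is_cluster n (initial_seed n) (tilting_cluster X T),
         forall T T', cluster_tilting (tau_inv_shift tau_inv) T ->
           cluster_tilting (tau_inv_shift tau_inv) T' ->
           (orbit_iso (tau_inv_shift tau_inv) (osum T) (osum T') <->
            tilting_cluster X T = tilting_cluster X T') &
         forall c, is_cluster n (initial_seed n) c ->
           exists2 T, cluster_tilting (tau_inv_shift tau_inv) T &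
             c = tilting_cluster X T]).
Proof.
split=> [S S' /mutation_realize[D rS] /mutation_realize[D' rS'] phi|chi T X hchi hT hX].
  exact: (seed_determined rS rS').
split.
- exact: (tilting_is_cluster hn hchi hT hX).
- exact: (tilting_iso hn hchi hT hX).
- exact: (cluster_is_tilting hn hchi hT hX).
Qed.
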